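(* Let $\Omega\subset\mathbb C$ be a bounded domain with $C^3$-boundary and let $G:\mathcal F_2\Omega\to\mathbb R$ satisfy Hypothesis (G) (stated in the context). For any $N\in\mathbb N$ and any $\Gamma\in\mathbb R^N$ which is $\mathcal L$-admissible, $\partial$-admissible and $\Delta$-admissible, the Kirchhoff--Routh path function $H_\Omega$ has a critical point in $\mathcal F_N\Omega$.
   Context: Identify $\mathbb C$ with $\mathbb R^2$; differentiability and gradients are meant in the real sense. For $M\in\mathbb N$, $\mathcal F_M\Omega:=\{z\in\Omega^M: z_i\neq z_j\text{ for }i\neq j\}$. For $\varepsilon>0$ put $\Omega_\varepsilon:=\{z\in\Omega:\operatorname{dist}(z,\partial\Omega)<\varepsilon\}$. Fix $\varepsilon_0>0$ so small that the orthogonal projection $p:\Omega_{\varepsilon_0}\to\partial\Omega$, $|p(z)-z|=\operatorname{dist}(z,\partial\Omega)$, is a well-defined $C^2$-map and the reflection $\bar z:=2p(z)-z$ of points $z\in\Omega_{\varepsilon_0}$ lies outside $\Omega$. Hypothesis (G): (i) $G$ is bounded below by a constant $C_0$; (ii) $(x,y)\mapsto G(x,y)+\frac1{2\pi}\ln|x-y|$ has a continuation $g\in C^1(\Omega^2)$ which is bounded above by some constant $C_1>0$; (iii) for every $\varepsilon>0$ there is $C_2>0$ depending only on $\Omega,\varepsilon$ with $|G(x,y)|+|\nabla_xG(x,y)|+|\nabla_yG(x,y)|\le C_2$ for all $x,y\in\Omega$ with $|x-y|\ge\varepsilon$; (iv) there is $C_3>0$ with $|\psi(x,y)|+|\nabla_x\psi(x,y)|+|\nabla_y\psi(x,y)|\le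 C_3$ for all $x,y\in\Omega_{\varepsilon_0}$, where $\psi(x,y)=g(x,y)-\frac1{2\pi}\ln|\bar x-y|$; (v) there is $C_4>0$ such that for any line $L=w+\mathbb Rv$ ($w\in\mathbb C$, $v\in S^1$) with $L\cap\Omega\ne\emptyset$, $G(w+rv,w+sv)-G(w+rv,w+tv)\ge -C_4$ for all $r<s<t$ for which the left-hand side is defined. With $h(x):=g(x,x)$, the Kirchhoff--Routh path function is $H_\Omega:\mathcal F_N\Omega\to\mathbb R$, $H_\Omega(z)=\sum_{j=1}^N\Gamma_j^2h(z_j)+\sum_{i,j=1,\,i\ne j}^N\Gamma_i\Gamma_jG(z_i,z_j)$. Admissibility of $\Gamma\in\mathbb R^N$ (sums over ordered pairs): - $\Delta$-admissible: $\sum_{i,j\in C,\,i\ne j}\Gamma_i\Gamma_j\ne0$ for every $C\subset\{1,\dots,N\}$, $|C|\ge2$. - $\partial$-admissible: $\sum_{i\in C}\Gamma_i^2>\sum_{i,j\in C,\,i\neq j}|\Gamma_i\Gamma_j|$ for every $C\subset\{1,\dots,N\}$, $|C|\ge2$; if $\Omega$ is strictly convex, this condition is replaced by the weaker one $\sum_{i\in C}\Gamma_i^2>\sum_{i,j\in C,\,\Gamma_i\Gamma_j<0}|\Gamma_i\Gamma_j|$ for every such $C$. - $\mathcal L$-admissible: there is a permutation $\sigma$ of $\{1,\dots,N\}$ such that, with $(\sigma\ast\Gamma)_j:=\Gamma_{\sigma^{-1}(j)}$ and $\iota(x):=((-1)^jx_j)_{j}$, either $\iota(\sigma\ast\Gamma)\in\overline{\Delta_N}$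 or $-\iota(\sigma\ast\Gamma)\in\overline{\Delta_N}$, where $\Delta_N:=\{t\in(0,\infty)^N:t_i<t_{i+1}\ \forall i\in\{1,\dots,N-1\}\}$ and the closure is taken in $(0,\infty)^N$ (so $\overline{\Delta_N}=\{t\in(0,\infty)^N:t_1\le\dots\le t_N\}$). *)

(* Defs.v *)
From HB Require Import structures.
From mathcomp Require Import all_boot all_order all_algebra all_fingroup.
From mathcomp Require Import all_classical all_reals all_analysis.

Set Implicit Arguments.
Unset Strict Implicit.
Unset Printing Implicit Defensive.

Import Order.TTheory GRing.Theory Num.Theory.
Import numFieldNormedType.Exports.

Local Open Scope classical_set_scope.
Local Open Scope ring_scope.

(** The plane is ['rV[R]_2], and a configuration of [N] points is an [N x 2]
    matrix whose rows are the points. The library's norm on matrices is the sup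
    norm: it is used only for the topology, boundedness and differentiability,
    for which the choice of norm is irrelevant. Distances and lengths are
    measured with [enorm].

    Functions that are mathematically defined on an open set only are total
    here; all conditions on them (and on their derivatives) are imposed at
    points of that open set, so their values elsewhere play no role. *)

Section Plane.
Context {R : realType}.
Notation plane := 'rV[R]_2.

Definition edot (u v : plane) : R := \sum_(j < 2) u 0 j * v 0 j.

Definition enorm (u : plane) : R := Num.sqrt (edot u u).

Definition edist (z : plane) (A : set plane) : R :=
  inf [set enorm (w - z) | w in A].

Definition boundary (A : set plane) : set plane := closure A `\` interior A.

Definition line (w v : plane) : set plane := [set w + r *: v | r in [set: R]].

Definition grad (f : plane -> R) (x : plane) : plane :=
  \row_(j < 2) 'd f x (delta_mx 0 j).

Definition strictly_convex (A : set plane) : Prop :=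
  forall (x y : plane) (t : R), closure A x -> closure A y -> x != y -> 0 < t < 1 ->
  interior A ((1 - t) *: x + t *: y).

End Plane.

(** [f] is of class [C^k] on the open set [U]. In finite dimension, continuity
    of the differential is continuity of all its directional evaluations. *)
Fixpoint Ck_on {R : realType} {V W : normedModType R} (k : nat) (U : set V)
    (f : V -> W) : Prop :=
  match k with
  | 0 => forall x, U x -> {for x, continuous f}
  | k'.+1 => (forall x, U x -> differentiable f x) /\
             (forall v, Ck_on k' U (fun x => 'd f x v))
  end.

Definition critical_point {R : realType} {V : normedModType R}
    (f : V -> R) (x : V) : Prop :=
  differentiable f x /\ forall v, 'd f x v = 0.

Section Domain.
Context {R : realType}.
Notation plane := 'rV[R]_2.

(** Near each boundary point, in suitable orthonormal coordinates centred
    there, [Omega] is the strict epigraph of a [C^k] function. *)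
Definition Ck_boundary (k : nat) (Omega : set plane) : Prop :=
  forall x0, boundary Omega x0 ->
  exists (r : R) (e1 e2 : plane) (gamma : R -> R),
    [/\ 0 < r,
        [/\ edot e1 e1 = 1, edot e2 e2 = 1 & edot e1 e2 = 0],
        Ck_on k [set: R] gamma &
        forall y, enorm (y - x0) < r ->
          (Omega y <-> gamma (edot (y - x0) e1) < edot (y - x0) e2)].

Definition bounded_domain (Omega : set plane) : Prop :=
  [/\ open Omega, connected Omega, Omega !=set0 & bounded_set Omega].

Definition collar (Omega : set plane) (eps : R) : set plane :=
  [set z | Omega z /\ edist z (boundary Omega) < eps].

Definition reflection (p : plane -> plane) (z : plane) : plane :=
  2 *: p z - z.

(** [eps0] is admissible and [p] is the orthogonal projection onto the
    boundary; the uniqueness clause says that it is well-defined. *)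
Definition boundary_projection (Omega : set plane) (eps0 : R)
    (p : plane -> plane) : Prop :=
  [/\ forall z, collar Omega eps0 z ->
        boundary Omega (p z) /\ enorm (p z - z) = edist z (boundary Omega),
      forall z w, collar Omega eps0 z -> boundary Omega w ->
        enorm (w - z) = edist z (boundary Omega) -> w = p z,
      Ck_on 2 (collar Omega eps0) p &
      forall z, collar Omega eps0 z -> ~ Omega (reflection p z)].

Definition config (N : nat) (Omega : set plane) : set 'M[R]_(N, 2) :=
  [set z | (forall i, Omega (row i z)) /\
           (forall i j, i != j -> row i z != row j z)].

Definition hypothesis_G (Omega : set plane) (eps0 : R) (p : plane -> plane)
    (G : plane -> plane -> R) (g : plane * plane -> R) : Prop :=
  let psi x y := g (x, y) - (2 * pi)^-1 * ln (enorm (reflection p x - y)) in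
  [/\ (exists C0 : R, forall x y, Omega x -> Omega y -> x != y -> C0 <= G x y),
      [/\ (forall x y, Omega x -> Omega y -> x != y ->
             g (x, y) = G x y + (2 * pi)^-1 * ln (enorm (x - y))),
          Ck_on 1 (Omega `*` Omega) g &
          exists2 C1 : R, 0 < C1 &
            forall x y, Omega x -> Omega y -> g (x, y) <= C1],
      (forall eps : R, 0 < eps -> exists2 C2 : R, 0 < C2 &
         forall x y, Omega x -> Omega y -> eps <= enorm (x - y) ->
           `|G x y| + enorm (grad (G ^~ y) x) + enorm (grad (G x) y) <= C2),
      (exists2 C3 : R, 0 < C3 &
         forall x y, collar Omega eps0 x -> collar Omega eps0 y ->
           `|psi x y| + enorm (grad (psi ^~ y) x) + enorm (grad (psi x) y)
             <= C3) &
      (exists2 C4 : R, 0 < C4 &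
         forall w v, enorm v = 1 -> line w v `&` Omega !=set0 ->
         forall r s t, r < s -> s < t ->
           Omega (w + r *: v) -> Omega (w + s *: v) -> Omega (w + t *: v) ->
           - C4 <= G (w + r *: v) (w + s *: v) - G (w + r *: v) (w + t *: v))].

Definition path_function (N : nat) (Gamma : 'rV[R]_N)
    (G : plane -> plane -> R) (g : plane * plane -> R) (z : 'M[R]_(N, 2)) : R :=
  let h x := g (x, x) in
  \sum_(j < N) Gamma 0 j ^+ 2 * h (row j z) +
  \sum_(i < N) \sum_(j < N | i != j)
     Gamma 0 i * Gamma 0 j * G (row i z) (row j z).

End Domain.

Section Admissibility.
Context {R : realType} {N : nat}.
Implicit Types Gamma x : 'rV[R]_N.

Definition Delta_admissible Gamma : Prop :=
  forall C : {set 'I_N}, (2 <= #|C|)%N ->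
    \sum_(i in C) \sum_(j in C | i != j) Gamma 0 i * Gamma 0 j != 0.

Definition boundary_admissible (Omega : set 'rV[R]_2) Gamma : Prop :=
  (strictly_convex Omega -> forall C : {set 'I_N}, (2 <= #|C|)%N ->
    \sum_(i in C) \sum_(j in C | Gamma 0 i * Gamma 0 j < 0)
       `|Gamma 0 i * Gamma 0 j| < \sum_(i in C) Gamma 0 i ^+ 2) /\
  (~ strictly_convex Omega -> forall C : {set 'I_N}, (2 <= #|C|)%N ->
    \sum_(i in C) \sum_(j in C | i != j)
       `|Gamma 0 i * Gamma 0 j| < \sum_(i in C) Gamma 0 i ^+ 2).

Definition positive_orthant : set 'rV[R]_N := [set t | forall i, 0 < t 0 i].

Definition Delta_simplex : set 'rV[R]_N :=
  positive_orthant `&`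
  [set t | forall i j : 'I_N, j = i.+1 :> nat -> t 0 i < t 0 j].

(** The closure relative to the open positive orthant. *)
Definition Delta_closure : set 'rV[R]_N :=
  closure Delta_simplex `&` positive_orthant.

Definition perm_act (sigma : 'S_N) Gamma : 'rV[R]_N :=
  \row_j Gamma 0 ((sigma^-1)%g j).

(** Indices start at 0 in ['I_N], whence the shift in the exponent. *)
Definition alternate x : 'rV[R]_N := \row_(j < N) ((-1) ^+ j.+1 * x 0 j).

Definition L_admissible Gamma : Prop :=
  exists sigma : 'S_N,
    Delta_closure (alternate (perm_act sigma Gamma)) \/
    Delta_closure (- alternate (perm_act sigma Gamma)).

End Admissibility.

(* Main.v *)
(** Suppose that [H] has no critical point. A blow-up at the scale of the
    clearance [rho] (the least distance among the points and to the complement)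
    shows that [rho |grad H|] is bounded below: if it tended to [0] along
    configurations with [rho -> 0], some cluster of points at distances [O(rho)]
    would form either inside or at the boundary. Moving an inner cluster away from
    one of its points, resp. a boundary cluster along the normals, changes [H] at
    a rate whose limit is, up to a nonzero factor, [sum G_i G_j] resp.
    [sum G_i^2 + sum G_i G_j c_ij] with [0 <= c_ij <= 1], and admissibility forbids
    that this limit vanishes. Hence Euler steps along [rho^2 grad H], suitably
    normalized, never leave the configuration space and raise [H] without bound.

    Start these steps at the chains whose successive differences are
    [e 3^l (cos theta_l, sin theta_l)]. A step turns the difference of two points
    by less than a right angle, so the angles of the differences after [n] steps are
    continuous functions of [theta] at bounded distance from [theta], and the
    Poincare-Miranda theorem yields a [theta] for which they all vanish. The
    resulting configuration lies on a line, in the order prescribed by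
    L-admissibility; there the interaction terms form alternating sums that
    condition (v) on [G] bounds from above, a contradiction. *)

(* A step of size s costs the clearance at most a factor 1 - 2s, so over a total time T a fixed
   fraction of it survives, and the number of steps that lifts [path_function] above a given bound
   is the same for every starting chain. This uniformity lets the box in the Poincare-Miranda
   theorem be chosen after the number of steps, although the angles may drift by up to a right angle
   at each of them. The blow-up runs along an ultrafilter: every bounded rescaled quantity converges
   there, and every quantity is either O(rho) or of larger order; clusters are the classes of the
   relation O(rho). Near the boundary [g] is a multiple of the logarithm of the distance to the
   reflected point, up to a function with bounded gradient. Motion along the normal keeps the
   projection fixed and moves the reflected point with exactly the opposite velocity. The
   coefficient of a pair thus becomes the difference of two quotients A^2 / (|P|^2 + A^2), one from
   the reflected point and one from the direct interaction, and this difference lies in [0, 1]. *)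
Require Import Defs.
From HB Require Import structures.
From mathcomp Require Import all_boot all_order all_algebra all_fingroup.
From mathcomp Require Import all_classical all_reals all_analysis.
From mathcomp Require Import ring lra zify.
Set Implicit Arguments.
Unset Strict Implicit.
Unset Printing Implicit Defensive.
Import Order.TTheory GRing.Theory Num.Theory Num.Def.
Import numFieldNormedType.Exports.
Import Defs.
Local Open Scope classical_set_scope.
Local Open Scope ring_scope.

(** * The Poincare-Miranda theorem *)

Section CubicalCup.
Variables (m n : nat) (A : 'I_m -> {ffun 'I_m -> 'I_n.+1} -> bool).
Notation V := {ffun 'I_m -> 'I_n.+1}.
Implicit Types (v x : V) (D : {set 'I_m}) (js : seq 'I_m).

(** Addition is modulo [n.+1], which makes the step a bijection of the grid, so that sums can be
    reindexed by it. The directions spanning a cube never wrap around. *)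
Definition next_vertex v (c : 'I_m) : V := v + [ffun i => inZp (i == c)].

Lemma next_vertexC v c d : next_vertex (next_vertex v c) d = next_vertex (next_vertex v d) c.
Proof. by rewrite /next_vertex -!addrA [X in _ + X]addrC. Qed.

Lemma next_vertex_neq v c i : i != c -> next_vertex v c i = v i.
Proof.
by move=> /negbTE ic; rewrite !ffunE ic; apply/val_inj; rewrite /= mod0n addn0 modn_small.
Qed.

Lemma next_vertex_eq v c : v c != ord_max -> val (next_vertex v c c) = (v c).+1.
Proof.
move=> vc; rewrite !ffunE eqxx /= modnDmr addn1 modn_small // ltnS.
by have := ltn_ord (v c); rewrite ltnS leq_eqVlt -(inj_eq val_inj) /= in vc *; rewrite (negbTE vc).
Qed.

Definition cube x D : {set V} :=
  [set u : V | [forall i, (u i == x i) || ((i \in D) && (u i == (x i).+1 :> nat))]].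

Definition label j v : 'F_2 := (A j v)%:R.

(* The cup product of the coboundaries of the labels listed in [js], evaluated on
   the cube at [v] spanned by [D]. It is itself a coboundary, so that its sum over
   the grid telescopes to opposite faces; a nonzero value on a cube means that
   each label takes both values there. *)
Fixpoint cup js v D : 'F_2 :=
  if js is j :: js' then
    \sum_(c in D) (label j (next_vertex v c) + label j v) * cup js' (next_vertex v c) (D :\ c)
  else 1.

Let addxx (x : 'F_2) : x + x = 0.
Proof. by rewrite addrr_pchar2 // pchar_Fp. Qed.

(** Modulo 2, the two orders of each pair cancel. *)
Lemma sum_sym_F2 (D : {set 'I_m}) (f : 'I_m -> 'I_m -> 'F_2) :
  (forall c d, f c d = f d c) ->
  \sum_(c in D) \sum_(d in D :\ c) f c d = 0.
Proof.
move=> fC.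
have -> : \sum_(c in D) \sum_(d in D :\ c) f c d =
   \sum_(c in D) \sum_(d in D | (c < d)%N) f c d +
   \sum_(c in D) \sum_(d in D | (d < c)%N) f c d.
  rewrite -big_split /=; apply: eq_bigr => c _.
  rewrite (bigID (fun d : 'I_m => (c < d)%N)) /=; congr (_ + _).
    apply: eq_bigl => d; rewrite !inE andbC; case: (d \in D); rewrite ?andbF ?andbT //=.
    by rewrite -(inj_eq val_inj) /=; case: ltngtP.
  apply: eq_bigl => d; rewrite !inE andbC; case: (d \in D); rewrite ?andbF ?andbT //=.
  by rewrite -(inj_eq val_inj) /=; case: ltngtP.
rewrite [X in _ + X](exchange_big_dep (mem D)) /=; last by move=> ? ? _ /andP[].
rewrite [X in _ + X](_ : _ = \sum_(c in D) \sum_(d in D | (c < d)%N) f c d) ?addxx//.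
by apply: eq_bigr => c cD; apply: eq_big => [d|d _]; [rewrite cD | rewrite fC].
Qed.

(** A product of coboundaries is closed, in discrete form. *)
Lemma cup_closed js v D :
  \sum_(c in D) (cup js (next_vertex v c) (D :\ c) + cup js v (D :\ c)) = 0.
Proof.
elim: js v D => [|j js IH] v D /=.
  by apply: big1 => c _; rewrite addxx.
pose eta v D := label j v * cup js v D.
(* Leibniz rule: [cup js] is closed by induction, so the longer product is the coboundary of [eta].
   A second difference is then symmetric in the two directions. *)
have exact v' D' : cup (j :: js) v' D' =
    \sum_(c in D') (eta (next_vertex v' c) (D' :\ c) + eta v' (D' :\ c)).
  rewrite /= [RHS](_ : _ = \sum_(c in D') (eta (next_vertex v' c) (D' :\ c) + eta v' (D' :\ c)) +
     label j v' * \sum_(c in D') (cup js (next_vertex v' c) (D' :\ c) + cup js v' (D' :\ c))); last first.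
    by rewrite IH mulr0 addr0.
  rewrite mulr_sumr -big_split /=; apply: eq_bigr => c _.
  rewrite /eta mulrDr mulrDl addrACA.
  by rewrite [X in _ = _ + X]addxx addr0.
under eq_bigr do rewrite -/(cup (j :: js) _ _) -[X in _ + X]/(cup (j :: js) _ _) !exact -big_split.
apply: sum_sym_F2 => c d /=.
rewrite [next_vertex (next_vertex v c) d]next_vertexC (_ : D :\ c :\ d = D :\ d :\ c) -?addrA; last first.
  by rewrite !finset.setDDl finset.setUC.
by congr (_ + _); rewrite addrCA; congr (_ + _); rewrite addrCA addrA addrC.
Qed.

Lemma cup_exact j js v D :
  cup (j :: js) v D =
  \sum_(c in D) (label j (next_vertex v c) * cup js (next_vertex v c) (D :\ c) +
                 label j v * cup js v (D :\ c)).
Proof.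
rewrite /= [RHS](_ : _ = \sum_(c in D) (label j (next_vertex v c) * cup js (next_vertex v c) (D :\ c) +
                 label j v * cup js v (D :\ c)) +
   label j v * \sum_(c in D) (cup js (next_vertex v c) (D :\ c) + cup js v (D :\ c))); last first.
  by rewrite cup_closed mulr0 addr0.
rewrite mulr_sumr -big_split /=; apply: eq_bigr => c _.
by rewrite mulrDr mulrDl addrACA [X in _ = _ + X]addxx addr0.
Qed.

(** Every term of the product contains the increment of label [j] along an edge of the cube. *)
Lemma cup_const js v D j b : j \in js ->
  (forall i, i \in D -> v i != ord_max) ->
  {in cube v D, forall u, A j u = b} -> cup js v D = 0.
Proof.
elim: js v D => //= k js IH v D; rewrite inE => jk vD Hc.
have vcube : v \in cube v D by rewrite inE; apply/forallP => i; rewrite eqxx.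
have scube c : c \in D -> next_vertex v c \in cube v D.
  move=> cD; rewrite inE; apply/forallP => i; have [->|ic] := eqVneq i c.
    by rewrite cD next_vertex_eq ?eqxx ?orbT ?vD.
  by rewrite next_vertex_neq ?eqxx.
apply: big1 => c cD; case/orP: jk => [/eqP jk|jjs].
  by rewrite /label -jk (Hc _ vcube) (Hc _ (scube _ cD)) addxx mul0r.
rewrite IH ?mulr0// => [i|u].
  by rewrite !inE => /andP[ic iD]; rewrite next_vertex_neq// vD.
rewrite inE => /forallP ucube; apply: Hc; rewrite inE; apply/forallP => i.
move: (ucube i); rewrite !inE; have [->|ic] /= := eqVneq i c.
  rewrite orbF -(inj_eq val_inj) => /eqP ->.
  by rewrite cD next_vertex_eq ?eqxx ?orbT ?vD.
by rewrite next_vertex_neq.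
Qed.

Hypothesis n_gt0 : (0 < n)%N.
Hypothesis A_lo : forall j v, v j = ord0 -> A j v = false.
Hypothesis A_hi : forall j v, v j = ord_max -> A j v = true.

(** The base points of the cubes spanned by the directions in [P] within the face where all other
    coordinates are maximal. *)
Definition box (P : pred 'I_m) (x : V) := [forall i, (x i != ord_max) == P i].

Lemma sum_box_telescope (P : pred 'I_m) c (f : V -> 'F_2) : P c ->
  \sum_(x | box P x) (f (next_vertex x c) + f x) =
  \sum_(x : V | [forall i, (i != c) ==> ((x i != ord_max) == P i)] &&
             (x c == ord_max)) f x +
  \sum_(x : V | [forall i, (i != c) ==> ((x i != ord_max) == P i)] &&
             (x c == ord0)) f x.
Proof.
move=> Pc; pose Q (x : V) := [forall i, (i != c) ==> ((x i != ord_max) == P i)].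
have boxE x : box P x = Q x && (x c != ord_max).
  apply/forallP/andP => [bx|[/forallP Qx xc] i].
    by split; [apply/forallP => i; rewrite bx implybT | rewrite (eqP (bx c))].
  by have [->|ic] := eqVneq i c; [rewrite xc Pc | move: (Qx i); rewrite ic].
have o0M : ord0 != ord_max :> 'I_n.+1 by rewrite -(inj_eq val_inj) /= neq_ltn n_gt0.
rewrite big_split /=.
have -> : \sum_(x | box P x) f (next_vertex x c) = \sum_(x | Q x && (x c != ord0)) f x.
  rewrite [RHS](reindex (next_vertex ^~ c)) /=; last first.
    by apply: onW_bij; exists (fun v => v - [ffun i => inZp (i == c)]) => v;
      rewrite /next_vertex ?addrK ?subrK.
  apply: eq_bigl => x; rewrite boxE; congr (_ && _).
    by apply: eq_forallb => i; case: eqVneq => //= ic; rewrite next_vertex_neq.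
  have [xc|xc] := eqVneq (x c) ord_max; last by rewrite -(inj_eq val_inj) next_vertex_eq.
  rewrite -(inj_eq val_inj) !ffunE eqxx xc /= modnDmr addn1 modnn eqxx //.
under [X in _ + X]eq_bigl do rewrite boxE.
rewrite (bigID (fun x : V => x c == ord_max)) /=.
rewrite [X in _ + X = _](bigID (fun x : V => x c == ord0)) /=.
rewrite addrACA -[RHS]addr0 -!/(Q _); congr (_ + _); last first.
  rewrite [X in _ + X](eq_bigl (fun x => Q x && (x c != ord0) && (x c != ord_max))) ?addxx//.
  by move=> x; rewrite -!andbA [X in _ && X]andbC.
congr (_ + _); apply: eq_bigl => x; rewrite -andbA; congr (_ && _).
  by have [->|] := eqVneq (x c) ord_max; rewrite ?andbF ?andbT// eq_sym.
by have [->|] := eqVneq (x c) ord0; rewrite ?andbF ?andbT.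
Qed.

(** By [cup_exact] the sum telescopes in each direction. In a direction [c] other than [j], label
    [c] is constant on both end faces, which kills the product there. In direction [j] only the
    upper face survives, with label 1, and the induction hypothesis applies to it. *)
Lemma sum_cup js : uniq js ->
  \sum_(x | box (mem js) x) cup js x [set i in js] = 1.
Proof.
elim: js => [_|j js IH /= /andP[jjs ujs]].
  rewrite (big_pred1 [ffun=> ord_max])//= => x.
  apply/forallP/eqP => [bx|-> i]; last by rewrite ffunE eqxx.
  apply/ffunP => i; rewrite ffunE; apply/eqP; move: (bx i); rewrite -[mem [::] i]/(i \in [::]) in_nil; by case: (x i == _).
rewrite -{}IH//; set D := [set i in j :: js].
under eq_bigr do rewrite -[(\sum_(c in D) _)]/(cup (j :: js) _ _) cup_exact.
rewrite exchange_big /= (bigD1 j) ?inE ?eqxx//= [X in _ + X]big1 ?addr0; last first.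
  move=> c /andP[cD cj].
  have cjs : c \in js by move: cD; rewrite !inE (negbTE cj).
  rewrite (sum_box_telescope (fun x => label j x * cup js x (D :\ c))) ?inE ?cjs ?orbT//.
  rewrite !big1 ?addr0// => x /andP[/forallP Qx xc]; rewrite (_ : cup _ _ _ = 0) ?mulr0//.
    apply: (@cup_const _ _ _ c false) => //.
      by move=> i; rewrite !inE => /andP[ic iD]; move: (Qx i); rewrite ic /= inE iD => /eqP.
    by move=> u; rewrite inE => /forallP/(_ c); rewrite !inE eqxx /= orbF (eqP xc) => /eqP; apply: A_lo.
  apply: (@cup_const _ _ _ c true) => //.
    by move=> i; rewrite !inE => /andP[ic iD]; move: (Qx i); rewrite ic /= inE iD => /eqP.
  by move=> u; rewrite inE => /forallP/(_ c); rewrite !inE eqxx /= orbF (eqP xc) => /eqP; apply: A_hi.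
rewrite (sum_box_telescope (fun x => label j x * cup js x (D :\ j))) ?inE ?eqxx//.
rewrite [X in _ + X]big1 ?addr0 => [|x /andP[_ /eqP xj]]; last by rewrite /label A_lo// mul0r.
have -> : D :\ j = [set i in js].
  by apply/finset.setP => i; rewrite !inE; case: eqVneq => //= ->; rewrite (negbTE jjs).
apply: eq_big => [x|x /andP[_ /eqP xj]]; last by rewrite /label A_hi// mul1r.
apply/andP/forallP => [[/forallP Qx /eqP xj] i|bx].
  have [->|ij] := eqVneq i j; first by rewrite xj eqxx /= (negbTE jjs).
  by move: (Qx i); rewrite ij /= inE (negbTE ij).
split; last by move: (bx j); rewrite -[mem js j]/(j \in js) (negbTE jjs); case: (x j == _).
by apply/forallP => i; apply/implyP => ij; rewrite /= inE (negbTE ij) /=; exact: bx.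
Qed.

Lemma sign_change_cube : exists x : V, (forall i, x i != ord_max) /\
  forall j, exists u u' : V, [/\ u \in cube x finset.setT, u' \in cube x finset.setT, A j u & ~~ A j u'].
Proof.
have := sum_cup (enum_uniq 'I_m).
have [x /andP[/forallP bx c0] _|x0] := pickP (fun x : V => box (mem (enum 'I_m)) x &&
   (cup (enum 'I_m) x [set i in enum 'I_m] != 0)); last first.
  rewrite big1 => [/eqP|x bx]; first by rewrite eq_sym oner_eq0.
  by move: (x0 x); rewrite bx /=; case: eqP.
have xM i : x i != ord_max by move: (bx i); rewrite /= mem_enum => /eqP.
exists x; split => // j.
have DT : [set i in enum 'I_m]%SET = finset.setT by apply/finset.setP => i; rewrite !inE mem_enum.
have [/existsP[u /andP[uc Au]]|/existsPn noT] := boolP [exists u, (u \in cube x finset.setT) && A j u]; last first.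
  case/eqP: c0; rewrite DT; apply: (@cup_const _ _ _ j false) => //; first by rewrite mem_enum.
  by move=> u uc; move: (noT u); rewrite uc /=; case: (A j u).
have [/existsP[u' /andP[u'c Au']]|/existsPn noF] := boolP [exists u, (u \in cube x finset.setT) && ~~ A j u].
  by exists u, u'.
case/eqP: c0; rewrite DT; apply: (@cup_const _ _ _ j true) => //; first by rewrite mem_enum.
by move=> v vc; move: (noF v); rewrite vc /=; case: (A j v).
Qed.
End CubicalCup.

Lemma mx_entry_le_norm (R : realType) m n (M : 'M[R]_(m, n)) i j : `|M i j| <= `|M|.
Proof.
by rewrite [leRHS]/normr /= mx_normrE; apply/bigmax_geP; right => /=; exists (i, j).
Qed.

Lemma mx_norm_le (R : realType) m n (M : 'M[R]_(m, n)) e : 0 <= e ->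
  (forall i j, `|M i j| <= e) -> `|M| <= e.
Proof.
by move=> e0 Me; rewrite [leLHS]/normr /= mx_normrE; apply/bigmax_leP; split.
Qed.

Lemma mx_norm_lt (R : realType) m n (M : 'M[R]_(m, n)) e : 0 < e ->
  (forall i j, `|M i j| < e) -> `|M| < e.
Proof.
by move=> e0 Me; rewrite [ltLHS]/normr /= mx_normrE; apply/bigmax_ltP; split.
Qed.

(** Without a common zero, near each point some component keeps a strict sign, and compactness makes
    this uniform at the scale of one mesh width. A grid cube on which no component keeps a strict
    sign contradicts it. *)
Theorem poincare_miranda (R : realType) m (F : 'I_m -> 'rV[R]_m -> R) (B : R) :
  0 < B -> (forall j, continuous (F j)) ->
  (forall j (x : 'rV[R]_m), (forall i, `|x 0 i| <= B) -> x 0 j = - B -> F j x < 0) ->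
  (forall j (x : 'rV[R]_m), (forall i, `|x 0 i| <= B) -> x 0 j = B -> 0 < F j x) ->
  exists x, forall j, F j x = 0.
Proof.
move=> B0 Fc Flo Fhi; apply: contrapT => noz.
pose K := [set x : 'rV[R]_m | forall i, `|x 0 i| <= B].
have cK : compact K.
  rewrite (_ : K = [set v : 'rV[R]_m | forall i, `[-B, B]%classic (v ord0 i)]).
    by apply: (@rV_compact R _ (fun=> `[-B, B]%classic)) => _; exact: segment_compact.
  by apply/seteqP; split => x /= Kx i; move: (Kx i); rewrite /= in_itv /= ler_norml.
pose P (n : nat) (x : 'rV[R]_m) := exists j,
  (forall y, `|x - y| <= 2 * B / n.+1%:R -> 0 < F j y) \/
  (forall y, `|x - y| <= 2 * B / n.+1%:R -> F j y < 0).
have cvg0 : (fun n => 2 * B / n.+1%:R) @ \oo --> (0 : R).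
  by rewrite -(mulr0 (2 * B)); apply: cvgMr; exact: cvg_harmonic.
have local (x : 'rV[R]_m) (Q : 'rV[R]_m -> Prop) : (\forall y \near x, Q y) ->
    \forall x' \near x & n \near \oo, forall y, `|x' - y| <= 2 * B / n.+1%:R -> Q y.
  move=> /nbhs_ballP[e /= e0 eQ].
  exists ([set x' | `|x - x'| < e / 2], [set n | 2 * B / n.+1%:R < e / 2]) => /=; first split.
  - by apply/nbhs_ballP; exists (e / 2) => /=; [rewrite divr_gt0 | rewrite -ball_normE].
  - move/cvgrPdist_lt : cvg0 => /(_ (e / 2)); rewrite divr_gt0// => /(_ isT).
    by apply: filterS => n /=; rewrite sub0r normrN; apply: le_lt_trans; rewrite ler_norm.
  - move=> [x' n] /= [xx' ne] y x'y; apply: eQ; rewrite -ball_normE /=.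
    by rewrite (splitr e) -(subrKA x'); apply: (le_lt_trans (ler_normD _ _)); rewrite ltrD// (le_lt_trans x'y).
have /compact_near_coveringP/(_ _ \oo P _) := cK.
case=> [x Kx|n _ KP].
  have [j Fj] : exists j, F j x != 0.
    apply: contrapT => nj; apply: noz; exists x => j; apply/eqP/negPn/negP => Fj.
    by apply: nj; exists j.
  have [Fj0|Fj0] : 0 < F j x \/ F j x < 0 by move: Fj; rewrite neq_lt => /orP[]; [right | left].
    have : \forall y \near x, 0 < F j y by exact: cvgr_gt (Fc j x) _ Fj0.
    by move/local; apply: filterS => -[x' n] /= ?; exists j; left.
  have : \forall y \near x, F j y < 0 by exact: cvgr_lt (Fc j x) _ Fj0.
  by move/local; apply: filterS => -[x' n] /= ?; exists j; right.
have {KP} KP := KP n (leqnn n).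
(* There are [n.+2] vertices per direction, hence the mesh width is the radius in [P]. *)
pose pt (v : {ffun 'I_m -> 'I_n.+2}) : 'rV[R]_m := \row_j (- B + 2 * B * (v j)%:R / n.+1%:R).
have n1 : n.+1%:R != 0 :> R by rewrite pnatr_eq0.
have ptK v : K (pt v).
  move=> i; rewrite mxE ler_norml lerDl; apply/andP; split.
    by rewrite !mulr_ge0 ?invr_ge0 ?ler0n ?ltW//.
  suff: (v i)%:R / n.+1%:R <= 1 :> R.
    rewrite -mulrA; set q := (v i)%:R / _ => q1; have : 0 <= B * (1 - q) by apply: mulr_ge0; rewrite ?subr_ge0 // ltW.
    by rewrite mulrBr mulr1 subr_ge0 => Bq; lra.
  by rewrite ler_pdivrMr ?ltr0n// mul1r ler_nat -ltnS.
have [] := @sign_change_cube m n.+1 (fun j v => 0 < F j (pt v)) isT.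
- move=> j v vj; apply/negbTE; rewrite -leNgt ltW//; apply: Flo; first exact: ptK.
  by rewrite mxE vj mulr0 mul0r addr0.
- move=> j v vj; apply: Fhi; first exact: ptK.
  by rewrite mxE vj /= mulfK//; lra.
move=> x [xM Hx]; have [j Fj] := KP _ (ptK x).
have near_cube u : u \in cube x [set: 'I_m]%SET -> `|pt x - pt u| <= 2 * B / n.+1%:R.
  rewrite inE => /forallP uc; apply: mx_norm_le => [|i k]; first by rewrite divr_ge0// mulr_ge0// ltW.
  rewrite !mxE; move: (uc k); rewrite inE /= => /orP[/eqP ->|/eqP ->].
    by rewrite subrr normr0 divr_ge0// mulr_ge0// ltW.
  have -> : - B + 2 * B * (x k)%:R / n.+1%:R - (- B + 2 * B * (x k).+1%:R / n.+1%:R)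
    = - (2 * B / n.+1%:R) by rewrite -[(x k).+1%:R]natr1; field.
  by rewrite normrN ger0_norm// divr_ge0// mulr_ge0// ltW.
have [u [u' [uc u'c Au Au']]] := Hx j.
case: Fj => Fj; first by move: Au'; rewrite Fj// near_cube.
by have := Fj _ (near_cube _ uc); rewrite ltNge ltW.
Qed.

(** * Plane geometry near a C^3 boundary *)

Section Euclid.
Context {R : realType}.
Notation plane := 'rV[R]_2.
Implicit Types (u v w x y : plane) (a : R).

Lemma edotE u v : edot u v = u 0 0 * v 0 0 + u 0 1 * v 0 1.
Proof. by rewrite /edot big_ord_recl big_ord1; congr (_ + u 0 _ * v 0 _); apply/val_inj. Qed.

Lemma rV2P u v : u 0 0 = v 0 0 -> u 0 1 = v 0 1 -> u = v.
Proof.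
by move=> h0 h1; apply/rowP => -[[|[|]]] //= i;
  [rewrite (_ : Ordinal _ = 0) | rewrite (_ : Ordinal _ = 1)] => //; apply/val_inj.
Qed.

Lemma edotC u v : edot u v = edot v u.
Proof. by rewrite !edotE; ring. Qed.

Lemma edotDl u v w : edot (u + v) w = edot u w + edot v w.
Proof. by rewrite !edotE !mxE; ring. Qed.

Lemma edotDr u v w : edot w (u + v) = edot w u + edot w v.
Proof. by rewrite !edotE !mxE; ring. Qed.

Lemma edotNl u w : edot (- u) w = - edot u w.
Proof. by rewrite !edotE !mxE; ring. Qed.

Lemma edotNr u w : edot w (- u) = - edot w u.
Proof. by rewrite !edotE !mxE; ring. Qed.

Lemma edotBl u v w : edot (u - v) w = edot u w - edot v w.
Proof. by rewrite !edotE !mxE; ring. Qed.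

Lemma edotBr u v w : edot w (u - v) = edot w u - edot w v.
Proof. by rewrite !edotE !mxE; ring. Qed.

Lemma edotZl a u w : edot (a *: u) w = a * edot u w.
Proof. by rewrite !edotE !mxE; ring. Qed.

Lemma edotZr a u w : edot w (a *: u) = a * edot w u.
Proof. by rewrite !edotE !mxE; ring. Qed.

Lemma edot0l w : edot 0 w = 0. Proof. by rewrite edotE !mxE; ring. Qed.

Lemma edot0r w : edot w 0 = 0. Proof. by rewrite edotE !mxE; ring. Qed.

Definition edot_lin := (edotDl, edotDr, edotBl, edotBr, edotNl, edotNr, edotZl, edotZr, edot0l, edot0r).

Lemma edot_ge0 u : 0 <= edot u u.
Proof. by rewrite edotE; nra. Qed.

Lemma edot_eq0 u : (edot u u == 0) = (u == 0).
Proof.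
apply/eqP/eqP => [|->]; last by rewrite edot0l.
rewrite edotE => h; have [h0 h1] : u 0 0 = 0 /\ u 0 1 = 0 by split; nra.
by apply: rV2P; rewrite !mxE.
Qed.

Lemma edot_gt0 u : (0 < edot u u) = (u != 0).
Proof. by rewrite lt_neqAle edot_ge0 andbT eq_sym edot_eq0. Qed.

Lemma enorm_ge0 u : 0 <= enorm u. Proof. exact: sqrtr_ge0. Qed.

Lemma sqr_enorm u : enorm u ^+ 2 = edot u u.
Proof. by rewrite sqr_sqrtr// edot_ge0. Qed.

Lemma enorm_eq0 u : (enorm u == 0) = (u == 0).
Proof. by rewrite -sqrf_eq0 sqr_enorm edot_eq0. Qed.

Lemma enorm_gt0 u : (0 < enorm u) = (u != 0).
Proof. by rewrite lt_neqAle enorm_ge0 andbT eq_sym enorm_eq0. Qed.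

Lemma enorm0 : enorm (0 : plane) = 0. Proof. by apply/eqP; rewrite enorm_eq0. Qed.

Lemma enormN u : enorm (- u) = enorm u.
Proof. by rewrite /enorm !edot_lin opprK. Qed.

Lemma enormB u v : enorm (u - v) = enorm (v - u).
Proof. by rewrite -enormN opprB. Qed.

Lemma enormZ a u : enorm (a *: u) = `|a| * enorm u.
Proof. by rewrite /enorm !edot_lin mulrA -expr2 sqrtrM ?sqr_ge0// sqrtr_sqr. Qed.

Lemma cauchy_schwarz u v : `|edot u v| <= enorm u * enorm v.
Proof.
rewrite -(@ler_pXn2r _ 2)// ?nnegrE ?mulr_ge0 ?enorm_ge0//.
rewrite exprMn !sqr_enorm real_normK ?num_real// !edotE.
have := sqr_ge0 (u 0 0 * v 0 1 - u 0 1 * v 0 0); nra.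
Qed.

Lemma ler_edot u v : edot u v <= enorm u * enorm v.
Proof. exact: le_trans (ler_norm _) (cauchy_schwarz u v). Qed.

Lemma ler_enormD u v : enorm (u + v) <= enorm u + enorm v.
Proof.
rewrite -(@ler_pXn2r _ 2)// ?nnegrE ?addr_ge0 ?enorm_ge0//.
rewrite sqrrD !sqr_enorm !edot_lin (edotC v u).
by have := ler_edot u v; lra.
Qed.

Lemma ler_enorm_dist u v w : enorm (u - w) <= enorm (u - v) + enorm (v - w).
Proof. by apply: le_trans (ler_enormD _ _); rewrite addrA subrK. Qed.

Lemma ler_enormB u v : enorm (u - v) <= enorm u + enorm v.
Proof. by apply: le_trans (ler_enormD _ _) _; rewrite enormN. Qed.

Lemma ler_dist_enorm u v : `|enorm u - enorm v| <= enorm (u - v).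
Proof.
rewrite ler_norml; apply/andP; split.
  by have := ler_enormD (v - u) u; rewrite subrK enormB; lra.
by have := ler_enormD (u - v) v; rewrite subrK; lra.
Qed.

Lemma norm_le_enorm u : `|u| <= enorm u.
Proof.
rewrite [leLHS]/normr /= mx_normrE; apply/bigmax_leP; split => [|[i j] _]; first exact: enorm_ge0.
rewrite -(@ler_pXn2r _ 2)// ?nnegrE ?enorm_ge0// sqr_enorm edotE real_normK ?num_real//= (ord1 i).
have := sqr_ge0 (u 0 0); have := sqr_ge0 (u 0 1); rewrite !expr2.
by case: j => [[|[|]]] //= h ? ?; [rewrite (_ : Ordinal _ = 0) | rewrite (_ : Ordinal _ = 1)];
  rewrite ?lerDl ?lerDr//; apply/val_inj.
Qed.

Lemma enorm_le_norm u : enorm u <= 2 * `|u|.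
Proof.
have ent j : `|u 0 j| <= `|u|.
  by rewrite [leRHS]/normr /= mx_normrE; apply/bigmax_geP; right => /=; exists (0, j).
rewrite -(@ler_pXn2r _ 2)// ?nnegrE ?enorm_ge0 ?mulr_ge0// sqr_enorm edotE exprMn.
have sq j : u 0 j * u 0 j <= `|u| ^+ 2.
  by rewrite -expr2 -real_normK ?num_real// ler_pXn2r ?nnegrE.
have := sq 0; have := sq 1; have := sqr_ge0 `|u|; lra.
Qed.

Lemma enorm_continuous : continuous (@enorm R).
Proof.
move=> u; apply: (iffRL (@cvgrPdist_lt _ _ _ (nbhs u) _ (@enorm R) (enorm u))) => e e0.
have e2 : 0 < e / 2 by rewrite divr_gt0.
apply/nbhs_ballP; exists (e / 2) => //= v; rewrite -ball_normE /= => uv.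
apply: le_lt_trans (ler_dist_enorm _ _) _; apply: le_lt_trans (enorm_le_norm _) _.
by rewrite mulrC -ltr_pdivlMr.
Qed.

Lemma nbhs_enormP u (P : set plane) :
  nbhs u P <-> exists2 e : R, 0 < e & forall v, enorm (u - v) < e -> P v.
Proof.
split.
  move=> /nbhs_ballP[e /= e0 eP]; exists e => // v uv; apply: eP.
  by rewrite -ball_normE /=; exact: le_lt_trans (norm_le_enorm _) uv.
move=> [e e0 eP]; have e2 : 0 < e / 2 by rewrite divr_gt0.
apply/nbhs_ballP; exists (e / 2) => //= v; rewrite -ball_normE /= => uv; apply: eP.
by apply: le_lt_trans (enorm_le_norm _) _; rewrite mulrC -ltr_pdivlMr.
Qed.

Lemma is_diff_coord (V : normedModType R) (f df : V -> plane) (x : V) j :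
  is_diff x f df -> is_diff x (fun z => f z 0 j : R) (fun z => df z 0 j).
Proof.
move=> fd; have @c : {linear plane -> R}.
  by exists (fun N : plane => N 0 j); do 2![eexists]; do ?[constructor];
     rewrite ?mxE// => ? *; rewrite ?mxE//; move=> ?; rewrite !mxE.
have cc : continuous c by move=> N; exact: coord_continuous.
have cd : is_diff (f x) c c.
  by apply: DiffDef; [exact: linear_differentiable | rewrite diff_lin].
exact: is_diff_comp.
Qed.

Lemma is_diff_edot (V : normedModType R) (f g df dg : V -> plane) (x : V) :
  is_diff x f df -> is_diff x g dg ->
  is_diff x (fun z => edot (f z) (g z)) (fun z => edot (f x) (dg z) + edot (df z) (g x)).
Proof.
move=> fd gd.
have -> : (fun z => edot (f z) (g z)) =
   (fun z => f z 0 0) * (fun z => g z 0 0) + (fun z => f z 0 1) * (fun z => g z 0 1).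
  by apply/funext => z; rewrite edotE.
have f0 := is_diff_coord 0 fd; have f1 := is_diff_coord 1 fd.
have g0 := is_diff_coord 0 gd; have g1 := is_diff_coord 1 gd.
apply: is_diff_eq (is_diffD (is_diffM f0 g0) (is_diffM f1 g1)) _.
apply/funext => z; rewrite !edotE /= !fctE /GRing.scale /=; ring.
Qed.

Lemma is_diff_ln_enorm (V : normedModType R) (f df : V -> plane) (x : V) :
  is_diff x f df -> f x != 0 ->
  is_diff x (fun z => ln (enorm (f z))) (fun z => edot (f x) (df z) / edot (f x) (f x)).
Proof.
move=> fd fx0; have ed := is_diff_edot fd fd.
have e0 : 0 < edot (f x) (f x) by rewrite edot_gt0.
have s0 : 0 < Num.sqrt (edot (f x) (f x)) by rewrite sqrtr_gt0.
have dln : is_derive (edot (f x) (f x)) 1 (fun t => ln (Num.sqrt t)) (2 * edot (f x) (f x))^-1.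
  have h1 := is_derive1_sqrt e0; have h2 := is_derive1_ln s0.
  apply: (@is_derive_eq _ _ _ _ _ _ _ _ (is_derive1_comp h2 h1)).
  by rewrite -invfM mulrCA -expr2 sqr_sqrtr// ltW.
have dd : differentiable (fun t => ln (Num.sqrt t)) (edot (f x) (f x)).
  by apply/derivable1_diffP; case: dln.
have -> : (fun z => ln (enorm (f z))) = (fun t => ln (Num.sqrt t)) \o (fun z => edot (f z) (f z)) by [].
have ld : is_diff (edot (f x) (f x)) (fun t => ln (Num.sqrt t))
    (fun h => h * (2 * edot (f x) (f x))^-1).
  apply: DiffDef => //; rewrite diff1E//; apply/funext => h.
  by rewrite derive1E (@derive_val _ _ _ _ _ _ _ dln).
apply: is_diff_eq (is_diff_comp ed ld) _; apply/funext => z /=.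
by rewrite (edotC (df z)); field; rewrite gt_eqF.
Qed.

End Euclid.

(* Comparing norms of vector expressions up to conversion is what makes [lra]
   slow: they are generalized to variables first. *)
Ltac elra :=
  repeat match goal with
  | H : context [enorm _] |- _ => revert H
  | H : context [edist _ _] |- _ => revert H
  | H : context [edot _ _] |- _ => revert H
  end;
  repeat match goal with
  | |- context [enorm ?u] => generalize (enorm u)
  | |- context [edist ?u ?A] => generalize (edist u A)
  | |- context [edot ?u ?v] => generalize (edot u v)
  end; intros; lra.

(** * Distance to the complement of an open set *)

Section Distance.
Context {R : realType}.
Notation plane := 'rV[R]_2.
Implicit Types (u v w x y z : plane) (A U : set plane).

Lemma edist_le A z w : A w -> edist z A <= enorm (w - z).
Proof.
move=> Aw; apply: ge_inf; last by exists w.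
by exists 0 => _ [v _ <-]; exact: enorm_ge0.
Qed.

Lemma le_edist A z r : A !=set0 -> (forall w, A w -> r <= enorm (w - z)) ->
  r <= edist z A.
Proof.
move=> [a Aa] Ar; apply: lb_le_inf; first by exists (enorm (a - z)), a.
by move=> _ [v Av <-]; exact: Ar.
Qed.

Lemma edist_ge0 A z : A !=set0 -> 0 <= edist z A.
Proof. by move=> A0; apply: le_edist => // w _; exact: enorm_ge0. Qed.

Lemma edist_lipschitz A x y : A !=set0 -> edist x A <= edist y A + enorm (x - y).
Proof.
move=> A0; rewrite -lerBlDr; apply: le_edist => // w Aw; rewrite lerBlDr.
apply: le_trans (edist_le x Aw) _; rewrite [enorm (x - y)]enormB.
exact: ler_enorm_dist.
Qed.

Lemma open_enormP U : open U <->
  forall x, U x -> exists2 e : R, 0 < e & forall v, enorm (x - v) < e -> U v.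
Proof.
by rewrite openE; split => oU x Ux; have /nbhs_enormP := oU x Ux.
Qed.

Lemma edist_gt0 U x : open U -> ~` U !=set0 -> U x -> 0 < edist x (~` U).
Proof.
move=> /open_enormP/(_ x) oU U0 /oU[e e0 eU]; apply: lt_le_trans e0 _.
apply: le_edist => // w Uw; rewrite leNgt; apply/negP => we; apply: Uw; apply: eU.
by rewrite enormB.
Qed.

Lemma edist_setC U x : ~` U !=set0 -> 0 < edist x (~` U) -> U x.
Proof.
move=> U0 d0; apply: contrapT => Ux; have := @edist_le (~` U) x x Ux.
by rewrite subrr enorm0 leNgt d0.
Qed.

Lemma segment_meets_boundary U x w : open U -> U x -> ~ U w ->
  exists2 t : R, 0 < t <= 1 & boundary U (x + t *: (w - x)).
Proof.
move=> oU Ux nUw.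
pose S := [set t : R | 0 <= t /\ ~ U (x + t *: (w - x))].
have S1 : S 1 by split => //; rewrite scale1r addrC subrK.
have S0 : lbound S 0 by move=> t [].
have lS : has_lbound S by exists 0.
(* The first exit time: the point there is outside [U] because [U] is open, and it is a limit of
   earlier points of the segment, which are inside. *)
set t0 := inf S.
have t01 : t0 <= 1 by exact: ge_inf.
have t00 : 0 <= t0 by apply: lb_le_inf => //; exists 1.
have below t : 0 <= t -> t < t0 -> U (x + t *: (w - x)).
  move=> t_ge0 tt0; apply: contrapT => nU; have : t0 <= t by apply: ge_inf.
  by rewrite leNgt tt0.
have wx : 0 < enorm (w - x).
  by rewrite enorm_gt0 subr_eq0; apply/eqP => wx; apply: nUw; rewrite wx.
have step s t : x + s *: (w - x) - (x + t *: (w - x)) = (s - t) *: (w - x).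
  by rewrite scalerBl opprD addrACA subrr add0r.
have nU0 : ~ U (x + t0 *: (w - x)).
  move=> U0; have /open_enormP/(_ _ U0)[e e0 eU] := oU.
  have : t0 + e / enorm (w - x) / 2 <= t0.
    apply: lb_le_inf; first by exists 1.
    move=> t [t_ge0 nUt]; rewrite leNgt; apply/negP => tlt; apply: nUt.
    have [tt0|t0t] := ltP t t0; first exact: below.
    apply: eU; rewrite step enormZ distrC ger0_norm ?subr_ge0//.
    rewrite -ltr_pdivlMr// ltrBlDl; apply: lt_le_trans tlt _.
    by rewrite lerD2l ler_pdivrMr// ler_peMr ?ler1n// divr_ge0// ltW.
  by rewrite gerDl leNgt !divr_gt0.
have t0_gt0 : 0 < t0.
  rewrite lt_neqAle t00 andbT; apply/eqP => t00'; apply: nU0.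
  by rewrite -t00' scale0r addr0.
exists t0; first by rewrite t0_gt0.
split; last by move/interior_subset.
move=> B /nbhs_enormP[e e0 eB].
pose s := Num.min t0 (e / enorm (w - x) / 2).
have s0 : 0 < s by rewrite lt_min t0_gt0 !divr_gt0.
exists (x + (t0 - s) *: (w - x)); split.
  by apply: below; rewrite ?subr_ge0 ?ge_min ?lexx// gtrDl oppr_lt0.
apply: eB; rewrite step opprB addrC subrK enormZ gtr0_norm//.
rewrite -ltr_pdivlMr// /s gt_min; apply/orP; right.
by rewrite ltr_pdivrMr// ltr_pMr ?divr_gt0// ltr1n.
Qed.

Lemma boundary_setC U : open U -> boundary U `<=` ~` U.
Proof. by rewrite openE => oU y [_ ny] Uy; apply: ny; exact: oU. Qed.

(** A segment to an outside point meets the boundary no later than its end. Working with the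
    complement makes positivity of the distance equivalent to membership in [U]. *)
Lemma edist_boundary U x : open U -> U x -> ~` U !=set0 ->
  edist x (boundary U) = edist x (~` U).
Proof.
move=> oU Ux U0.
have B0 : boundary U !=set0.
  by case: U0 => w Uw; have [t _ Bt] := segment_meets_boundary oU Ux Uw; eexists; exact: Bt.
apply/eqP; rewrite eq_le; apply/andP; split; apply: le_edist => // w.
  move=> Uw; have [t /andP[t0 t1] Bt] := segment_meets_boundary oU Ux Uw.
  apply: le_trans (edist_le x Bt) _; rewrite addrC addKr enormZ gtr0_norm//.
  by rewrite ler_piMl ?enorm_ge0.
by move=> /(boundary_setC oU) Uw; exact: edist_le.
Qed.

Lemma edist_setC_continuous U : ~` U !=set0 -> continuous (fun x => edist x (~` U)).
Proof.
move=> U0 x; apply: (iffRL (@cvgrPdist_lt _ _ _ (nbhs x) _ _ _)) => e e0.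
apply/nbhs_enormP; exists e => // v xv; apply: le_lt_trans xv.
rewrite ler_norml lerBlDr lerNl opprB lerBlDr ![enorm _ + _]addrC.
by rewrite edist_lipschitz// enormB edist_lipschitz.
Qed.

Lemma bounded_setC_neq0 U : bounded_set U -> ~` U !=set0.
Proof.
move=> [M [Mr MU]]; apply: contrapT => /set0P/negP/negPn/eqP/(congr1 setC).
rewrite setCK setC0 => UT.
have := MU (`|M| + 1) _ ((`|M| + 1 + 1) *: const_mx 1).
rewrite ltr_pwDr// ?ler_norm// => /(_ isT); rewrite UT => /(_ I).
rewrite /= normrZ ger0_norm ?addr_ge0// => h.
have : `|M| + 1 + 1 <= `|M| + 1.
  apply: le_trans h; rewrite ler_peMr ?addr_ge0//.
  by have := mx_entry_le_norm (const_mx 1 : plane) 0 0; rewrite mxE normr1.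
by rewrite leNgt ltrDl ltr01.
Qed.

End Distance.

Lemma diff_quotient (R : realType) (V W : normedModType R) (f : V -> W) a v (e : R) :
  differentiable f a -> 0 < e -> exists2 d : R, 0 < d &
  forall h, h != 0 -> `|h| < d -> `|'d f a v - h^-1 *: (f (h *: v + a) - f a)| < e.
Proof.
move=> fd e0; rewrite -deriveE//; have /(_ v) := @diff_derivable _ _ _ f a _ fd.
rewrite /derivable => /cvgrPdist_lt/(_ _ e0)[d /= d0 Hd]; exists d => // h h0 hd.
by apply: Hd => //=; rewrite sub0r normrN.
Qed.

Lemma MVT_between (R : realType) (f df : R -> R) (a b : R) :
  (forall t : R, is_derive t 1 f (df t)) ->
  exists2 t, 0 <= t <= 1 & f b - f a = df (a + t * (b - a)) * (b - a).
Proof.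
move=> fd; have fc x y : {within `[x, y], continuous f}.
  apply: continuous_subspaceT => z; apply: differentiable_continuous.
  by apply/derivable1_diffP; case: (fd z).
have [ab|ab|->] := ltgtP a b; last by exists 0; rewrite ?lexx ?ler01// !subrr mulr0.
- have [c] := MVT ab (fun x _ => fd x) (fc a b); rewrite in_itv /= => /andP[ac cb] ->.
  have ba : 0 < b - a by rewrite subr_gt0.
  exists ((c - a) / (b - a)); last by rewrite divfK ?gt_eqF// [a + _]addrC subrK.
  by rewrite ler_pdivlMr// ler_pdivrMr// mul0r mul1r subr_ge0 lerD2r !ltW.
- have [c] := MVT ab (fun x _ => fd x) (fc b a); rewrite in_itv /= => /andP[bc ca] E.
  have ba : 0 < a - b by rewrite subr_gt0.
  exists ((a - c) / (a - b)); last first.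
    rewrite -opprB E -(opprB a b) !mulrN divfK ?gt_eqF//; congr (- (df _ * _)); lra.
  by rewrite ler_pdivlMr// ler_pdivrMr// mul0r mul1r subr_ge0 lerD2l lerN2 !ltW.
Qed.

(** * The projection onto the boundary along normals *)

Section Projection.
Context {R : realType}.
Notation plane := 'rV[R]_2.
Variables (Omega : set plane) (eps0 : R) (p : plane -> plane).
Hypotheses (Omega_domain : bounded_domain Omega) (p_proj : boundary_projection Omega eps0 p).
Notation D x := (edist x (~` Omega)).
Implicit Types x y : plane.

Let oO : open Omega. Proof. by case: Omega_domain. Qed.

Lemma setC_domain_neq0 : ~` Omega !=set0.
Proof. by case: Omega_domain => _ _ _ /bounded_setC_neq0. Qed.

Lemma collarE x : Omega x -> D x < eps0 -> collar Omega eps0 x.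
Proof. by move=> Ox Dx; split=> //; rewrite edist_boundary//; exact: setC_domain_neq0. Qed.

Lemma projP x : Omega x -> D x < eps0 -> boundary Omega (p x) /\ enorm (p x - x) = D x.
Proof.
move=> Ox Dx; have [+ _ _ _] := p_proj => /(_ x (collarE Ox Dx)).
by rewrite edist_boundary//; exact: setC_domain_neq0.
Qed.

Lemma proj_uniq x w : Omega x -> D x < eps0 -> boundary Omega w ->
  enorm (w - x) = D x -> w = p x.
Proof.
move=> Ox Dx Bw wx; have [_ + _ _] := p_proj => /(_ x w (collarE Ox Dx) Bw).
by rewrite edist_boundary//; [exact | exact: setC_domain_neq0].
Qed.

Lemma domain_edist_gt0 x : Omega x -> 0 < D x.
Proof. exact: edist_gt0 setC_domain_neq0. Qed.

(** Along the segment the distance to [p x] drops at unit rate and the distance to the complement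
    cannot drop faster, so [p x] remains a nearest point; uniqueness concludes. *)
Lemma proj_segment x (t : R) : Omega x -> D x < eps0 -> 0 <= t < 1 ->
  p (x + t *: (p x - x)) = p x.
Proof.
move=> Ox Dx /andP[t0 t1]; have [Bp px] := projP Ox Dx.
set y := x + _; have nO := setC_domain_neq0; have D0 := domain_edist_gt0 Ox.
have py : enorm (p x - y) = (1 - t) * D x.
  rewrite /y (_ : _ - _ = (1 - t) *: (p x - x)) ?enormZ ?px ?ger0_norm ?subr_ge0 ?ltW//.
  by rewrite scalerBl scale1r opprD addrA.
have xy : enorm (x - y) = t * D x by rewrite /y opprD addrA subrr sub0r enormN enormZ px ger0_norm.
have Dy : D y = (1 - t) * D x.
  apply/eqP; rewrite eq_le -{1}py edist_le//=; last exact: boundary_setC Bp.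
  by have := edist_lipschitz x y nO; rewrite xy; lra.
have Oy : Omega y by apply: edist_setC => //; rewrite Dy mulr_gt0// subr_gt0.
apply/esym/proj_uniq => //; last by rewrite Dy.
by rewrite Dy; apply: le_lt_trans Dx; rewrite ler_piMl ?(ltW D0)//; lra.
Qed.

(** [p] is constant on the segment towards [p x]. As a consequence, motion along the normal moves
    the reflected point with the opposite velocity. *)
Lemma diff_proj_normal x : Omega x -> D x < eps0 -> 'd p x (x - p x) = 0.
Proof.
move=> Ox Dx; have [_ _ [dp _] _] := p_proj.
have {}dp := dp x (collarE Ox Dx).
apply/eqP/negPn/negP; rewrite -normr_gt0 => n0.
(* The increment is negative because [x - p x] points away from the boundary; the bound 1/2 keeps
   the point on the segment of [proj_segment]. *)
have [d d0 /(_ (- Num.min (d / 2) (1 / 2)))] := diff_quotient (x - p x) dp n0.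
have m0 : 0 < Num.min (d / 2) (1 / 2) by rewrite lt_min !divr_gt0.
rewrite oppr_eq0 gt_eqF// normrN gtr0_norm// => /(_ isT).
rewrite gt_min ltr_pdivrMr// ltr_pMr// ltr1n => /(_ isT).
rewrite scaleNr -scalerN opprB [_ + x]addrC proj_segment// ?subrr ?scaler0 ?subr0 ?ltxx//.
by rewrite ltW//= gt_min; apply/orP; right; lra.
Qed.

Lemma diff_proj_bound x (C : R) v : Omega x -> D x < eps0 ->
  (exists2 d : R, 0 < d & forall y, Omega y -> enorm (x - y) < d -> enorm (p y - p x) <= C * enorm (y - x)) ->
  enorm ('d p x v) <= C * enorm v.
Proof.
move=> Ox Dx [d d0 Hd]; have [_ _ [dp _] _] := p_proj.
have {}dp := dp x (collarE Ox Dx).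
apply/ler_addgt0Pl => e e0; have e2 : 0 < e / 2 by rewrite divr_gt0.
have [d' d'0 Hd'] := diff_quotient v dp e2.
have /open_enormP/(_ _ Ox)[r r0 Or] := oO.
have v1 : 0 < enorm v + 1 by rewrite ltr_pwDr// enorm_ge0.
pose h := Num.min (d' / 2) (Num.min d r / 2 / (enorm v + 1)).
have dr : 0 < Num.min d r by rewrite lt_min d0.
have h0 : 0 < h by rewrite lt_min !divr_gt0.
have hd' : `|h| < d' by rewrite gtr0_norm// gt_min ltr_pdivrMr// ltr_pMr// ltr1n.
have hv : enorm (h *: v) < Num.min d r.
  rewrite enormZ gtr0_norm//; have : h <= Num.min d r / 2 / (enorm v + 1) by rewrite ge_min lexx orbT.
  rewrite ler_pdivlMr// => hm; have := enorm_ge0 v; nra.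
have xh : enorm (x - (h *: v + x)) = enorm (h *: v) by rewrite opprD addrCA subrr addr0 enormN.
have := Hd' h; rewrite gt_eqF// => /(_ isT hd').
set q := h^-1 *: _ => dq.
have : enorm q <= C * enorm v.
  rewrite /q enormZ gtr0_norm ?invr_gt0// ler_pdivrMl//.
  move: hv; rewrite lt_min => /andP[hvd hvr].
  apply: le_trans (Hd _ _ _) _; rewrite ?xh//; first by apply: Or; rewrite xh.
  by rewrite addrK enormZ gtr0_norm// mulrCA.
have := enorm_le_norm ('d p x v - q); have := ler_enormD ('d p x v - q) q.
by rewrite subrK; lra.
Qed.

End Projection.

(** * The boundary as a graph *)

Section Chart.
Context {R : realType}.
Notation plane := 'rV[R]_2.

Lemma C3_real (f : R -> R) : Ck_on 3 [set: R] f ->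
  exists f1 f2 : R -> R, [/\ forall t : R, is_derive t 1 f (f1 t),
    forall t : R, is_derive t 1 f1 (f2 t) & continuous f2].
Proof.
move=> [df /(_ 1)[df1 /(_ 1)[df2 _]]].
have H (g : R -> R) (t : R) : differentiable g t -> is_derive t 1 g ('d g t 1).
  by move=> dg; apply: DeriveDef; [exact: diff_derivable | rewrite deriveE].
exists (fun t => 'd f t 1), (fun t => 'd (fun t => 'd f t 1) t 1); split.
- by move=> t; apply: H; exact: df.
- by move=> t; apply: H; exact: df1.
- by move=> t; apply: differentiable_continuous; exact: df2.
Qed.

Lemma norm_convex_lt (r s t u : R) : `|s| < r -> `|t| < r -> 0 <= u <= 1 ->
  `|s + u * (t - s)| < r.
Proof.
move=> sr tr /andP[u0 u1]; have u1' : 0 <= 1 - u by rewrite subr_ge0.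
apply: (@le_lt_trans _ _ (Num.max `|s| `|t|)); last by rewrite gt_max sr.
rewrite (_ : s + _ = (1 - u) * s + u * t); last by ring.
apply: le_trans (ler_normD _ _) _; rewrite !normrM (ger0_norm u0) (ger0_norm u1').
have h1 : (1 - u) * `|s| <= (1 - u) * Num.max `|s| `|t| by rewrite ler_wpM2l// le_max lexx.
have h2 : u * `|t| <= u * Num.max `|s| `|t| by rewrite ler_wpM2l// le_max lexx orbT.
by lra.
Qed.

Lemma taylor_local (f f1 f2 : R -> R) : (forall t : R, is_derive t 1 f (f1 t)) ->
  (forall t : R, is_derive t 1 f1 (f2 t)) -> continuous f2 ->
  exists K r : R, [/\ 0 < K, 0 < r & forall s t, `|s| < r -> `|t| < r ->
    `|f1 t - f1 s| <= K * `|t - s| /\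
    `|f t - f s - f1 s * (t - s)| <= K * (t - s) ^+ 2].
Proof.
move=> d1 d2 c2; pose K := `|f2 0| + 1.
have K0 : 0 < K by rewrite ltr_pwDr.
have /cvgrPdist_lt/(_ 1 ltr01)/nbhs_ballP[r /= r0 Hr] := c2 0.
exists K, r; split => // s t sr tr.
have f2K u : `|u| < r -> `|f2 u| <= K.
  move=> ur; have := Hr u; rewrite -ball_normE /= sub0r normrN => /(_ ur).
  rewrite distrC => h; have := ler_normD (f2 u - f2 0) (f2 0); rewrite subrK /K; lra.
have between u : 0 <= u <= 1 -> `|s + u * (t - s)| < r by exact: norm_convex_lt.
have lip u : `|u| < r -> `|f1 u - f1 s| <= K * `|u - s|.
  move=> ur; have [v v01 ->] := MVT_between s u d2.
  rewrite normrM ler_wpM2r// f2K//.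
  exact: norm_convex_lt.
split; first exact: lip.
have [v v01 ->] := MVT_between s t d1.
rewrite -mulrBl normrM -(real_normK (num_real (t - s))) expr2 mulrA ler_wpM2r//.
apply: le_trans (lip _ (between _ v01)) _; rewrite [s + _]addrC addrK normrM mulrA ler_wpM2r//.
by case/andP: v01 => v0 v1; rewrite ger0_norm// ler_piMr// ltW.
Qed.

Lemma edot_orthonormal (e1 e2 u v : plane) :
  edot e1 e1 = 1 -> edot e2 e2 = 1 -> edot e1 e2 = 0 ->
  edot u v = edot u e1 * edot v e1 + edot u e2 * edot v e2.
Proof.
move=> h1 h2 h12.
pose w := u - (edot u e1 *: e1 + edot u e2 *: e2).
have w1 : edot w e1 = 0 by rewrite /w !edot_lin h1 (edotC e2) h12; ring.
have w2 : edot w e2 = 0 by rewrite /w !edot_lin h2 h12; ring.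
have w0 : w = 0.
  move: w1 w2 h1 h2 h12; rewrite !edotE; set a := e1 0 0; set b := e1 0 1.
  set c := e2 0 0; set d := e2 0 1; set x := w 0 0; set y := w 0 1 => w1 w2 h1 h2 h12.
  have det : (a * d - b * c) ^+ 2 = 1.
    rewrite (_ : _ ^+ 2 = (a * a + b * b) * (c * c + d * d) - (a * c + b * d) ^+ 2); last by ring.
    by rewrite h1 h2 h12; ring.
  have x0 : x = 0.
    rewrite -[x]mul1r -det (_ : _ * x = (a * d - b * c) * (d * (x * a + y * b) - b * (x * c + y * d))); last by ring.
    by rewrite w1 w2; ring.
  have y0 : y = 0.
    rewrite -[y]mul1r -det (_ : _ * y = (a * d - b * c) * (a * (x * c + y * d) - c * (x * a + y * b))); last by ring.
    by rewrite w1 w2; ring.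
  by apply: rV2P; rewrite [RHS]mxE; [exact: x0 | exact: y0].
have -> : u = edot u e1 *: e1 + edot u e2 *: e2 by apply/eqP; rewrite -subr_eq0; apply/eqP.
by rewrite !edot_lin h1 h2 h12 (edotC e2 e1) h12 (edotC e1 v) (edotC e2 v); ring.
Qed.

Lemma orthonormal_eq (e1 e2 u v : plane) :
  edot e1 e1 = 1 -> edot e2 e2 = 1 -> edot e1 e2 = 0 ->
  edot u e1 = edot v e1 -> edot u e2 = edot v e2 -> u = v.
Proof.
move=> h1 h2 h12 uv1 uv2; apply/eqP; rewrite -subr_eq0 -edot_eq0.
by rewrite (edot_orthonormal _ _ h1 h2 h12) !edotBl uv1 uv2 !subrr; apply/eqP; ring.
Qed.

Lemma enorm_unit (e : plane) : edot e e = 1 -> enorm e = 1.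
Proof. by move=> h; rewrite /enorm h sqrtr1. Qed.

Section BoundaryChart.
Variables (Omega : set plane) (eps0 : R) (p : plane -> plane).
Hypotheses (Omega_domain : bounded_domain Omega) (eps0_gt0 : 0 < eps0)
  (p_proj : boundary_projection Omega eps0 p).
Notation D x := (edist x (~` Omega)).

Let oO : open Omega. Proof. by case: Omega_domain. Qed.

(** A boundary point is not in [Omega], hence not above the graph; strictly below the graph, a whole
    neighbourhood would miss [Omega]. *)
Lemma chart_boundary (q0 : plane) (r : R) (e1 e2 : plane) (gamma : R -> R) (q : plane) :
  (forall t : R, differentiable gamma t) -> (forall y, enorm (y - q0) < r ->
     (Omega y <-> gamma (edot (y - q0) e1) < edot (y - q0) e2)) ->
  boundary Omega q -> enorm (q - q0) < r ->
  edot (q - q0) e2 = gamma (edot (q - q0) e1).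
Proof.
move=> gc Hc Bq qr; apply/eqP; rewrite eq_le; apply/andP; split.
  by rewrite leNgt; apply/negP => /Hc => /(_ qr); exact: boundary_setC Bq.
rewrite leNgt; apply/negP => lt.
have dc (e y : plane) : differentiable (fun y : plane => edot (y - q0) e : R) y.
  have hd : is_diff y (fun y : plane => y - q0) (id - 0) := is_diffB (is_diff_id y) (is_diff_cst q0 y).
  have hc : is_diff y (fun=> e) (0 : plane -> plane) := is_diff_cst e y.
  by case: (is_diff_edot hd hc).
have ac : {for q, continuous (fun y : plane => gamma (edot (y - q0) e1) - edot (y - q0) e2)}.
  apply: differentiable_continuous; apply: (@differentiableB _ _ _ (fun y : plane => gamma (edot (y - q0) e1))) => //.
  exact: (@differentiable_comp _ _ _ _ (fun y : plane => edot (y - q0) e1) gamma _ (dc e1 q)).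
have nb : \forall y \near q, 0 < gamma (edot (y - q0) e1) - edot (y - q0) e2.
  by apply: (cvgr_gt _ ac); rewrite subr_gt0.
have nb2 : \forall y \near q, enorm (y - q0) < r.
  apply/nbhs_enormP; exists (r - enorm (q - q0)); first by rewrite subr_gt0.
  by move=> v qv; have := ler_enorm_dist v q q0; rewrite (enormB v q); lra.
case: Bq => cq _; have [y [Oy [/= y1 y2]]] := cq _ (filterI nb nb2).
by move/Hc : Oy => /(_ y2); rewrite ltNge ltW// -subr_gt0.
Qed.


(** Among the nearby points of the graph [p x] is nearest to [x], so the derivative of the squared
    distance along the graph vanishes there: [x - p x] is normal to the graph. *)
Lemma chart_normal_form (q0 : plane) : Ck_boundary 3 Omega -> boundary Omega q0 ->
  exists (e1 e2 : plane) (f f1 : R -> R) (K d : R),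
  [/\ [/\ edot e1 e1 = 1, edot e2 e2 = 1 & edot e1 e2 = 0], 0 < K, 0 < d,
    (forall s t, `|s| < d -> `|t| < d -> `|f1 t - f1 s| <= K * `|t - s| /\
      `|f t - f s - f1 s * (t - s)| <= K * (t - s) ^+ 2) &
    forall x, Omega x -> enorm (x - q0) < d / 2 ->
      [/\ D x < eps0, `|edot (p x - q0) e1| <= 2 * enorm (x - q0),
        edot (p x - q0) e2 = f (edot (p x - q0) e1) &
        exists2 Y : R, 0 < Y & x - p x = Y *: (e2 - f1 (edot (p x - q0) e1) *: e1)]].
Proof.
move=> C3 Bq0; have [r [e1 [e2 [f [r0 [h1 h2 h12] Cf Hf]]]]] := C3 _ Bq0.
have [f1 [f2 [d1 d2 c2]]] := C3_real Cf.
have [K [r1 [K0 r10 taylor]]] := taylor_local d1 d2 c2.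
have fc t : differentiable f t by apply/derivable1_diffP; case: (d1 t).
have f0 : f 0 = 0.
  have := chart_boundary fc Hf Bq0; rewrite subrr enorm0 !edot0l => /(_ r0)//.
have en1 := enorm_unit h1; have en2 := enorm_unit h2.
pose L := 1 + `|f1 0| + K; have L0 : 0 < L by rewrite /L; have := normr_ge0 (f1 0); lra.
(* [eps0] puts [x] into the collar, [r1] and 1 serve the Taylor estimate, [r / L] keeps the graph
   points inside the ball of the chart, and [1 / K] decides the sign of [Y]. *)
pose d := Num.min (Num.min eps0 (Num.min r1 1)) (Num.min (r / L) (1 / K)).
have [de [dr1 [dle1 [drL dK]]]] : d <= eps0 /\ d <= r1 /\ d <= 1 /\ d <= r / L /\ d <= 1 / K.
  by rewrite /d !ge_min !lexx !orbT.
have d0 : 0 < d by rewrite /d !lt_min eps0_gt0 r10 ltr01 !divr_gt0.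
have dr : d <= r.
  apply: le_trans drL _; rewrite ler_pdivrMr// ler_peMr ?ltW//.
  by rewrite /L; have := normr_ge0 (f1 0); lra.
have fsmall t : `|t| < d -> `|t| + `|f t| < r.
  move=> td; have td1 : `|t| < r1 by exact: lt_le_trans td dr1.
  have := taylor 0 t; rewrite normr0 f0 !subr0 => /(_ r10 td1)[_ h].
  have t2 : t ^+ 2 <= `|t|.
    by rewrite -real_normK ?num_real// expr2 ler_piMr// ltW// (lt_le_trans td).
  have : `|f t| <= (`|f1 0| + K) * `|t|.
    have := ler_normD (f t - f1 0 * t) (f1 0 * t); rewrite subrK normrM mulrDl.
    by have := ler_wpM2l (ltW K0) t2; lra.
  have : L * `|t| < r by rewrite mulrC -ltr_pdivlMr// (lt_le_trans td).
  by rewrite /L !mulrDl; lra.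
exists e1, e2, f, f1, K, d; split; [by [] | by [] | by [] | move=> s t sd td | move=> x Ox xq].
  by apply: taylor; [exact: lt_le_trans sd _ | exact: lt_le_trans td _].
have nO := setC_domain_neq0 Omega_domain.
have nOq0 : ~ Omega q0 by exact: boundary_setC Bq0.
have Dx : D x <= enorm (x - q0) by rewrite enormB; exact: edist_le.
have Dxe : D x < eps0 by lra.
have [Bp px] := projP Omega_domain p_proj Ox Dxe.
have pq : enorm (p x - q0) <= 2 * enorm (x - q0).
  by have := ler_enorm_dist (p x) x q0; rewrite px; lra.
set s := edot (p x - q0) e1.
have sle : `|s| <= 2 * enorm (x - q0).
  by apply: le_trans (cauchy_schwarz _ _) _; rewrite en1 mulr1.
have sd : `|s| < d by lra.
have pf : edot (p x - q0) e2 = f s.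
  apply: (chart_boundary fc Hf Bp); lra.
split => //.
set X := edot (x - q0) e1; set Z := edot (x - q0) e2.
pose w t := q0 + (t *: e1 + f t *: e2).
have wE t : w t - q0 = t *: e1 + f t *: e2 by rewrite /w [LHS]addrC addKr.
have w1 t : edot (w t - q0) e1 = t.
  by rewrite wE !edot_lin h1 (edotC e2) h12; ring.
have w2 t : edot (w t - q0) e2 = f t.
  by rewrite wE !edot_lin h2 h12; ring.
have wq t : `|t| < d -> enorm (w t - q0) < r.
  move=> /fsmall; apply: le_lt_trans; rewrite wE.
  by apply: le_trans (ler_enormD _ _) _; rewrite !enormZ en1 en2 !mulr1.
have nw t : `|t| < d -> ~ Omega (w t).
  by move=> td /(Hf _ (wq _ td)); rewrite w1 w2 ltxx.
pose phi (t : R) := (t - X) ^+ 2 + (f t - Z) ^+ 2.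
have phiE y : edot (y - x) (y - x) = (edot (y - q0) e1 - X) ^+ 2 + (edot (y - q0) e2 - Z) ^+ 2.
  by rewrite (edot_orthonormal _ _ h1 h2 h12) /X /Z -!edotBl !expr2 opprB addrA subrK.
have phis : phi s = D x ^+ 2 by rewrite -px sqr_enorm phiE pf.
have phi_ge t : `|t| < d -> phi s <= phi t.
  move=> /nw nwt; rewrite phis /phi -{1}(w1 t) -(w2 t) -phiE -sqr_enorm.
  by rewrite ler_pXn2r ?nnegrE ?enorm_ge0 ?edist_ge0// edist_le.
have dphi (t : R) : is_derive t 1 phi (2 * (t - X) + 2 * (f t - Z) * f1 t).
  have df := d1 t.
  have phiF : phi = ((id : R -> R) - cst X) ^+ 2 + (f - cst Z) ^+ 2.
    by apply/funext => u; rewrite /phi !fctE.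
  rewrite phiF; have h := is_deriveD
    (is_deriveX 2 (is_deriveB (is_derive_id t 1) (is_derive_cst X t 1)))
    (is_deriveX 2 (is_deriveB df (is_derive_cst Z t 1))).
  by apply: (@is_derive_eq _ _ _ _ _ _ _ _ h); rewrite /GRing.scale /= !fctE; ring.
have [/andP[sd1 sd2]] : - d < s < d by rewrite -ltr_norml.
have dphi0 : is_derive s 1 phi 0.
  apply: (@derive1_at_min _ _ (- d) d) => [|t _||t]; [lra|by case: (dphi t)|by rewrite in_itv /= sd1|].
  by rewrite in_itv /= -ltr_norml => /phi_ge.
have stat : 2 * (s - X) + 2 * (f s - Z) * f1 s = 0.
  by rewrite -(@derive_val _ _ _ _ _ _ _ (dphi s)) (@derive_val _ _ _ _ _ _ _ dphi0).
pose Y := Z - f s.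
have XE : X = s - f1 s * Y by rewrite /Y; lra.
have xpE : x - p x = Y *: (e2 - f1 s *: e1).
  have xp e : edot (x - p x) e = edot (x - q0) e - edot (p x - q0) e.
    by rewrite -edotBl opprB addrA subrK.
  apply: (orthonormal_eq h1 h2 h12); rewrite xp -/X -/Z ?pf -/s.
    by rewrite XE !edot_lin h1 (edotC e2) h12; ring.
  by rewrite !edot_lin h2 h12 /Y; ring.
(* If [Y <= 0], the Taylor estimate at [s] gives [f X >= f s - f1 s ^+ 2 * Y * (1 + K * Y) >= f s],
   whereas [x] in [Omega] means [f X < f s + Y]. *)
exists Y => //; rewrite ltNge; apply/negP => Y0.
have Yd : `|Y| < d.
  have := cauchy_schwarz (x - p x) e2; rewrite en2 mulr1 enormB px xpE !edot_lin h2 h12 mulr0 subr0 mulr1.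
  by lra.
have Xd : `|X| < d.
  by have := cauchy_schwarz (x - q0) e1; rewrite en1 mulr1 -/X; have := enorm_ge0 (x - q0); lra.
have [_] := taylor s X (lt_le_trans sd dr1) (lt_le_trans Xd dr1).
have : f X < Z by apply/Hf => //; have := enorm_ge0 (x - q0); lra.
have -> : X - s = - (f1 s * Y) by rewrite XE; ring.
have -> : Z = f s + Y by rewrite /Y; ring.
rewrite ler_norml => fX /andP[tlo _].
have K1 : K * `|Y| <= 1.
  by rewrite mulrC -ler_pdivlMr// ltW// (lt_le_trans Yd).
rewrite ler0_norm// in K1.
have := mulr_ge0 (sqr_ge0 (f1 s)) (_ : 0 <= 1 + K * Y).
have := sqr_ge0 (f1 s).
nra.
Qed.

End BoundaryChart.
End Chart.

Section BoundaryGeometry.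
Context {R : realType}.
Notation plane := 'rV[R]_2.
Variables (Omega : set plane) (eps0 : R) (p : plane -> plane).
Hypotheses (Omega_domain : bounded_domain Omega) (eps0_gt0 : 0 < eps0)
  (Omega_C3 : Ck_boundary 3 Omega) (p_proj : boundary_projection Omega eps0 p).
Notation D x := (edist x (~` Omega)).

Lemma edot_normalized (u : plane) : u != 0 ->
  edot ((enorm u)^-1 *: u) ((enorm u)^-1 *: u) = 1.
Proof. by rewrite -enorm_eq0 => u0; rewrite edotZl edotZr -sqr_enorm; field. Qed.

(** [n] is the inward unit normal at [q0]. In the blow-up, the two estimates with [eta] turn the
    boundary into a straight line orthogonal to [n]. *)
Lemma boundary_geometry (q0 : plane) : boundary Omega q0 ->
  exists2 n : plane, edot n n = 1 & forall eta : R, 0 < eta ->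
  exists2 d : R, 0 < d & forall x y, Omega x -> Omega y ->
    enorm (x - q0) < d -> enorm (y - q0) < d ->
    [/\ D x < eps0, enorm ((x - p x) - D x *: n) <= eta * D x,
        `|edot (p x - p y) n| <= eta * enorm (p x - p y) &
        enorm (p x - p y) <= 2 * enorm (x - y)].
Proof.
move=> Bq0.
have [e1 [e2 [f [f1 [K [d [[h1 h2 h12] K0 d0 taylor form]]]]]]] :=
  chart_normal_form Omega_domain eps0_gt0 p_proj Omega_C3 Bq0.
have nO := setC_domain_neq0 Omega_domain.
have en1 := enorm_unit h1; have en2 := enorm_unit h2.
pose N s : plane := e2 - f1 s *: e1.
have NN s : edot (N s) (N s) = 1 + f1 s ^+ 2.
  by rewrite /N !edot_lin h1 h2 h12 (edotC e2) h12; ring.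
have N1 s : 1 <= enorm (N s).
  rewrite -(@ler_pXn2r _ 2)// ?nnegrE ?enorm_ge0//.
  by rewrite sqr_enorm NN expr1n lerDl sqr_ge0.
have N0 s : enorm (N s) != 0 by rewrite gt_eqF// (lt_le_trans ltr01).
exists ((enorm (N 0))^-1 *: N 0).
  by rewrite edot_normalized// -enorm_eq0.
move=> eta eta0.
(* [c * K <= 1 / 8] absorbs the curvature terms in the Lipschitz estimate for [p];
   [c * K <= eta / 16] keeps the turning of the normal small enough for the other two estimates. *)
pose c := Num.min (d / 2) (Num.min (1 / (8 * K)) (eta / (16 * K))).
have c0 : 0 < c by rewrite !lt_min !divr_gt0 ?mulr_gt0.
have [cd [cK ceta]] : c <= d / 2 /\ c <= 1 / (8 * K) /\ c <= eta / (16 * K).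
  by rewrite /c !ge_min !lexx !orbT.
have cK' : c * K <= 1 / 8.
  by have := ler_wpM2r (ltW K0) cK; congr (_ <= _); field; rewrite gt_eqF.
have ceta' : c * K <= eta / 16.
  by have := ler_wpM2r (ltW K0) ceta; congr (_ <= _); field; rewrite gt_eqF.
have data x : Omega x -> enorm (x - q0) < c ->
    [/\ D x < eps0, `|edot (p x - q0) e1| < 2 * c,
      edot (p x - q0) e2 = f (edot (p x - q0) e1) &
      exists Y : R, [/\ 0 < Y, x - p x = Y *: N (edot (p x - q0) e1),
        D x = Y * enorm (N (edot (p x - q0) e1)) & Y <= D x]].
  move=> Ox xc; have [|Dx s2 pf [Y Y0 xp]] := form x Ox; first exact: lt_le_trans cd.
  have [_ px] := projP Omega_domain p_proj Ox Dx.
  have DE : D x = Y * enorm (N (edot (p x - q0) e1)).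
    by rewrite -px enormB xp enormZ gtr0_norm.
  split => //; first by lra.
  by exists Y; split => //; rewrite DE ler_peMr// ltW.
exists c => // x y Ox Oy xc yc.
have [Dx s2 pxf [Y [Y0 xp DxE YD]]] := data x Ox xc.
have [Dy t2 pyf [Z [Z0 yp DyE ZD]]] := data y Oy yc.
set s := edot (p x - q0) e1 in s2 pxf xp DxE *.
set t := edot (p y - q0) e1 in t2 pyf yp DyE *.
have sd : `|s| < d by elra.
have td : `|t| < d by elra.
have P1 : edot (p x - p y) e1 = s - t by rewrite /s /t -edotBl opprB addrA subrK.
have P2 : edot (p x - p y) e2 = f s - f t by rewrite -pxf -pyf -edotBl opprB addrA subrK.
have Pst : `|s - t| <= enorm (p x - p y).
  by rewrite -P1; have := cauchy_schwarz (p x - p y) e1; rewrite en1 mulr1.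
have t0 u : `|u| < d -> `|f1 u - f1 0| <= K * `|u|.
  by move=> ud; have := taylor 0 u; rewrite normr0 !subr0 => /(_ d0 ud)[].
split => //.
- have -> : x - p x - D x *: ((enorm (N 0))^-1 *: N 0) =
      Y *: (N s - N 0 + (1 - enorm (N s) / enorm (N 0)) *: N 0).
    by rewrite xp DxE; apply/rowP => j; rewrite !mxE; ring.
  rewrite enormZ gtr0_norm//.
  have NsN0 : enorm (N s - N 0) <= K * `|s|.
    rewrite (_ : N s - N 0 = - (f1 s - f1 0) *: e1); last first.
      by apply/rowP => j; rewrite !mxE; ring.
    by rewrite enormZ en1 mulr1 normrN t0.
  have h : enorm ((1 - enorm (N s) / enorm (N 0)) *: N 0) <= K * `|s|.
    rewrite enormZ -{2}(ger0_norm (enorm_ge0 (N 0))) -normrM mulrBl mul1r divfK//.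
    by apply: le_trans (ler_dist_enorm _ _) _; rewrite enormB.
  have := ler_enormD (N s - N 0) ((1 - enorm (N s) / enorm (N 0)) *: N 0).
  move=> h2'; have : enorm (N s - N 0 + (1 - enorm (N s) / enorm (N 0)) *: N 0) <= eta.
    by have := ler_wpM2l (ltW K0) (ltW s2); lra.
  by move=> h3; rewrite mulrC; apply: ler_pM => //; [exact: enorm_ge0 | exact: ltW].
- rewrite edotZr normrM normrV ?unitfE// ger0_norm ?enorm_ge0//.
  apply: (@le_trans _ _ `|edot (p x - p y) (N 0)|).
    by rewrite ler_piMl// invf_le1// (lt_le_trans ltr01).
  have -> : edot (p x - p y) (N 0) = (f s - f t - f1 t * (s - t)) + (f1 t - f1 0) * (s - t).
    by rewrite /N edotBr edotZr P1 P2; ring.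
  apply: le_trans (ler_normD _ _) _.
  have [_ h] := taylor t s td sd; have h' := t0 t td.
  rewrite normrM.
  have st4 : `|s - t| <= 4 * c by have := ler_normB s t; lra.
  have e1' : K * (s - t) ^+ 2 <= K * (4 * c) * `|s - t|.
    by rewrite -real_normK ?num_real// expr2 mulrA ler_wpM2r// ler_wpM2l// ltW.
  have e2' : `|f1 t - f1 0| * `|s - t| <= K * (2 * c) * `|s - t|.
    by rewrite ler_wpM2r//; apply: le_trans h' _; rewrite ler_wpM2l ?ltW.
  have e3 : K * (4 * c) * `|s - t| + K * (2 * c) * `|s - t| <= eta * `|s - t|.
    by rewrite -mulrDl ler_wpM2r//; lra.
  have e4 : eta * `|s - t| <= eta * enorm (p x - p y) by rewrite ler_wpM2l// ltW.
  by lra.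
(* [x - p x] and [y - p y] are normal to the graph, so their products with [p x - p y] are
   second-order terms with factors [Y] and [Z] at most [c]: each costs at most an eighth of the
   squared length. *)
- have Q u v (W : R) : `|u| < d -> `|v| < d -> 0 < W -> W <= c ->
      W * (f v - f u - f1 u * (v - u)) <= 1 / 8 * (v - u) ^+ 2.
    move=> ud vd W0 Wc; have [_] := taylor u v ud vd; rewrite ler_norml => /andP[_ h].
    apply: (@le_trans _ _ (W * (K * (v - u) ^+ 2))); first by rewrite ler_wpM2l// ltW.
    rewrite mulrA ler_wpM2r ?sqr_ge0//; apply: le_trans cK'.
    by rewrite ler_wpM2r// ltW.
  have nq0 : ~ Omega q0 by apply: boundary_setC Bq0; case: Omega_domain.
  have Dc (z : plane) : enorm (z - q0) < c -> D z <= c.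
    by move=> zc; have := @edist_le _ (~` Omega) z q0 nq0; rewrite enormB; elra.
  have Yc : Y <= c by exact: le_trans YD (Dc _ xc).
  have Zc : Z <= c by exact: le_trans ZD (Dc _ yc).
  have Q1 := Q s t Y sd td Y0 Yc; have Q2 := Q t s Z td sd Z0 Zc.
  have x1 : edot (x - p x) (p x - p y) = - (Y * (f t - f s - f1 s * (t - s))).
    by rewrite xp edotZl edotC edotBr edotZr P1 P2; ring.
  have y1 : edot (y - p y) (p x - p y) = Z * (f s - f t - f1 t * (s - t)).
    by rewrite yp edotZl edotC edotBr edotZr P1 P2; ring.
  have st2 : (s - t) ^+ 2 <= enorm (p x - p y) ^+ 2.
    by rewrite -real_normK ?num_real// ler_pXn2r ?nnegrE ?enorm_ge0.
  have main : enorm (p x - p y) ^+ 2 =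
      edot (x - y) (p x - p y) - edot (x - p x) (p x - p y) + edot (y - p y) (p x - p y).
    by rewrite sqr_enorm -edotBl -edotDl; congr edot; apply/rowP => j; rewrite !mxE; ring.
  have cs := ler_edot (x - y) (p x - p y).
  have tt : (t - s) ^+ 2 = (s - t) ^+ 2 by rewrite -sqrrN opprB.
  have E0 := enorm_ge0 (p x - p y); have E1 := enorm_ge0 (x - y).
  rewrite x1 y1 in main; rewrite tt in Q1.
  have fin : enorm (p x - p y) * enorm (p x - p y) <= (2 * enorm (x - y)) * enorm (p x - p y) by nra.
  have [->|n0] := eqVneq (enorm (p x - p y)) 0; first by rewrite mulr_ge0.
  by move: fin; rewrite ler_pM2r// lt_neqAle eq_sym n0.
Qed.

End BoundaryGeometry.

(** * The Green function *)

Section DiffTools.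
Context {R : realType}.
Notation plane := 'rV[R]_2.

Lemma is_diff_near_eq (V W : normedModType R) (f h dh : V -> W) (x : V) :
  (\forall z \near x, f z = h z) -> is_diff x h dh -> is_diff x f dh.
Proof.
move=> fh hd; pose k : V -> W := f - h.
have fE : f = h + k by rewrite /k addrC subrK.
have kx : k x = 0 by rewrite /k !fctE (nbhs_singleton fh) subrr.
have ko : k \o shift x = cst (k x) + (\0 : V -> W) +o_ 0 id.
  apply/eqaddoP => e e0; rewrite kx.
  have : \forall z \near (0 : V), f (z + x) = h (z + x).
    have sc : {for (0 : V), continuous (shift x)} by apply: cvgD; [exact: cvg_id | exact: cvg_cst].
    by have := sc [set z | f z = h z]; rewrite /= add0r; exact.
  apply: filterS => z /= fz; rewrite !fctE /= /k !fctE fz.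
  by rewrite subrr addr0 subrr normr0 mulr_ge0// ltW.
have k0 : 'd k x = (\0 : V -> W) :> (V -> W).
  by apply/diff_unique => //; exact: cst_continuous.
have kd : differentiable k x.
  by apply/diff_locallyP; rewrite k0; split => //; exact: cst_continuous.
have kD : is_diff x k (0 : V -> W) by apply: DiffDef.
by rewrite fE; apply: is_diff_eq (is_diffD hd kD) _; rewrite addr0.
Qed.

Lemma plane_basis (v : plane) : v = v 0 0 *: delta_mx 0 0 + v 0 1 *: delta_mx 0 1.
Proof. by apply: rV2P; rewrite !mxE /=; ring. Qed.

Lemma edotBN (x y v : plane) : edot (y - x) v = - edot (x - y) v.
Proof. by rewrite -opprB edotNl. Qed.

Lemma edotBB (x y : plane) : edot (y - x) (y - x) = edot (x - y) (x - y).
Proof. by rewrite -opprB edotNl edotNr opprK. Qed.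

Lemma diff_grad (f : plane -> R) (x v : plane) : 'd f x v = edot (grad f x) v.
Proof.
by rewrite {1}(plane_basis v) linearD !linearZ edotE !mxE; congr (_ + _); exact: mulrC.
Qed.

Lemma ler_diff_grad (f : plane -> R) (x v : plane) : `|'d f x v| <= enorm (grad f x) * enorm v.
Proof. by rewrite diff_grad cauchy_schwarz. Qed.

End DiffTools.

(** Any property that is monotone in [M] qualifies, so lower bounds (as [- M]) and radii (as
    [expR (- M)]) are covered as well. *)
Lemma compact_bound (R : realType) (T : topologicalType) (K : set T) (P : R -> T -> Prop) :
  compact K -> (forall M M' a, M <= M' -> P M a -> P M' a) ->
  (forall a, K a -> exists M, \forall b \near a, P M b) ->
  exists M, forall a, K a -> P M a.
Proof.
move=> /compact_near_coveringP cK mono loc.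
have [|M [_ KM]] := cK R +oo P _; last by exists (M + 1) => a; apply: KM; rewrite ltrDl.
move=> a /loc[M aM]; exists ([set b | P M b], [set M' | M <= M']) => /=.
  by split => //; exact: nbhs_pinfty_ge (num_real M).
by move=> [b M'] /= [Pb MM']; exact: mono Pb.
Qed.

(** Pythagoras up to constants, for [P] nearly tangential and [A] nearly normal of length about
    [T]. *)
Lemma near_orthogonal_sum (R : realType) (P A n : 'rV[R]_2) (T : R) :
  0 <= T -> edot n n = 1 -> `|edot P n| <= 1 / 8 * enorm P ->
  enorm (A - T *: n) <= 1 / 8 * T ->
  1 / 2 * enorm P ^+ 2 + 1 / 2 * T ^+ 2 <= enorm (P - A) ^+ 2.
Proof.
move=> T0 n1 Pn At; have en1 := enorm_unit n1.
have PA : edot P A <= 1 / 4 * (T * enorm P).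
  have -> : edot P A = edot P (A - T *: n) + T * edot P n by rewrite edotBr edotZr subrK.
  have h1 := ler_edot P (A - T *: n); have h2 := ler_norm (edot P n).
  have h3 : enorm P * enorm (A - T *: n) <= enorm P * (1 / 8 * T) by rewrite ler_wpM2l ?enorm_ge0.
  have h4 : T * edot P n <= T * (1 / 8 * enorm P) by rewrite ler_wpM2l//; lra.
  move: h1 h3 h4; move: (edot P _) (edot P n) (enorm P) (enorm (A - _)) => *; lra.
have Alow : 7 / 8 * T <= enorm A.
  have := ler_enormB A (A - T *: n); rewrite opprB addrC subrK enormZ en1 mulr1 ger0_norm//.
  lra.
have sqA : 49 / 64 * T ^+ 2 <= enorm A ^+ 2.
  rewrite (_ : 49 / 64 * T ^+ 2 = (7 / 8 * T) ^+ 2); last by field.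
  by rewrite ler_pXn2r ?nnegrE ?enorm_ge0// mulr_ge0//; lra.
have -> : enorm (P - A) ^+ 2 = enorm P ^+ 2 - 2 * edot P A + enorm A ^+ 2.
  by rewrite !sqr_enorm !edotBl !edotBr (edotC A P); ring.
have h := sqr_ge0 (enorm P - T / 2); have hT := sqr_ge0 T.
move: PA sqA h hT; rewrite !expr2; move: (edot P A) (enorm P) (enorm A) => *; lra.
Qed.

Section AlternatingSum.
Context {R : realType}.

(** The last term carries the sign -1, and up to errors [K * C] the terms grow in size towards it,
    so each positive term is outweighed by its successor. *)
Lemma alternating_sum_le (A B : nat -> R) (C K : R) m : 0 <= C ->
  (forall b, (b < m)%N -> 0 <= A b) ->
  (forall b, (b < m)%N -> 0 <= B b <= K) ->
  (forall b, (b.+1 < m)%N -> B b <= B b.+1) ->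
  (forall b, (b.+1 < m)%N -> A b <= A b.+1 + C) ->
  \sum_(b < m) (-1) ^+ (m + b) * (B b * A b) <= m%:R * (K * C).
Proof.
move=> C0 A0 BK Bmono Amono.
pose E n := \sum_(b < n) (-1) ^+ (n + b) * (B b * A b).
have ES n : E n.+1 = - (B n * A n) - E n.
  rewrite /E big_ord_recr /= addSn addnn exprS -[_ ^+ n.*2]signr_odd odd_double expr0 mulr1 mulN1r addrC.
  by congr (_ + _); rewrite -sumrN; apply: eq_bigr => b _; rewrite addSn exprS mulN1r mulNr.
have E0 : E 0%N = 0 by rewrite /E big_ord0.
(* The recursion [E n.+1 = - (B n * A n) - E n] exchanges upper and lower bounds, so both are
   carried along. *)
suff H n : (n <= m)%N -> E n <= n%:R * (K * C) /\
    (forall n', n = n'.+1 -> - (B n' * A n') - n%:R * (K * C) <= E n).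
  by have [] := H m (leqnn m).
elim: n => [|n IH] nm; first by rewrite E0 mul0r; split.
have [U L] := IH (ltnW nm).
have /andP[Bn0 BnK] := BK _ nm; have An0 := A0 _ nm.
have KC : 0 <= K * C by rewrite mulr_ge0// (le_trans Bn0).
split; last first.
  by move=> _ [<-]; rewrite ES -natr1 mulrDl mul1r; move: (_ * _) (n%:R * _) U KC => *; lra.
rewrite ES -natr1 mulrDl mul1r.
case: n IH nm U L Bn0 BnK An0 => [|n] IH nm U L Bn0 BnK An0.
  by rewrite E0 mul0r; have := mulr_ge0 Bn0 An0; move: (B _ * _) => *; lra.
have := L _ erefl.
have /andP[Bn0' BnK'] := BK _ (ltnW nm).
have h1 : B n * A n <= B n * (A n.+1 + C) by rewrite ler_wpM2l ?Amono.
have h2 : B n * A n.+1 <= B n.+1 * A n.+1 by rewrite ler_wpM2r ?Bmono.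
have h3 : B n * C <= K * C by rewrite ler_wpM2r.
rewrite mulrDr in h1.
move: (n.+1%:R * _) (E _) => e1 e2 h4; lra.
Qed.

End AlternatingSum.

(** * Bounds on the gradient of g, on the asymmetry of G and on collinear configurations *)

Section GreenDerivatives.
Context {R : realType}.
Notation plane := 'rV[R]_2.

(** The sign allowed in [L_admissible] cancels, since only products of two strengths are recorded.
    Passing to the closure turns the strict inequalities into weak ones. *)
Lemma L_admissibleP (N : nat) (Gamma : 'rV[R]_N) : L_admissible Gamma ->
  exists (k : 'S_N) (t : 'I_N -> R), [/\ (forall i, 0 < t i),
    (forall i j : 'I_N, j = i.+1 :> nat -> t i <= t j) &
    forall i j : 'I_N, Gamma 0 (k i) * Gamma 0 (k j) = (-1) ^+ (i + j) * (t i * t j)].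
Proof.
move=> [sigma H].
have [s [s2 [cl pos]]] : exists s : R, s * s = 1 /\ Delta_closure (s *: alternate (perm_act sigma Gamma)).
  case: H => H; first by exists 1; rewrite mulr1 scale1r.
  by exists (-1); rewrite mulrNN mulr1 scaleN1r.
set u := s *: _ in cl pos.
exists (sigma^-1)%g, (fun i => u 0 i); split.
- exact: pos.
- move=> i j ij; rewrite leNgt; apply/negP => uji.
  have nb : nbhs u [set v : 'rV[R]_N | v 0 j < v 0 i].
    have cc : {for u, continuous (fun v : 'rV[R]_N => v 0 i - v 0 j)}.
      apply: differentiable_continuous; apply: differentiableB; exact: differentiable_coord.
    have h : nbhs u [set v : 'rV[R]_N | 0 < v 0 i - v 0 j] by apply: (cvgr_gt _ cc); rewrite subr_gt0.
    by apply: (@filterS _ (nbhs u) _ _ _ _ h) => v /=; rewrite subr_gt0.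
  have [v [[_ /(_ i j ij) v1] /= v2]] := cl _ nb.
  by move: v1; rewrite ltNge ltW.
- move=> i j; rewrite /u !mxE.
  rewrite [X in _ = _ * X]mulrACA s2 mul1r [X in _ = _ * X]mulrACA -exprD addSn addnS !exprS !mulN1r opprK.
  by rewrite [RHS]mulrA -expr2 sqrr_sign mul1r.
Qed.

Lemma sum_offdiag_sym (n : nat) (F : 'I_n -> 'I_n -> R) :
  \sum_(i < n) \sum_(j < n | i != j) F i j =
  \sum_(i < n) \sum_(j < n | (j < i)%N) (F i j + F j i).
Proof.
under [RHS]eq_bigr do rewrite big_split /=.
rewrite big_split /= [X in _ + X](exchange_big_dep xpredT)//= -big_split /=.
apply: eq_bigr => i _; rewrite (bigID (fun j : 'I_n => (j < i)%N)) /=; congr (_ + _);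
  by apply: eq_bigl => j; rewrite -(inj_eq val_inj) /= neq_ltn; case: ltngtP.
Qed.

Variables (Omega : set plane) (eps0 : R) (p : plane -> plane).
Hypotheses (Omega_domain : bounded_domain Omega) (eps0_gt0 : 0 < eps0)
  (Omega_C3 : Ck_boundary 3 Omega) (p_proj : boundary_projection Omega eps0 p).
Variables (G : plane -> plane -> R) (g : plane * plane -> R).
Hypothesis HG : hypothesis_G Omega eps0 p G g.
Notation D x := (edist x (~` Omega)).
Implicit Types x y u v : plane.

Let oO : open Omega. Proof. by case: Omega_domain. Qed.

Let near_domain x : Omega x -> \forall z \near x, Omega z.
Proof. by move: oO; rewrite openE => /(_ x); exact. Qed.

Lemma GE x y : Omega x -> Omega y -> x != y ->
  G x y = g (x, y) - (2 * pi)^-1 * ln (enorm (x - y)).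
Proof. by move=> Ox Oy xy; case: HG => _ [gE _ _] _ _ _; rewrite gE// addrK. Qed.

Lemma differentiable_g x y : Omega x -> Omega y -> differentiable g (x, y).
Proof. by move=> Ox Oy; case: HG => _ [_ [dg _] _] _ _ _; exact: dg. Qed.

Lemma is_diff_g_l x y : Omega x -> Omega y ->
  is_diff x (fun z => g (z, y)) (fun v => 'd g (x, y) (v, 0)).
Proof.
move=> Ox Oy; have /differentiableP gd := differentiable_g Ox Oy.
exact: is_diff_comp (is_diff_pair (is_diff_id x) (is_diff_cst y x)) gd.
Qed.

Lemma is_diff_g_r x y : Omega x -> Omega y ->
  is_diff y (fun z => g (x, z)) (fun v => 'd g (x, y) (0, v)).
Proof.
move=> Ox Oy; have /differentiableP gd := differentiable_g Ox Oy.
exact: is_diff_comp (is_diff_pair (is_diff_cst x y) (is_diff_id y)) gd.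
Qed.

Lemma is_diff_ln_dist (V : normedModType R) (f df : V -> plane) (a : V) y :
  is_diff a f df -> f a != y ->
  is_diff a (fun z => (2 * pi)^-1 * ln (enorm (f z - y)))
    (fun w => (2 * pi)^-1 * (edot (f a - y) (df w) / edot (f a - y) (f a - y))).
Proof.
move=> fd fy; have fyd : is_diff a (fun z => f z - y) (df - 0) :=
  is_diffB fd (is_diff_cst y a).
have := is_diff_ln_enorm fyd; rewrite subr_eq0 => /(_ fy) h.
apply: is_diff_eq (is_diffZ (2 * pi)^-1 h) _; apply/funext => v.
by rewrite !fctE subr0.
Qed.

Lemma diff_G_l x y v : Omega x -> Omega y -> x != y ->
  'd (G ^~ y) x v =
  'd g (x, y) (v, 0) - (2 * pi)^-1 * (edot (x - y) v / edot (x - y) (x - y)).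
Proof.
move=> Ox Oy xy.
have h := is_diffB (is_diff_g_l Ox Oy) (is_diff_ln_dist (is_diff_id x) xy).
have e : \forall z \near x, G z y = ((fun z => g (z, y)) - (fun z => (2 * pi)^-1 * ln (enorm (id z - y)))) z.
  have ny : \forall z \near x, z != y.
    apply/nbhs_enormP; exists (enorm (x - y)); first by rewrite enorm_gt0 subr_eq0.
    by move=> z xz; apply/eqP => zy; move: xz; rewrite zy ltxx.
  by apply: (@filterS _ (nbhs x) _ _ _ _ (filterI (near_domain Ox) ny)) => z [Oz zy]; rewrite GE.
by have hh := is_diff_near_eq e h; rewrite (@diff_val _ _ _ _ _ _ _ hh).
Qed.

Lemma diff_G_r x y v : Omega x -> Omega y -> x != y ->
  'd (G x) y v =
  'd g (x, y) (0, v) + (2 * pi)^-1 * (edot (x - y) v / edot (x - y) (x - y)).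
Proof.
move=> Ox Oy; rewrite eq_sym => xy.
have h := is_diffB (is_diff_g_r Ox Oy) (is_diff_ln_dist (is_diff_id y) xy).
have e : \forall z \near y, G x z = ((fun z => g (x, z)) - (fun z => (2 * pi)^-1 * ln (enorm (id z - x)))) z.
  have ny : \forall z \near y, z != x.
    apply/nbhs_enormP; exists (enorm (y - x)); first by rewrite enorm_gt0 subr_eq0.
    by move=> z xz; apply/eqP => zy; move: xz; rewrite zy ltxx.
  apply: (@filterS _ (nbhs y) _ _ _ _ (filterI (near_domain Oy) ny)) => z [Oz zy].
  by rewrite GE 1?eq_sym// [enorm (x - z)]enormB.
have hh := is_diff_near_eq e h; rewrite (@diff_val _ _ _ _ _ _ _ hh) !fctE.
by rewrite (edotBB x y) (edotBN x y v) mulNr mulrN opprK.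
Qed.

(** The function [psi] of condition (iv): what is left of [g] after removing the logarithm of the
    distance to the reflected point. *)
Definition reflected_part x y := g (x, y) - (2 * pi)^-1 * ln (enorm (reflection p x - y)).

Lemma reflection_neq x y : Omega x -> D x < eps0 -> Omega y -> reflection p x != y.
Proof.
move=> Ox Dx Oy; have [_ _ _ nO] := p_proj; apply/eqP => E.
by apply: (nO x); [exact: collarE | rewrite E].
Qed.

Lemma diff_psi_l x y v : Omega x -> D x < eps0 -> Omega y ->
  'd (reflected_part ^~ y) x v = 'd g (x, y) (v, 0) -
   (2 * pi)^-1 * (edot (reflection p x - y) (2 *: 'd p x v - v) /
     edot (reflection p x - y) (reflection p x - y)).
Proof.
move=> Ox Dx Oy; have [_ _ [dp _] _] := p_proj.
have /differentiableP pd := dp x (collarE Omega_domain Ox Dx).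
have rd : is_diff x (reflection p) (2 *: ('d p x : plane -> plane) - id) :=
  is_diffB (is_diffZ 2 pd) (is_diff_id x).
have h := is_diffB (is_diff_g_l Ox Oy) (is_diff_ln_dist rd (reflection_neq Ox Dx Oy)).
by rewrite (@diff_val _ _ _ _ _ _ _ h).
Qed.

Lemma diff_psi_r x y v : Omega x -> D x < eps0 -> Omega y ->
  'd (reflected_part x) y v = 'd g (x, y) (0, v) +
   (2 * pi)^-1 * (edot (reflection p x - y) v /
     edot (reflection p x - y) (reflection p x - y)).
Proof.
move=> Ox Dx Oy; have := reflection_neq Ox Dx Oy; rewrite eq_sym => rn.
have h := is_diffB (is_diff_g_r Ox Oy) (is_diff_ln_dist (is_diff_id y) rn).
have e : reflected_part x = (fun z => g (x, z)) - (fun z => (2 * pi)^-1 * ln (enorm (id z - reflection p x))).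
  by apply/funext => z; rewrite /reflected_part [enorm (_ - z)]enormB.
rewrite e (@diff_val _ _ _ _ _ _ _ h) !fctE.
by rewrite (edotBB (reflection p x) y) (edotBN (reflection p x) y v) mulNr mulrN opprK.
Qed.

Implicit Types a b : plane.

(** Near the boundary this is comparable to the distance between [y] and the reflection of [x], but
    it makes sense for all pairs. *)
Definition separation x y := enorm (x - y) + D x + D y.

Lemma separation_gt0 x y : Omega x -> Omega y -> 0 < separation x y.
Proof.
move=> Ox Oy; have := domain_edist_gt0 Omega_domain Ox.
by have := domain_edist_gt0 Omega_domain Oy; have := enorm_ge0 (x - y); rewrite /separation; elra.
Qed.

Lemma separationC x y : separation x y = separation y x.
Proof. by rewrite /separation enormB addrAC. Qed.

Lemma compact_closure_domain : compact (closure Omega).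
Proof.
apply: bounded_closed_compact; last exact: closed_closure.
case: Omega_domain => _ _ _ [M [Mr MO]].
exists M; split => // M' MM' x cx; apply/ler_addgt0Pl => e e0.
have [y [Oy /=]] := cx _ (nbhsx_ballx x e e0); rewrite -ball_normE /= => xy.
have := MO M' MM' y Oy => /= yM; have := ler_normD (x - y) y; rewrite subrK; elra.
Qed.

(** Bounds over all pairs become local at limit pairs [(a, b)]: condition (iii) will serve for
    [a != b], regularity of [g] for [a = b] inside, and condition (iv) for [a = b] on the
    boundary. *)
Lemma pair_local_bound (P : R -> plane -> plane -> Prop) :
  (forall M M' x y, M <= M' -> P M x y -> P M' x y) ->
  (forall a b, closure Omega a -> closure Omega b ->
     exists M, exists2 e : R, 0 < e & forall x y, Omega x -> Omega y ->
       enorm (x - a) < e -> enorm (y - b) < e -> P M x y) ->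
  exists M, forall x y, Omega x -> Omega y -> P M x y.
Proof.
move=> mono loc.
have cK : compact (closure Omega `*` closure Omega).
  by apply: compact_setX; exact: compact_closure_domain.
have [|a [c1 c2]|M HM] := compact_bound (P := fun M (z : plane * plane) =>
    Omega z.1 -> Omega z.2 -> P M z.1 z.2) cK.
- by move=> M M' z MM' Pz Oz1 Oz2; apply: mono MM' (Pz _ _).
- have [M [e e0 H]] := loc _ _ c1 c2; exists M.
  have b1 : nbhs a.1 [set x | enorm (x - a.1) < e].
    by apply/nbhs_enormP; exists e => // v; rewrite enormB.
  have b2 : nbhs a.2 [set x | enorm (x - a.2) < e].
    by apply/nbhs_enormP; exists e => // v; rewrite enormB.
  exists ([set x | enorm (x - a.1) < e], [set x | enorm (x - a.2) < e]) => //=.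
  by move=> [x y] /= [xa ya] Ox Oy; exact: H.
- by exists M => x y Ox Oy; apply: (HM (x, y)) => //; split; exact: subset_closure.
Qed.

Lemma closure_domain_cases a : closure Omega a -> Omega a \/ boundary Omega a.
Proof.
move=> ca; have [Oa|nOa] := pselect (Omega a); [by left | right; split => //].
by move/interior_subset.
Qed.

(** [reflection p x - y] equals [p x - p y], nearly tangential, minus [(x - p x) + (y - p y)],
    nearly normal of length about [D x + D y]. *)
Lemma reflection_comparison q0 : boundary Omega q0 ->
  exists2 d : R, 0 < d & forall x y, Omega x -> Omega y ->
    enorm (x - q0) < d -> enorm (y - q0) < d ->
    [/\ D x < eps0, separation x y <= 4 * enorm (reflection p x - y),
        enorm (reflection p x - y) <= 2 * separation x y &
        enorm (p x - p y) <= 2 * enorm (x - y)].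
Proof.
move=> Bq0; have [n n1 geo] := boundary_geometry Omega_domain eps0_gt0 Omega_C3 p_proj Bq0.
have [|d d0 {}geo] := geo (1 / 8); first lra.
exists d => // x y Ox Oy xq yq; have [Dx Vx Pn PL] := geo x y Ox Oy xq yq.
have [Dy Vy _ _] := geo y x Oy Ox yq xq.
have Dx0 := domain_edist_gt0 Omega_domain Ox; have Dy0 := domain_edist_gt0 Omega_domain Oy.
have [_ px] := projP Omega_domain p_proj Ox Dx.
have [_ py] := projP Omega_domain p_proj Oy Dy.
have [P PE] : {P | P = p x - p y} by exists (p x - p y).
have [T TE] : {T | T = D x + D y} by exists (D x + D y).
have [A AE] : {A | A = (x - p x) + (y - p y)} by exists ((x - p x) + (y - p y)).
rewrite -PE in Pn PL *.
have rE : reflection p x - y = P - A.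
  by rewrite PE AE /reflection; apply/rowP => j; rewrite !mxE; ring.
have At : enorm (A - T *: n) <= 1 / 8 * T.
  rewrite (_ : A - _ = (x - p x - D x *: n) + (y - p y - D y *: n)); last first.
    by rewrite AE TE; apply/rowP => j; rewrite !mxE; ring.
  by have := ler_enormD (x - p x - D x *: n) (y - p y - D y *: n); rewrite TE; elra.
have T0 : 0 <= T by rewrite TE; elra.
have sq := near_orthogonal_sum T0 n1 Pn At.
have xyb : enorm (x - y) <= enorm P + T.
  rewrite (_ : x - y = P + ((x - p x) - (y - p y))); last first.
    by rewrite PE; apply/rowP => j; rewrite !mxE; ring.
  have := ler_enormD P ((x - p x) - (y - p y)); have := ler_enormB (x - p x) (y - p y).
  by rewrite (enormB x) px (enormB y) py TE; elra.
have sb : separation x y <= enorm P + 2 * T by rewrite /separation; elra.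
split => //.
  rewrite rE -(@ler_pXn2r _ 2)// ?nnegrE ?mulr_ge0 ?enorm_ge0//; last first.
    by rewrite ltW// separation_gt0.
  have b0 := ltW (separation_gt0 Ox Oy).
  apply: (@le_trans _ _ ((enorm P + 2 * T) ^+ 2)).
    by rewrite ler_pXn2r ?nnegrE//; exact: le_trans sb.
  rewrite exprMn; have := sqr_ge0 (enorm P - 2 * T); have := sqr_ge0 (enorm P); have := sqr_ge0 T.
  move: sq; rewrite !expr2; move: (enorm P) (enorm (P - A)) (T) => *; elra.
rewrite /reflection (_ : 2 *: p x - x - y = 2 *: (p x - x) + (x - y)); last first.
  by apply/rowP => j; rewrite !mxE; ring.
apply: le_trans (ler_enormD _ _) _; rewrite enormZ px ger0_norm// /separation.
by have := enorm_ge0 (x - y); elra.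
Qed.

Lemma norm_near_le (c d : R) : `|c - d| < 1 -> `|d| <= `|c| + 1.
Proof. by move=> cd; have := ler_normB c (c - d); rewrite opprB addrC subrK; lra. Qed.

Lemma norm_le_sum4 (c1 c2 c3 c4 : R) : [/\ `|c1| + 1 <= `|c1| + `|c2| + `|c3| + `|c4| + 1,
   `|c2| + 1 <= `|c1| + `|c2| + `|c3| + `|c4| + 1, `|c3| + 1 <= `|c1| + `|c2| + `|c3| + `|c4| + 1 &
   `|c4| + 1 <= `|c1| + `|c2| + `|c3| + `|c4| + 1].
Proof.
have := normr_ge0 c1; have := normr_ge0 c2; have := normr_ge0 c3; have := normr_ge0 c4.
by move=> *; split; lra.
Qed.

Lemma ler_edot_div (w u : plane) : `|edot w u / edot w w| <= enorm u / enorm w.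
Proof.
have [->|w0] := eqVneq w 0; first by rewrite edot0l mul0r normr0 divr_ge0 ?enorm_ge0.
have e0 : 0 < enorm w by rewrite enorm_gt0.
rewrite -sqr_enorm normrM normrV ?unitfE ?expf_neq0 ?gt_eqF// (ger0_norm (sqr_ge0 _)).
rewrite expr2 invfM mulrA ler_pM2r ?invr_gt0// ler_pdivrMr// [leRHS]mulrC.
exact: cauchy_schwarz.
Qed.

Lemma inv2pi : 0 < (2 * pi)^-1 :> R /\ (2 * pi)^-1 <= 1 :> R.
Proof.
have := pi_ge2 R => pi2; have p0 : 0 < 2 * pi :> R by lra.
by rewrite invr_gt0 p0 invf_le1//; split=> //; lra.
Qed.

Lemma ler_2pi_edot_div (w u : plane) :
  `|(2 * pi)^-1 * (edot w u / edot w w)| <= enorm u / enorm w.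
Proof.
have [c0 c1] := inv2pi; rewrite normrM (gtr0_norm c0).
apply: le_trans (ler_edot_div w u); rewrite ler_piMl//.
Qed.

Lemma diff_g_split x y u v :
  Omega x -> Omega y -> 'd g (x, y) (u, v) = 'd g (x, y) (u, 0) + 'd g (x, y) (0, v).
Proof. by move=> Ox Oy; rewrite -linearD; congr ('d g (x, y) _); congr pair; rewrite ?addr0 ?add0r. Qed.

Lemma grad_g_far (eps : R) : 0 < eps -> exists2 M : R, 0 < M &
  forall x y u v, Omega x -> Omega y -> eps <= enorm (x - y) ->
    `|'d g (x, y) (u, v)| <= M * (enorm u + enorm v).
Proof.
move=> eps_gt0; case: HG => _ _ /(_ _ eps_gt0)[C2 C20 HC] _ _.
exists (C2 + eps^-1); first by rewrite addr_gt0// invr_gt0.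
move=> x y u v Ox Oy xy.
have xny : x != y by rewrite -subr_eq0 -enorm_gt0; exact: lt_le_trans xy.
have H := HC x y Ox Oy xy.
have gx := enorm_ge0 (grad (G ^~ y) x); have gy := enorm_ge0 (grad (G x) y).
have h1 := diff_G_l u Ox Oy xny.
have h2 := diff_G_r v Ox Oy xny.
have u0 := enorm_ge0 u; have v0 := enorm_ge0 v; have G0 := normr_ge0 (G x y).
have gx2 : enorm (grad (G ^~ y) x) <= C2 by elra.
have gy2 : enorm (grad (G x) y) <= C2 by elra.
have b1 := le_trans (ler_diff_grad (G ^~ y) x u) (ler_wpM2r u0 gx2).
have b2 := le_trans (ler_diff_grad (G x) y v) (ler_wpM2r v0 gy2).
have bd (w : plane) : enorm w / enorm (x - y) <= eps^-1 * enorm w.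
  by rewrite mulrC ler_wpM2r ?enorm_ge0// lef_pV2// posrE (lt_le_trans eps_gt0).
have c1 := le_trans (ler_2pi_edot_div (x - y) u) (bd u).
have c2 := le_trans (ler_2pi_edot_div (x - y) v) (bd v).
rewrite diff_g_split//.
have -> : 'd g (x, y) (u, 0) = 'd (G ^~ y) x u + (2 * pi)^-1 * (edot (x - y) u / edot (x - y) (x - y)).
  by rewrite h1 subrK.
have -> : 'd g (x, y) (0, v) = 'd (G x) y v - (2 * pi)^-1 * (edot (x - y) v / edot (x - y) (x - y)).
  by rewrite h2 addrK.
apply: le_trans (ler_normD _ _) _.
have := ler_normD ('d (G ^~ y) x u) ((2 * pi)^-1 * (edot (x - y) u / edot (x - y) (x - y))).
have := ler_normB ('d (G x) y v) ((2 * pi)^-1 * (edot (x - y) v / edot (x - y) (x - y))).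
move: b1 b2 c1 c2.
move: (`|'d (G ^~ y) x u|) (`|'d (G x) y v|) (`|(2 * pi)^-1 * (edot (x - y) u / edot (x - y) (x - y))|)
   (`|(2 * pi)^-1 * (edot (x - y) v / edot (x - y) (x - y))|) => a1 a2 a3 a4 b1 b2 c1 c2.
move: (`|_ + _|) (`|_ - _|) => a5 a6 c5 c6.
clear - b1 b2 c1 c2 c5 c6; rewrite mulrDl !mulrDr; elra.
Qed.

(** [Ck_on] yields continuity of the differential one direction at a time; by linearity four basis
    directions suffice. *)
Lemma grad_g_interior a : Omega a -> exists M, exists2 e : R, 0 < e &
  forall x y u v, Omega x -> Omega y -> enorm (x - a) < e -> enorm (y - a) < e ->
    `|'d g (x, y) (u, v)| <= M * (enorm u + enorm v).
Proof.
move=> Oa; case: HG => _ [_ [_ dg] _] _ _ _.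
have loc (w : plane * plane) : exists2 e : R, 0 < e & forall x y, Omega x -> Omega y ->
    enorm (x - a) < e -> enorm (y - a) < e -> `|'d g (x, y) w| <= `|'d g (a, a) w| + 1.
  have /cvgrPdist_lt/(_ 1 ltr01) := dg w (a, a) (conj Oa Oa).
  case=> -[/= A B] [/nbhs_enormP[e1 e10 HA] /nbhs_enormP[e2 e20 HB]] HAB.
  exists (Num.min e1 e2); first by rewrite lt_min e10.
  move=> x y Ox Oy; rewrite !lt_min => /andP[x1 _] /andP[_ y2].
  have := HAB (x, y); rewrite /= => /(_ (conj (HA _ _) (HB _ _))).
  rewrite enormB => /(_ x1); rewrite enormB => /(_ y2) h.
  exact: norm_near_le h.
pose E (j : bool) : plane := delta_mx 0 (if j then 1 else 0).
have [e00 p00 H00] := loc (E false, 0); have [e01 p01 H01] := loc (E true, 0).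
have [e10 p10 H10] := loc (0, E false); have [e11 p11 H11] := loc (0, E true).
pose M := `|'d g (a, a) (E false, 0)| + `|'d g (a, a) (E true, 0)| +
  `|'d g (a, a) (0, E false)| + `|'d g (a, a) (0, E true)| + 1.
exists (2 * M), (Num.min (Num.min e00 e01) (Num.min e10 e11)).
  by rewrite !lt_min p00 p01 p10 p11.
move=> x y u v Ox Oy; rewrite !lt_min => /andP[/andP[x1 x2] /andP[x3 x4]] /andP[/andP[y1 y2] /andP[y3 y4]].
have Mle w : `|'d g (x, y) w| <= `|'d g (a, a) w| + 1 -> `|'d g (a, a) w| + 1 <= M ->
  `|'d g (x, y) w| <= M by exact: le_trans.
have B00 := H00 x y Ox Oy x1 y1; have B01 := H01 x y Ox Oy x2 y2.
have B10 := H10 x y Ox Oy x3 y3; have B11 := H11 x y Ox Oy x4 y4.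
have E1 : (u, v) = u 0 0 *: (E false, 0) + u 0 1 *: (E true, 0) +
   (v 0 0 *: (0, E false) + v 0 1 *: (0, E true)) :> plane * plane.
  rewrite /= {1}(plane_basis u) {1}(plane_basis v); congr pair => /=.
    by rewrite !scaler0 !addr0.
  by rewrite !scaler0 !add0r.
have -> : 'd g (x, y) (u, v) =
    u 0 0 * 'd g (x, y) (E false, 0) + u 0 1 * 'd g (x, y) (E true, 0) +
    (v 0 0 * 'd g (x, y) (0, E false) + v 0 1 * 'd g (x, y) (0, E true)).
  by rewrite E1 !linearD !linearZ.
clear E1.
have entry (w : plane) j : `|w 0 j| <= enorm w.
  by apply: le_trans (norm_le_enorm _); exact: mx_entry_le_norm.
have term (w : plane) j (c : R) : `|c| <= M -> `|w 0 j * c| <= enorm w * M.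
  by move=> cM; rewrite normrM ler_pM.
have [M1 M2 M3 M4] := norm_le_sum4 ('d g (a, a) (E false, 0)) ('d g (a, a) (E true, 0))
  ('d g (a, a) (0, E false)) ('d g (a, a) (0, E true)).
have T1 := term u 0 _ (le_trans B00 M1); have T2 := term u 1 _ (le_trans B01 M2).
have T3 := term v 0 _ (le_trans B10 M3); have T4 := term v 1 _ (le_trans B11 M4).
apply: le_trans (ler_normD _ _) _.
have S1 := ler_normD (u 0 0 * 'd g (x, y) (E false, 0)) (u 0 1 * 'd g (x, y) (E true, 0)).
have S2 := ler_normD (v 0 0 * 'd g (x, y) (0, E false)) (v 0 1 * 'd g (x, y) (0, E true)).
have := lerD (le_trans S1 (lerD T1 T2)) (le_trans S2 (lerD T3 T4)).
by move/le_trans; apply; rewrite le_eqVlt; apply/orP; left; apply/eqP; ring.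
Qed.

Lemma psi_bounds : exists2 C3 : R, 0 < C3 & forall x y, Omega x -> Omega y -> D x < eps0 -> D y < eps0 ->
  [/\ `|reflected_part x y| <= C3, (forall u, `|'d (reflected_part ^~ y) x u| <= C3 * enorm u) &
      (forall v, `|'d (reflected_part x) y v| <= C3 * enorm v)].
Proof.
case: HG => _ _ _ [C3 C30 H] _; exists C3 => // x y Ox Oy Dx Dy.
have := H x y (collarE Omega_domain Ox Dx) (collarE Omega_domain Oy Dy).
rewrite -/(reflected_part x y) -/(reflected_part^~ y) -/(reflected_part x).
have := enorm_ge0 (grad (reflected_part ^~ y) x); have := enorm_ge0 (grad (reflected_part x) y); have := normr_ge0 (reflected_part x y).
move=> h1 h2 h3 h4.
have [l1 [l2 l3]] : `|reflected_part x y| <= C3 /\ enorm (grad (reflected_part ^~ y) x) <= C3 /\ enorm (grad (reflected_part x) y) <= C3.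
  by split; [|split]; elra.
split; [exact: l1 | move=> u | move=> v].
- exact: le_trans (ler_diff_grad (reflected_part ^~ y) x u) (ler_wpM2r (enorm_ge0 u) l2).
- exact: le_trans (ler_diff_grad (reflected_part x) y v) (ler_wpM2r (enorm_ge0 v) l3).
Qed.

Lemma grad_g_boundary a : boundary Omega a -> exists M, exists2 e : R, 0 < e &
  forall x y u v, Omega x -> Omega y -> enorm (x - a) < e -> enorm (y - a) < e ->
    `|'d g (x, y) (u, v)| <= M * (1 + (separation x y)^-1) * (enorm u + enorm v).
Proof.
move=> Ba; have [d d0 cmp] := reflection_comparison Ba.
have [C3 C30 Hpsi] := psi_bounds.
(* 20 = 5 * 4: as [p] is locally 2-Lipschitz, the reflection has derivative at most 2 * 2 + 1, and
   the distance to the reflected point is at least a quarter of [separation]. *)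
exists (C3 + 20), d => // x y u v Ox Oy xa ya.
have [Dx rlow rup _] := cmp x y Ox Oy xa ya; have [Dy _ _ _] := cmp y x Oy Ox ya xa.
have [_ Hu Hv] := Hpsi x y Ox Oy Dx Dy.
have b0 := separation_gt0 Ox Oy.
have dp w : enorm ('d p x w) <= 2 * enorm w.
  apply: (diff_proj_bound Omega_domain p_proj w Ox Dx).
  exists (d - enorm (x - a)); first by rewrite subr_gt0.
  move=> z Oz xz; have za : enorm (z - a) < d.
    by have := ler_enorm_dist z x a; rewrite (enormB z x); elra.
  by have [_ _ _] := cmp z x Oz Ox za xa.
have dR w : enorm (2 *: 'd p x w - w) <= 5 * enorm w.
  apply: le_trans (ler_enormB _ _) _; rewrite enormZ ger0_norm//.
  by have := dp w; elra.
set r := reflection p x - y in rlow rup.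
have r0 : 0 < enorm r by move: b0 rlow; elra.
have rinv w c : 0 <= c -> enorm w <= 5 * c -> enorm w / enorm r <= 20 * (separation x y)^-1 * c.
  move=> c0 wc; rewrite ler_pdivrMr// -mulrA mulrC mulrA.
  have h : 1 <= 4 * (enorm r / separation x y) by rewrite mulrA ler_pdivlMr// mul1r.
  apply: le_trans wc _.
  have := ler_wpM2l c0 h; rewrite mulr1 => h'.
  apply: (@le_trans _ _ (5 * (c * (4 * (enorm r / separation x y))))); first by rewrite ler_wpM2l.
  by rewrite le_eqVlt; apply/orP; left; apply/eqP; ring.
have h1 := diff_psi_l u Ox Dx Oy.
have h2 := diff_psi_r v Ox Dx Oy.
rewrite -/r in h1 h2.
have c1 := le_trans (ler_2pi_edot_div r (2 *: 'd p x u - u)) (rinv _ _ (enorm_ge0 u) (dR u)).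
have v5 : enorm v <= 5 * enorm v by have := enorm_ge0 v; elra.
have c2 := le_trans (ler_2pi_edot_div r v) (rinv _ _ (enorm_ge0 v) v5).
rewrite diff_g_split//.
have -> : 'd g (x, y) (u, 0) = 'd (reflected_part ^~ y) x u + (2 * pi)^-1 * (edot r (2 *: 'd p x u - u) / edot r r).
  by rewrite h1 subrK.
have -> : 'd g (x, y) (0, v) = 'd (reflected_part x) y v - (2 * pi)^-1 * (edot r v / edot r r).
  by rewrite h2 addrK.
have S1 := le_trans (ler_normD _ _) (lerD (Hu u) c1).
have S2 := le_trans (ler_normB _ _) (lerD (Hv v) c2).
apply: le_trans (ler_normD _ _) _; apply: le_trans (lerD S1 S2) _.
have bi : 0 < (separation x y)^-1 by rewrite invr_gt0.
have eu := enorm_ge0 u; have ev := enorm_ge0 v.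
have key w : 0 <= w -> C3 * w + 20 * (separation x y)^-1 * w <= (C3 + 20) * (1 + (separation x y)^-1) * w.
  move=> w0; rewrite -mulrDl ler_wpM2r//.
  have := mulr_ge0 (ltW C30) (ltW bi); rewrite mulrDl !mulrDr !mulr1; move: (_^-1) bi => *; lra.
by apply: le_trans (lerD (key _ eu) (key _ ev)) _; rewrite -mulrDr.
Qed.

(** Only near a common boundary point can the gradient of [g] blow up; there it does so like the
    reciprocal distance to the reflected point, which is comparable to [separation]. *)
Lemma grad_g_bound : exists2 M : R, 0 < M & forall x y u v, Omega x -> Omega y ->
  `|'d g (x, y) (u, v)| <= M * (1 + (separation x y)^-1) * (enorm u + enorm v).
Proof.
have [||M HM] := @pair_local_bound (fun M x y => Omega x -> Omega y ->
   forall u v, `|'d g (x, y) (u, v)| <= M * (1 + (separation x y)^-1) * (enorm u + enorm v)).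
- move=> M M' x y MM' H Ox Oy u v; apply: le_trans (H Ox Oy u v) _.
  have b0 : 0 < (separation x y)^-1 by rewrite invr_gt0 separation_gt0.
  by rewrite ler_wpM2r ?addr_ge0 ?enorm_ge0// ler_wpM2r// addr_ge0// ltW.
- have weak M x y u v : 0 <= M -> Omega x -> Omega y -> `|'d g (x, y) (u, v)| <= M * (enorm u + enorm v) ->
      `|'d g (x, y) (u, v)| <= M * (1 + (separation x y)^-1) * (enorm u + enorm v).
    move=> M0 Ox Oy; move/le_trans; apply.
    have b0 : 0 < (separation x y)^-1 by rewrite invr_gt0 separation_gt0.
    by rewrite ler_wpM2r ?addr_ge0 ?enorm_ge0// ler_peMr// lerDl ltW.
  move=> a b ca cb; have [->|ab] := eqVneq a b.
    have [Ob|Bb] := closure_domain_cases cb.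
      have [M [e e0 H]] := grad_g_interior Ob; exists `|M|, e => // x y Ox Oy xa ya _ _ u v.
      apply: weak => //; apply: le_trans (H x y u v Ox Oy xa ya) _.
      by rewrite ler_wpM2r ?addr_ge0 ?enorm_ge0// ler_norm.
    have [M [e e0 H]] := grad_g_boundary Bb; exists M, e => // x y Ox Oy xa ya _ _ u v.
    exact: H.
  have ab0 : 0 < enorm (a - b) by rewrite enorm_gt0 subr_eq0.
  have ab2 : 0 < enorm (a - b) / 2 by rewrite divr_gt0.
  have [M M0 H] := grad_g_far ab2; exists M, (enorm (a - b) / 4); first by rewrite divr_gt0.
  move=> x y Ox Oy xa yb _ _ u v; apply: weak => //; first exact: ltW.
  apply: H => //; have := ler_enorm_dist a x b; have := ler_enorm_dist x y b.
  by rewrite (enormB a x); elra.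
exists (`|M| + 1); first by rewrite ltr_pwDr.
move=> x y u v Ox Oy; apply: le_trans (HM x y Ox Oy Ox Oy u v) _.
have b0 : 0 < (separation x y)^-1 by rewrite invr_gt0 separation_gt0.
rewrite ler_wpM2r ?addr_ge0 ?enorm_ge0// ler_wpM2r ?addr_ge0 ?(ltW b0)//.
by have := ler_norm M; lra.
Qed.

Lemma ln_ratio_bound (r s : R) : 0 < r -> 0 < s -> r <= 8 * s -> s <= 8 * r ->
  `|ln r - ln s| <= ln 8.
Proof.
move=> r0 s0 rs sr; have h (a b : R) : 0 < a -> 0 < b -> a <= 8 * b -> ln a <= ln 8 + ln b.
  by move=> a0 b0 ab; rewrite -lnM ?posrE// ler_ln ?posrE ?mulr_gt0.
by rewrite ler_norml; have := h _ _ r0 s0 rs; have := h _ _ s0 r0 sr; move=> *; lra.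
Qed.

(** [hypothesis_G] does not state symmetry. In the difference the direct logarithms cancel, and near
    the boundary the reflected ones have arguments that agree up to the factor 8 = 4 * 2 from
    [reflection_comparison]. *)
Lemma G_sym_bound : exists2 M : R, 0 < M & forall x y, Omega x -> Omega y -> x != y ->
  `|G x y - G y x| <= M.
Proof.
have [||M HM] := @pair_local_bound (fun M x y => Omega x -> Omega y ->
   x != y -> `|G x y - G y x| <= M).
- by move=> M M' x y MM' H Ox Oy xy; apply: le_trans (H Ox Oy xy) _.
- move=> a b ca cb; have [->|ab] := eqVneq a b; last first.
    have ab0 : 0 < enorm (a - b) by rewrite enorm_gt0 subr_eq0.
    have ab2 : 0 < enorm (a - b) / 2 by rewrite divr_gt0.
    case: (HG) => _ _ /(_ _ ab2)[C2 C20 HC] _ _.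
    exists (C2 + C2), (enorm (a - b) / 4); first by rewrite divr_gt0.
    move=> x y Ox Oy xa yb _ _ xy.
    have far : enorm (a - b) / 2 <= enorm (x - y).
      have := ler_enorm_dist a x b; have := ler_enorm_dist x y b.
      by rewrite (enormB a x); elra.
    have far' : enorm (a - b) / 2 <= enorm (y - x) by rewrite (enormB y).
    have h1 := HC x y Ox Oy far; have h2 := HC y x Oy Ox far'.
    have k1 : `|G x y| <= C2.
      by have := enorm_ge0 (grad (G ^~ y) x); have := enorm_ge0 (grad (G x) y); elra.
    have k2 : `|G y x| <= C2.
      by have := enorm_ge0 (grad (G ^~ x) y); have := enorm_ge0 (grad (G y) x); elra.
    exact: le_trans (ler_normB _ _) (lerD k1 k2).
  have GB x y : Omega x -> Omega y -> x != y -> G x y - G y x = g (x, y) - g (y, x).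
    move=> Ox Oy xy; rewrite (GE Ox Oy xy) (GE Oy Ox); last by rewrite eq_sym.
    by rewrite (enormB y x); ring.
  have [Ob|Bb] := closure_domain_cases cb.
    have gc := differentiable_continuous (differentiable_g Ob Ob).
    have /cvgrPdist_lt/(_ 1 ltr01) := gc.
    case=> -[/= A B] [/nbhs_enormP[e1 e10 HA] /nbhs_enormP[e2 e20 HB]] HAB.
    exists 2, (Num.min e1 e2); first by rewrite lt_min e10.
    move=> x y Ox Oy; rewrite !lt_min => /andP[x1 x2] /andP[y1 y2] _ _ xy.
    rewrite GB//; rewrite enormB in x1; rewrite enormB in x2.
    rewrite enormB in y1; rewrite enormB in y2.
    have h1 := HAB (x, y) (conj (HA _ x1) (HB _ y2)).
    have h2 := HAB (y, x) (conj (HA _ y1) (HB _ x2)).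
    move: h1 h2 => /=; rewrite !ltr_norml ler_norml => /andP[? ?] /andP[? ?].
    by apply/andP; split; lra.
  have [d d0 cmp] := reflection_comparison Bb.
  have [C3 C30 Hpsi] := psi_bounds.
  exists (C3 + C3 + ln 8), d => // x y Ox Oy xa ya _ _ xy.
  have [Dx rlow rup _] := cmp x y Ox Oy xa ya; have [Dy slow sup _] := cmp y x Oy Ox ya xa.
  have [h1 _ _] := Hpsi x y Ox Oy Dx Dy; have [h2 _ _] := Hpsi y x Oy Ox Dy Dx.
  have b0 := separation_gt0 Ox Oy; rewrite (separationC y x) in slow sup.
  have [c0 c1] := inv2pi.
  have lnb : `|ln (enorm (reflection p x - y)) - ln (enorm (reflection p y - x))| <= ln 8.
    by apply: ln_ratio_bound; elra.
  rewrite GB//.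
  have -> : g (x, y) - g (y, x) = reflected_part x y - reflected_part y x + (2 * pi)^-1 *
     (ln (enorm (reflection p x - y)) - ln (enorm (reflection p y - x))).
    by rewrite /reflected_part; ring.
  apply: le_trans (ler_normD _ _) _; apply: lerD; first exact: le_trans (ler_normB _ _) (lerD h1 h2).
  rewrite normrM (gtr0_norm c0); apply: le_trans lnb.
  by rewrite ler_piMl.
exists (`|M| + 1); first by rewrite ltr_pwDr.
move=> x y Ox Oy xy; apply: le_trans (HM x y Ox Oy Ox Oy xy) _.
by have := ler_norm M; lra.
Qed.

(* For fixed [j] the sum over [i < j] of the mixed terms alternates; condition
   (v) makes its terms essentially increase in size towards [i = j - 1], whose
   sign is negative. *)
Lemma path_upper_bound (N : nat) (Gamma : 'rV[R]_N) (k : 'S_N) (t : 'I_N -> R) :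
  (forall i, 0 < t i) -> (forall i j : 'I_N, j = i.+1 :> nat -> t i <= t j) ->
  (forall i j : 'I_N, Gamma 0 (k i) * Gamma 0 (k j) = (-1) ^+ (i + j) * (t i * t j)) ->
  exists b : R, forall (z : 'M[R]_(N, 2)) (w v : plane) (r : 'I_N -> R),
    config Omega z -> enorm v = 1 -> (forall i j : 'I_N, (i < j)%N -> r i < r j) ->
    (forall i, row (k i) z = w + r i *: v) ->
    path_function Gamma G g z <= b.
Proof.
move=> t0 tmono Gt.
have [M M0 HM] := G_sym_bound.
case: (HG) => -[C0 HC0] [_ _ [C1 C10 HC1]] _ _ [C4 C40 HC4].
pose K := \sum_i t i.
have tK i : t i <= K by rewrite /K (bigD1 i)//= lerDl sumr_ge0// => j _; exact: ltW.
pose c := N%:R * (K * C4) + `|C0| * K.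
exists (\sum_(j < N) Gamma 0 j ^+ 2 * C1 +
  \sum_(a < N) (2 * t a * c + \sum_(b < N | (b < a)%N) t a * t b * M)) => z w v r [zO zN] v1 rmono rowE.
pose x (a : 'I_N) := row (k a) z.
have xO (a : 'I_N) : Omega (x a) by exact: zO.
have xN (a b : 'I_N) : a != b -> x a != x b by move=> ab; apply: zN; rewrite (inj_eq perm_inj).
rewrite /path_function; apply: lerD.
  by apply: ler_sum => j _; rewrite ler_wpM2l ?sqr_ge0// HC1.
rewrite (reindex_inj (@perm_inj _ k)) /=.
under eq_bigr => a _.
  rewrite (reindex_inj (@perm_inj _ k)) /=.
  under eq_bigl do rewrite (inj_eq perm_inj).
  over.
rewrite sum_offdiag_sym; apply: ler_sum => a _.
(* Both orders of a pair are replaced by [G (x a) (x b)], at the cost of the asymmetry bound [M]. *)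
have ineq (b : 'I_N) : (b < a)%N ->
    Gamma 0 (k a) * Gamma 0 (k b) * G (x a) (x b) + Gamma 0 (k b) * Gamma 0 (k a) * G (x b) (x a) <=
    2 * t a * ((-1) ^+ (a + b) * (t b * G (x a) (x b))) + t a * t b * M.
  move=> ba; rewrite Gt (mulrC (Gamma 0 (k b))) Gt.
  have ab : a != b by rewrite -(inj_eq val_inj) /= gtn_eqF.
  have /ler_normlP[h1 h2] := HM _ _ (xO a) (xO b) (xN _ _ ab).
  have tt : 0 < t a * t b by rewrite mulr_gt0.
  have [s s1] : exists2 s : R, (-1) ^+ (a + b) = s & (s = 1) \/ (s = -1).
    by exists ((-1) ^+ (a + b)) => //; rewrite -signr_odd; case: odd; [right; rewrite expr1|left; rewrite expr0].
  move: h1 h2; rewrite s1; move: (G (x a) (x b)) (G (x b) (x a)) => e1 e2 h1 h2.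
  have h3 : t a * t b * - (e1 - e2) <= t a * t b * M by rewrite ler_wpM2l// ltW.
  have h4 : t a * t b * (e1 - e2) <= t a * t b * M by rewrite ler_wpM2l// ltW.
  by case=> ->; lra.
apply: le_trans (ler_sum _ ineq) _; rewrite big_split /= lerD2r -mulr_sumr.
rewrite ler_wpM2l ?mulr_ge0 ?(ltW (t0 _))//.
(* [alternating_sum_le] takes sequences indexed by naturals; the value 0 outside the range never
   enters, as all indices are below [a]. *)
pose ext (f : 'I_N -> R) (n : nat) := oapp f 0 (insub n : option 'I_N).
have extE f (b : 'I_N) : ext f b = f b by rewrite /ext valK.
have extN f n (nN : (n < N)%N) : ext f n = f (Ordinal nN) by rewrite /ext insubT.
have aN := ltn_ord a.
(* Subtracting the lower bound [C0] makes the terms nonnegative; the correction is [C0] times a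
   signed sum of the [t b], of size at most [K]. *)
pose A := ext (fun b : 'I_N => G (x a) (x b) - C0).
have alt := @alternating_sum_le R A (ext t) C4 K a (ltW C40).
have -> : \sum_(b < N | (b < a)%N) (-1) ^+ (a + b) * (t b * G (x a) (x b)) =
    \sum_(b < a) (-1) ^+ (a + b) * (ext t b * A b) +
    C0 * \sum_(b < N | (b < a)%N) (-1) ^+ (a + b) * t b.
  rewrite (big_ord_widen N (fun b : nat => (-1) ^+ (a + b) * (ext t b * A b))) ?(ltnW aN)//.
  rewrite mulr_sumr -big_split /=; apply: eq_bigr => b _.
  by rewrite /A !extE; ring.
apply: lerD.
  apply: le_trans (alt _ _ _ _) _.
  - move=> b ba; rewrite /A (extN _ _ (ltn_trans ba aN)) subr_ge0; apply: HC0 => //.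
    by apply: xN; rewrite -(inj_eq val_inj) /= gtn_eqF.
  - by move=> b ba; rewrite (extN _ _ (ltn_trans ba aN)) tK ltW.
  - move=> b ba; have bN := ltn_trans ba aN; have b'N := ltn_trans (ltnSn b) bN.
    by rewrite (extN _ _ b'N) (extN _ _ bN); exact: tmono.
  - move=> b ba; have bN := ltn_trans ba aN; have b'N := ltn_trans (ltnSn b) bN.
    rewrite /A (extN _ _ b'N) (extN _ _ bN).
    (* Condition (v) keeps fixed the point that comes first on the line. Reversing the direction
       puts [x a] first, then the points with indices [b.+1] and [b]. *)
    have rv i : w + (- r i) *: (- v) = x i by rewrite scalerN scaleNr opprK /x rowE.
    have v1' : enorm (- v) = 1 by rewrite enormN.
    have lm : line w (- v) `&` Omega !=set0.
      by exists (x a); split => //; exists (- r a) => //; rewrite rv.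
    have := HC4 w (- v) v1' lm (- r a) (- r (Ordinal bN)) (- r (Ordinal b'N)).
    rewrite !ltrN2 !rmono//= => /(_ isT isT); rewrite !rv => /(_ (xO _) (xO _) (xO _)).
    by move: (G _ _) (G _ _) => e1 e2 *; lra.
  have K0 : 0 <= K * C4.
    by rewrite mulr_ge0 ?(ltW C40)// /K sumr_ge0// => i _; exact: ltW.
  by rewrite ler_wpM2r// ler_nat ltnW.
apply: le_trans (ler_norm _) _; rewrite normrM ler_wpM2l//.
apply: le_trans (ler_norm_sum _ _ _) _.
rewrite /K [leRHS](bigID (fun b : 'I_N => (b < a)%N)) /= -[leLHS]addr0.
apply: lerD; last by apply: sumr_ge0 => i _; exact: ltW.
by apply: ler_sum => b _; rewrite normrM normr_sign mul1r gtr0_norm.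
Qed.

End GreenDerivatives.

(** * The gradient of the path function *)

Lemma cvg_sum (R : realType) (T : Type) (F : set_system T) {FF : Filter F} (I : finType)
    (P : pred I) (f : I -> T -> R) (l : I -> R) :
  (forall i, P i -> f i @ F --> l i) ->
  (fun t => \sum_(i | P i) f i t) @ F --> \sum_(i | P i) l i.
Proof.
move=> fl; have -> : (fun t => \sum_(i | P i) f i t) = \sum_(i | P i) f i.
  by apply/funext => z'; rewrite fct_sumE.
elim/big_ind2 : _ => // [|f1 d1 f2 d2 h1 h2]; first exact: cvg_cst.
exact: cvgD.
Qed.

Section PathFunction.
Context {R : realType}.
Notation plane := 'rV[R]_2.

Lemma is_diff_sum (V W : normedModType R) (I : finType) (P : pred I) (f df : I -> V -> W) (x : V) :
  (forall i, P i -> is_diff x (f i) (df i)) ->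
  is_diff x (fun z => \sum_(i | P i) f i z) (fun v => \sum_(i | P i) df i v).
Proof.
move=> fd.
have -> : (fun z => \sum_(i | P i) f i z) = \sum_(i | P i) f i.
  by apply/funext => z; rewrite fct_sumE.
have -> : (fun z => \sum_(i | P i) df i z) = \sum_(i | P i) df i.
  by apply/funext => z; rewrite fct_sumE.
elim/big_ind2 : _ => // [|f1 d1 f2 d2 h1 h2]; first exact: is_diff_cst.
exact: is_diffD.
Qed.

Lemma row_norm (m n : nat) (i : 'I_m) (M : 'M[R]_(m, n)) : `|row i M| <= `|M|.
Proof. by apply: mx_norm_le => // a b; rewrite mxE mx_entry_le_norm. Qed.

Lemma row_continuous (m n : nat) (i : 'I_m) : continuous (row i : 'M[R]_(m, n) -> 'rV[R]_n).
Proof.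
move=> M; apply: (iffRL (@cvgrPdist_lt _ _ _ (nbhs M) _ (row i) (row i M))) => e e0.
apply/nbhs_ballP; exists e => //= M'; rewrite -ball_normE /= => MM'.
by apply: le_lt_trans MM'; rewrite -linearB /=; exact: row_norm.
Qed.

Lemma is_diff_row (m n : nat) (i : 'I_m) (z : 'M[R]_(m, n)) :
  is_diff z (row i : 'M[R]_(m, n) -> 'rV[R]_n) (row i).
Proof.
have cr := @row_continuous m n i.
by apply: DiffDef; [exact: linear_differentiable | rewrite diff_lin].
Qed.

Variables (Omega : set plane) (eps0 : R) (p : plane -> plane).
Hypotheses (Omega_domain : bounded_domain Omega).
Variables (G : plane -> plane -> R) (g : plane * plane -> R).
Hypothesis HG : hypothesis_G Omega eps0 p G g.
Variables (N : nat) (Gamma : 'rV[R]_N).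
Implicit Types (z V : 'M[R]_(N, 2)).

Let oO : open Omega. Proof. by case: Omega_domain. Qed.

Lemma near_row z i (A : set plane) : nbhs (row i z) A -> \forall z' \near z, A (row i z').
Proof. by move=> nA; exact: (row_continuous nA). Qed.

Lemma near_domain_row z i : Omega (row i z) -> \forall z' \near z, Omega (row i z').
Proof. by move=> Oz; apply: near_row; move: oO; rewrite openE => /(_ _ Oz). Qed.

Lemma near_row_neq z i j : row i z != row j z -> \forall z' \near z, row i z' != row j z'.
Proof.
rewrite -subr_eq0 -enorm_gt0 => h.
have h2 : 0 < enorm (row i z - row j z) / 2 by rewrite divr_gt0.
have h3 (k : 'I_N) : nbhs (row k z) [set x | enorm (row k z - x) < enorm (row i z - row j z) / 2].
  by apply/nbhs_enormP; exists (enorm (row i z - row j z) / 2).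
have h4 : nbhs z [set z' | enorm (row i z - row i z') < enorm (row i z - row j z) / 2 /\
     enorm (row j z - row j z') < enorm (row i z - row j z) / 2].
  exact: filterI (near_row (h3 i)) (near_row (h3 j)).
apply: (@filterS _ (nbhs z) (nbhs_filter z) _ _ _ h4) => z' /= [zi zj]; apply/eqP => E.
have := ler_enorm_dist (row i z) (row i z') (row j z); rewrite {2}E (enormB (row j z')).
by move: zi zj; clear E; elra.
Qed.

Lemma open_config : open (config Omega : set 'M[R]_(N, 2)).
Proof.
rewrite openE => z [zO zN].
have h1 : \forall z' \near z, forall i, Omega (row i z').
  by apply: (@filter_forall _ _ _ (nbhs z) (nbhs_filter z)) => i; exact: near_domain_row.
have h2 : \forall z' \near z, forall i j : 'I_N, i != j -> row i z' != row j z'.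
  apply: (@filter_forall _ _ _ (nbhs z) (nbhs_filter z)) => i.
  apply: (@filter_forall _ _ _ (nbhs z) (nbhs_filter z)) => j.
  have [->|ij] := eqVneq i j; first by apply: (@filterS _ (nbhs z) (nbhs_filter z) _ _ _ filterT) => z' _; rewrite eqxx.
  by apply: (@filterS _ (nbhs z) (nbhs_filter z) _ _ _ (near_row_neq (zN _ _ ij))).
exact: filterI h1 h2.
Qed.

Definition pair_diff (i j : 'I_N) z V : R :=
  'd g (row i z, row j z) (row i V, row j V) -
  (2 * pi)^-1 * (edot (row i z - row j z) (row i V - row j V) /
                 edot (row i z - row j z) (row i z - row j z)).

Definition path_diff z V : R :=
  \sum_(j < N) Gamma 0 j ^+ 2 * 'd g (row j z, row j z) (row j V, row j V) +
  \sum_(i < N) \sum_(j < N | i != j) Gamma 0 i * Gamma 0 j * pair_diff i j z V.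

Lemma is_diff_rows z i j : is_diff z (fun z' => (row i z', row j z')) (fun V => (row i V, row j V)).
Proof. exact: is_diff_pair (is_diff_row i z) (is_diff_row j z). Qed.

Lemma is_diff_path z : config Omega z -> is_diff z (path_function Gamma G g) (path_diff z).
Proof.
move=> [zO zN].
have hg i j : is_diff z (fun z' => g (row i z', row j z'))
    (fun V => 'd g (row i z, row j z) (row i V, row j V)).
  have /differentiableP gd := differentiable_g HG (zO i) (zO j).
  exact: is_diff_comp (is_diff_rows z i j) gd.
have hG i j : i != j -> is_diff z (fun z' => G (row i z') (row j z')) (pair_diff i j z).
  move=> ij.
  have rd : is_diff z (fun z' => row i z' - row j z') (fun V => row i V - row j V) :=
    is_diffB (is_diff_row i z) (is_diff_row j z).
  have ln_d := is_diff_ln_enorm rd; rewrite subr_eq0 in ln_d.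
  have h := is_diffB (hg i j) (is_diffZ (2 * pi)^-1 (ln_d (zN _ _ ij))).
  apply: is_diff_near_eq h.
  have n1 : nbhs z [set z' | (Omega (row i z') /\ Omega (row j z')) /\ row i z' != row j z'].
    by do 2?apply: filterI; [exact: near_domain_row | exact: near_domain_row | exact: near_row_neq (zN _ _ ij)].
  apply: (@filterS _ (nbhs z) (nbhs_filter z) _ _ _ n1) => z' /= [[Oi Oj] nij].
  by rewrite (GE HG Oi Oj nij).
apply: is_diffD.
  by apply: is_diff_sum => j _; exact: is_diffZ (hg j j).
apply: is_diff_sum => i _; apply: is_diff_sum => j ij; exact: is_diffZ (hG i j ij).
Qed.

Lemma diff_path z : config Omega z -> 'd (path_function Gamma G g) z = path_diff z :> (_ -> _).
Proof. by move=> cz; rewrite (@diff_val _ _ _ _ _ _ _ (is_diff_path cz)). Qed.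

Lemma rows_continuous i j : continuous (fun z => (row i z, row j z)).
Proof. by move=> z; case: (is_diff_rows z i j) => d _; exact: differentiable_continuous d. Qed.

Lemma cvg_edot (T : Type) (F : set_system T) (FF : Filter F) (f1 f2 : T -> plane) a b :
  f1 @ F --> a -> f2 @ F --> b -> (fun t => edot (f1 t) (f2 t)) @ F --> (edot a b : R).
Proof.
move=> fa fb; have co (f : T -> plane) (c : plane) (j : 'I_2) :
    f @ F --> c -> (fun t => f t 0 j) @ F --> (c 0 j : R).
  move=> fc; exact: (cvg_comp _ _ fc (@coord_continuous _ 1 2 0 j c)).
rewrite edotE; under eq_fun do rewrite edotE.
by apply: cvgD; apply: cvgM; exact: co.
Qed.

Lemma diff_g_rows_continuous i j z V : config Omega z ->
  {for z, continuous (fun z' => 'd g (row i z', row j z') (row i V, row j V) : R)}.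
Proof.
move=> [zO zN]; case: (HG) => _ [_ [_ dg] _] _ _ _.
exact: cvg_comp _ _ (@rows_continuous i j z)
  (dg (row i V, row j V) (row i z, row j z) (conj (zO i) (zO j))).
Qed.

Lemma pair_diff_continuous i j z V : config Omega z -> i != j ->
  {for z, continuous (fun z' => pair_diff i j z' V)}.
Proof.
move=> cz ij; have [zO zN] := cz.
have FF : Filter (nbhs z) := nbhs_filter z.
have cB : (fun z' => row i z' - row j z') @ nbhs z --> row i z - row j z.
  by case: (is_diffB (is_diff_row i z) (is_diff_row j z)) => d _; exact: differentiable_continuous d.
have c2 := cvg_edot FF cB cB.
have c3 := cvg_edot FF cB (@cvg_cst _ (row i V - row j V) _ (nbhs z) FF).
have n0 : edot (row i z - row j z) (row i z - row j z) != 0 by rewrite edot_eq0 subr_eq0 zN.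
have c5 := @cvgM _ _ (nbhs z) FF _ _ _ _ (@cvg_cst R (2 * pi)^-1 _ (nbhs z) FF)
  (@cvgM _ _ (nbhs z) FF _ _ _ _ c3 (@cvgV _ _ (nbhs z) FF _ _ n0 c2)).
have c6 := @cvgB _ _ _ (nbhs z) FF _ _ _ _ (@diff_g_rows_continuous i j z V cz) c5.
exact c6.
Qed.

Lemma path_diff_continuous z V : config Omega z ->
  {for z, continuous (fun z' => path_diff z' V)}.
Proof.
move=> cz; have FF : Filter (nbhs z) := nbhs_filter z.
apply: (@cvgD _ _ _ (nbhs z) FF).
  apply: (@cvg_sum R _ (nbhs z) FF _ xpredT (fun j z' => Gamma 0 j ^+ 2 * 'd g (row j z', row j z') (row j V, row j V))).
  by move=> j _; exact: (@cvgM _ _ (nbhs z) FF _ _ _ _ (@cvg_cst R _ _ (nbhs z) FF) (@diff_g_rows_continuous j j z V cz)).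
apply: (@cvg_sum R _ (nbhs z) FF _ xpredT (fun i z' => \sum_(j < N | i != j) Gamma 0 i * Gamma 0 j * pair_diff i j z' V)).
move=> i _; apply: (@cvg_sum R _ (nbhs z) FF _ (fun j => i != j) (fun j z' => Gamma 0 i * Gamma 0 j * pair_diff i j z' V)).
by move=> j ij; exact: (@cvgM _ _ (nbhs z) FF _ _ _ _ (@cvg_cst R _ _ (nbhs z) FF) (@pair_diff_continuous i j z V cz ij)).
Qed.

Definition path_grad z : 'M[R]_(N, 2) := \matrix_(i, j) path_diff z (delta_mx i j).

Lemma path_diff_grad z V : config Omega z -> path_diff z V = \sum_i \sum_j V i j * path_grad z i j.
Proof.
move=> cz; rewrite -diff_path// {1}[V]matrix_sum_delta linear_sum; apply: eq_bigr => i _.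
rewrite linear_sum; apply: eq_bigr => j _.
by rewrite linearZ mxE diff_path.
Qed.

Lemma ler_path_diff z V : config Omega z -> `|path_diff z V| <= (N * 2)%:R * (`|V| * `|path_grad z|).
Proof.
move=> cz; rewrite path_diff_grad//; apply: le_trans (ler_norm_sum _ _ _) _.
have h i j : `|V i j * path_grad z i j| <= `|V| * `|path_grad z|.
  by rewrite normrM ler_pM// mx_entry_le_norm.
apply: (@le_trans _ _ (\sum_(i < N) \sum_(j < 2) `|V| * `|path_grad z|)).
  apply: ler_sum => i _; apply: le_trans (ler_norm_sum _ _ _) _.
  by apply: ler_sum => j _; exact: h.
by rewrite !sumr_const !card_ord -mulrnA mulr_natl mulnC.
Qed.

Lemma path_grad_continuous z : config Omega z -> {for z, continuous path_grad}.
Proof.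
move=> cz; apply: (iffRL (@cvgrPdist_lt _ _ _ (nbhs z) _ path_grad (path_grad z))) => e e0.
have h i j : \forall z' \near z, `|path_diff z (delta_mx i j) - path_diff z' (delta_mx i j)| < e.
  have := @path_diff_continuous z (delta_mx i j) cz.
  by move/(iffLR (@cvgrPdist_lt _ _ _ (nbhs z) _ _ _)); apply.
have h2 : \forall z' \near z, forall i j, `|path_diff z (delta_mx i j) - path_diff z' (delta_mx i j)| < e.
  apply: (@filter_forall _ _ _ (nbhs z) (nbhs_filter z)) => i.
  by apply: (@filter_forall _ _ _ (nbhs z) (nbhs_filter z)) => j; exact: h.
apply: (@filterS _ (nbhs z) (nbhs_filter z) _ _ _ h2) => z' hz'.
by apply: mx_norm_lt => // i j; rewrite !mxE; exact: hz'.
Qed.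

Lemma critical_path z : config Omega z -> path_grad z = 0 ->
  critical_point (path_function Gamma G g) z.
Proof.
move=> cz g0; split; first by case: (is_diff_path cz).
move=> V; rewrite diff_path// path_diff_grad// big1// => i _; rewrite big1// => j _.
by rewrite g0 mxE mulr0.
Qed.

End PathFunction.

(** * The clearance of a configuration *)

Lemma mx_bounded_closed_compact (R : realType) m n (A : set 'M[R]_(m, n)) (M : R) :
  (forall z, A z -> `|z| <= M) -> closed A -> compact A.
Proof.
move=> AM Acl.
have vcont : continuous (vec_mx : 'rV[R]_(m * n) -> 'M[R]_(m, n)).
  move=> v; apply: (iffRL (@cvgrPdist_lt _ _ _ (nbhs v) _ vec_mx (vec_mx v))) => e e0.
  apply/nbhs_ballP; exists e => //= v'; rewrite -ball_normE /= => vv'.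
  rewrite -linearB; apply: le_lt_trans vv'; apply: mx_norm_le => // i j.
  by rewrite mxE mx_entry_le_norm.
have -> : A = vec_mx @` (vec_mx @^-1` A).
  by apply/seteqP; split => [z Az|_ [v Av <-]//]; exists (mxvec z) => /=; rewrite mxvecK.
apply: continuous_compact; first exact: continuous_subspaceT.
apply: bounded_closed_compact.
  exists M; split; first exact: num_real.
  move=> M' MM' v /= Av; apply: le_trans (ltW MM'); apply: le_trans (AM _ Av).
  apply: mx_norm_le => // i j; rewrite (ord1 i) -[v]vec_mxK.
  case/mxvec_indexP: j => a b; rewrite mxvecE vec_mxK; exact: mx_entry_le_norm.
exact: closed_comp Acl.
Qed.

Section Clearance.
Context {R : realType}.
Notation plane := 'rV[R]_2.
Variables (Omega : set plane).
Hypotheses (Omega_domain : bounded_domain Omega).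
Notation D x := (edist x (~` Omega)).
Variable N : nat.
Implicit Types (z V : 'M[R]_(N, 2)).

Let oO : open Omega. Proof. by case: Omega_domain. Qed.

(** The diagonal pairs stand for the distances to the complement, so that one minimum covers both
    kinds of gaps. *)
Definition gap (ij : 'I_N * 'I_N) z : R :=
  if ij.1 == ij.2 then D (row ij.1 z) else enorm (row ij.1 z - row ij.2 z).

(** The cap at 1 bounds the velocity of the Euler steps, and it gives the empty configuration a
    clearance too. *)
Definition clearance z : R := \big[minr/1]_(ij : 'I_N * 'I_N) gap ij z.

Lemma clearance_le1 z : clearance z <= 1.
Proof. exact: bigmin_le_id. Qed.

Lemma clearance_edist z i : clearance z <= D (row i z).
Proof. by apply: (@bigmin_inf _ _ _ _ (i, i)) => //; rewrite /gap eqxx. Qed.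

Lemma clearance_dist z i j : i != j -> clearance z <= enorm (row i z - row j z).
Proof. by move=> ij; apply: (@bigmin_inf _ _ _ _ (i, j)) => //; rewrite /gap (negbTE ij). Qed.

Lemma clearance_attained z : clearance z < 1 -> exists ij, gap ij z = clearance z.
Proof.
rewrite /clearance; set c := bigop _ _ _ => c1.
have : c = 1 \/ exists ij, gap ij z = c.
  rewrite /c; elim/big_ind : _ => [|x y hx hy|ij _]; [by left | | by right; exists ij].
  by rewrite /minr; case: ifP.
by case=> // c1'; move: c1; rewrite c1' ltxx.
Qed.

Lemma clearance_lipschitz z z' : clearance z' <= clearance z + 4 * `|z - z'|.
Proof.
(* A factor 2 for passing from the sup norm to [enorm], and another 2 because both points of a pair
   move: hence the constant 4. *)
have rowle i : enorm (row i z - row i z') <= 2 * `|z - z'|.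
  by rewrite -linearB; apply: le_trans (enorm_le_norm _) _; rewrite ler_pM2l// row_norm.
have d0 : 0 <= `|z - z'| by [].
move: rowle d0; move: (`|z - z'|) => d rowle d0.
rewrite -lerBlDr; apply: le_bigmin => [|ij _].
  by rewrite lerBlDr (le_trans (clearance_le1 _))// lerDl mulr_ge0.
rewrite lerBlDr /gap; case: eqP => [_|/eqP ij12].
  suff h : D (row ij.1 z') <= D (row ij.1 z) + 4 * d by exact: le_trans (clearance_edist z' ij.1) h.
  have := edist_lipschitz (row ij.1 z') (row ij.1 z) (setC_domain_neq0 Omega_domain).
  by have := rowle ij.1; rewrite (enormB (row ij.1 z') (row ij.1 z)); elra.
suff h : enorm (row ij.1 z' - row ij.2 z') <= enorm (row ij.1 z - row ij.2 z) + 4 * d.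
  exact: le_trans (clearance_dist z' ij12) h.
have := ler_enorm_dist (row ij.1 z') (row ij.1 z) (row ij.2 z').
have := ler_enorm_dist (row ij.1 z) (row ij.2 z) (row ij.2 z').
have := rowle ij.1; have := rowle ij.2.
by rewrite (enormB (row ij.1 z') (row ij.1 z)); elra.
Qed.

Lemma clearance_gt0 z : config Omega z -> 0 < clearance z.
Proof.
move=> [zO zN]; rewrite /clearance; elim/big_ind : _ => [|x y hx hy|ij _] //.
  by rewrite lt_min hx.
rewrite /gap; case: eqP => [_|/eqP ij']; first exact: domain_edist_gt0.
by rewrite enorm_gt0 subr_eq0 zN.
Qed.

Lemma clearance_config z : 0 < clearance z -> config Omega z.
Proof.
move=> c0; split => [i|i j ij].
  exact: edist_setC (setC_domain_neq0 Omega_domain) (lt_le_trans c0 (clearance_edist z i)).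
by rewrite -subr_eq0 -enorm_gt0; exact: lt_le_trans c0 (clearance_dist z ij).
Qed.

Lemma clearance_continuous : continuous clearance.
Proof.
move=> z; apply: (iffRL (@cvgrPdist_lt _ _ _ (nbhs z) _ clearance (clearance z))) => e e0.
apply/nbhs_ballP; exists (e / 4) => /=; first by rewrite divr_gt0.
move=> z'; rewrite -ball_normE /= => zz'.
have h1 := clearance_lipschitz z z'; have h2 := clearance_lipschitz z' z.
rewrite (distrC z' z) in h2.
by rewrite ltr_norml; move: (`|z - z'|) zz' h1 h2 => a *; apply/andP; split; lra.
Qed.

Lemma config_bounded : exists M : R, forall z, config Omega z -> `|z| <= M.
Proof.
case: Omega_domain => _ _ _ [M [Mr MO]].
exists (`|M| + 1) => z [zO _]; apply: mx_norm_le => [|i j]; first by rewrite addr_ge0.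
have M1 : M < `|M| + 1 by rewrite ltr_pwDr// ler_norm.
apply: le_trans (MO _ M1 _ (zO i)); have := mx_entry_le_norm (row i z) 0 j.
by rewrite mxE.
Qed.

Lemma compact_clearance (r : R) : 0 < r -> compact [set z | r <= clearance z].
Proof.
move=> r0; have [M HM] := config_bounded; apply: (@mx_bounded_closed_compact _ _ _ _ M).
  by move=> z /= rz; apply: HM; apply: clearance_config; exact: lt_le_trans rz.
have -> : [set z | r <= clearance z] = clearance @^-1` [set x | r <= x] by [].
by apply: closed_comp; [move=> z _; exact: clearance_continuous | exact: closed_ge].
Qed.

End Clearance.

(** * Blow-up along an ultrafilter *)

Section UltraTools.
Context {R : realType} {T : Type} (U : set_system T) {UU : UltraFilter U}.
Notation plane := 'rV[R]_2.

(** A cluster point along an ultrafilter is a limit, since the preimage of each neighbourhood or its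
    complement belongs to [U]. *)
Lemma ultra_cvg (X : topologicalType) (f : T -> X) (K : set X) :
  compact K -> U (f @^-1` K) -> exists2 l, K l & f @ U --> l.
Proof.
move=> cK fK; have PF : ProperFilter (f @ U) by exact: fmap_proper_filter.
have [l [Kl cl]] := cK (f @ U) PF fK; exists l => // B lB.
have [//|nB] := in_ultra_setVsetC (f @^-1` B) UU.
by have [y [nBy By]] := cl (~` B) B nB lB.
Qed.

Lemma ultra_real_cvg (f : T -> R) (K : R) : (\forall t \near U, `|f t| <= K) ->
  exists l : R, f @ U --> l.
Proof.
move=> fK; have cK : compact `[- K, K]%classic by exact: segment_compact.
have [|l _ fl] := ultra_cvg (f := f) cK; last by exists l.
by apply: filterS fK => t; rewrite /= in_itv /= ler_norml.
Qed.

Lemma cvg_plane (f : T -> plane) (a b : R) :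
  (fun t => f t 0 0) @ U --> a -> (fun t => f t 0 1) @ U --> b ->
  f @ U --> (\row_j (if j == 0 then a else b) : plane).
Proof.
move=> /cvgrPdist_lt fa /cvgrPdist_lt fb; apply/cvgrPdist_lt => e e0.
near=> t; apply: mx_norm_lt => // i j; rewrite !mxE (ord1 i).
have [->|j0] := eqVneq j 0; first by near: t; exact: fa.
have -> : j = 1 by case: j j0 => [[|[|]]] //= h h0; apply/val_inj.
by near: t; exact: fb.
Unshelve. all: by end_near. Qed.

Lemma ultra_plane_cvg (f : T -> plane) (K : R) : (\forall t \near U, enorm (f t) <= K) ->
  exists l : plane, f @ U --> l.
Proof.
move=> fK; have ent j : \forall t \near U, `|f t 0 j| <= K.
  apply: filterS fK => t; apply: le_trans; apply: le_trans (norm_le_enorm _).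
  exact: mx_entry_le_norm.
have [a fa] := ultra_real_cvg (ent 0); have [b fb] := ultra_real_cvg (ent 1).
by eexists; exact: cvg_plane fa fb.
Qed.

Lemma ultra_exists (I : finType) (P : I -> set T) :
  (\forall t \near U, exists i, P i t) -> exists i, U (P i).
Proof.
move=> UP; apply: contrapT => nP.
have : \forall t \near U, forall i, ~ P i t.
  apply: filter_forall => i; have [Pi|//] := in_ultra_setVsetC (P i) UU.
  by case: nP; exists i.
move=> h; have [t [[i Pit] nPt]] := filter_ex (filterI UP h).
exact: nPt i Pit.
Qed.

Lemma cvg0_le (f h : T -> R) : (\forall t \near U, `|f t| <= h t) ->
  h @ U --> (0 : R) -> f @ U --> (0 : R).
Proof.
move=> fh /cvgrPdist_lt h0; apply/cvgrPdist_lt => e /h0 he.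
apply: filterS2 fh he => t fh; rewrite !sub0r !normrN => he.
by apply: le_lt_trans fh _; apply: le_lt_trans he; exact: ler_norm.
Qed.

Lemma cvg_ge_lim (f : T -> R) (a l : R) : (\forall t \near U, a <= f t) -> f @ U --> l -> a <= l.
Proof. by move=> fa fl; apply: (@closed_cvg _ _ U _ f [set x | a <= x]) fl => //; exact: closed_ge. Qed.

Lemma cvg_near_eq (X : topologicalType) (f h : T -> X) (l : X) :
  (\forall t \near U, f t = h t) -> h @ U --> l -> f @ U --> l.
Proof. by move=> fh hl; apply: cvg_trans hl; apply: near_eq_cvg; apply: filterS fh => t ->. Qed.

Lemma cvg_uniq (f : T -> R) (a b : R) : f @ U --> a -> f @ U --> b -> a = b.
Proof. by move=> fa fb; apply: (@cvg_unique _ (@Rhausdorff R) (f @ U)). Qed.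

End UltraTools.

Section BlowUp.
Context {R : realType}.
Notation plane := 'rV[R]_2.
Variables (Omega : set plane) (eps0 : R) (p : plane -> plane).
Hypotheses (Omega_domain : bounded_domain Omega) (eps0_gt0 : 0 < eps0)
  (Omega_C3 : Ck_boundary 3 Omega) (p_proj : boundary_projection Omega eps0 p).
Variables (G : plane -> plane -> R) (g : plane * plane -> R).
Hypothesis HG : hypothesis_G Omega eps0 p G g.
Notation D x := (edist x (~` Omega)).
Variables (N : nat) (Gamma : 'rV[R]_N).
Notation config := (config Omega : set 'M[R]_(N, 2)).
Notation rho := (@clearance R Omega N).
Variable (U : set_system 'M[R]_(N, 2)).
Context {UU : UltraFilter U}.
(** The situation to be excluded: [U] replaces a sequence of configurations that violates the
    gradient bound while the clearance tends to 0. *)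
Hypotheses (U_config : U config) (rho0 : rho @ U --> (0 : R))
  (grad0 : (fun z => rho z * `|path_grad g Gamma z|) @ U --> (0 : R)).

(** The ratio of [f] to [rho] tends to infinity; along an ultrafilter the only alternative is
    [close], a bound O(rho). *)
Definition far (f : 'M[R]_(N, 2) -> R) := forall K, \forall z \near U, K * rho z < f z.

Definition close (f : 'M[R]_(N, 2) -> R) := exists K, \forall z \near U, f z <= K * rho z.

Lemma close_or_far f : close f \/ far f.
Proof.
have [fc|nc] := pselect (close f); [by left | right => K].
have [h|h] := in_ultra_setVsetC [set z | f z <= K * rho z] UU; first by case: nc; exists K.
by apply: filterS h => z /negP; rewrite /= -ltNge.
Qed.

Lemma near_rho_gt0 : \forall z \near U, 0 < rho z.
Proof. by apply: filterS U_config => z; exact: clearance_gt0. Qed.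

Lemma far_cvg f : far f -> (fun z => rho z / f z) @ U --> (0 : R).
Proof.
move=> ff; apply/cvgrPdist_lt => e e0; have := ff e^-1.
apply: filterS2 near_rho_gt0 => z r0 h; rewrite sub0r normrN.
have f0 : 0 < f z by apply: lt_trans h; rewrite mulr_gt0 ?invr_gt0.
by rewrite ger0_norm ?divr_ge0 ?ltW// ltr_pdivrMr// -ltr_pdivrMl.
Qed.

(** Displacements of size O(rho) change [g] by O(rho + rho / f), because its gradient is O(1 + 1 /
    [separation]). *)
Lemma small_diff_g (i j : 'I_N) (u v : 'M[R]_(N, 2) -> plane) (f : 'M[R]_(N, 2) -> R) (K : R) :
  far f -> (\forall z \near U, f z <= separation Omega (row i z) (row j z)) ->
  (\forall z \near U, enorm (u z) <= K * rho z) ->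
  (\forall z \near U, enorm (v z) <= K * rho z) ->
  (fun z => 'd g (row i z, row j z) (u z, v z) : R) @ U --> (0 : R).
Proof.
move=> ff fs uK vK.
have [M M0 HM] := grad_g_bound Omega_domain eps0_gt0 Omega_C3 p_proj HG.
pose h z := 2 * K * M * (rho z + rho z / f z).
apply: (@cvg0_le _ _ _ _ _ h); last first.
  rewrite -(mulr0 (2 * K * M)) -[X in _ * X](addr0 0); apply: cvgM; first exact: cvg_cst.
  by apply: cvgD => //; exact: far_cvg.
have f1 := ff 0.
near=> z; have [zO _] : config z by near: z.
have f0 : 0 < f z by rewrite -(mul0r (rho z)); near: z.
have r0 : 0 < rho z by near: z; exact: near_rho_gt0.
have uz : enorm (u z) <= K * rho z by near: z.
have vz : enorm (v z) <= K * rho z by near: z.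
have fz : f z <= separation Omega (row i z) (row j z) by near: z.
apply: le_trans (HM _ _ _ _ (zO i) (zO j)) _.
have inv : (separation Omega (row i z) (row j z))^-1 <= (f z)^-1.
  by rewrite lef_pV2// posrE (lt_le_trans f0).
have uv0 : 0 <= enorm (u z) + enorm (v z) by rewrite addr_ge0 ?enorm_ge0.
have b0 : 0 < separation Omega (row i z) (row j z) by exact: lt_le_trans fz.
apply: (@le_trans _ _ (M * (1 + (f z)^-1) * (2 * (K * rho z)))).
  apply: ler_pM => //.
  - by rewrite mulr_ge0 ?(ltW M0)// addr_ge0// invr_ge0 ltW.
  - by rewrite ler_pM2l// lerD2l.
  - by elra.
by rewrite /h le_eqVlt; apply/orP; left; apply/eqP; ring.
Unshelve. all: by end_near. Qed.

(** [V] is O(rho) and [rho] times the gradient tends to 0, so the derivative along [V] tends to 0.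
    Pairs with a point outside the cluster contribute nothing in the limit, hence the limits inside
    it add up to 0. *)
Lemma test_field (C : {set 'I_N}) (V : 'M[R]_(N, 2) -> 'M[R]_(N, 2)) (K : R)
    (l : 'I_N -> R) (ll : 'I_N -> 'I_N -> R) :
  (forall k, k \in C -> \forall z \near U, enorm (row k (V z)) <= K * rho z) ->
  (forall k z, k \notin C -> row k (V z) = 0) ->
  (forall i j, i \in C -> j \notin C -> far (fun z => enorm (row i z - row j z))) ->
  (forall i, i \in C ->
    (fun z => 'd g (row i z, row i z) (row i (V z), row i (V z)) : R) @ U --> l i) ->
  (forall i j, i \in C -> j \in C -> i != j ->
    (fun z => pair_diff g i j z (V z)) @ U --> ll i j) ->
  \sum_(i in C) Gamma 0 i ^+ 2 * l i +
  \sum_(i in C) \sum_(j in C | i != j) Gamma 0 i * Gamma 0 j * ll i j = 0.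
Proof.
move=> VK V0 Vfar Hl Hll.
have diff0 x y : 'd g (x, y) (0, 0) = 0 :> R by rewrite -[(0, 0)]/(0 : plane * plane) linear0.
have VKall k : \forall z \near U, enorm (row k (V z)) <= `|K| * rho z.
  have [/VK h|h] := boolP (k \in C).
    by apply: filterS2 near_rho_gt0 h => z r0 /le_trans; apply; rewrite ler_pM2r// ler_norm.
  by apply: filterS near_rho_gt0 => z r0; rewrite V0// enorm0 mulr_ge0// ltW.
have cself i : (fun z => 'd g (row i z, row i z) (row i (V z), row i (V z)) : R) @ U -->
     (if i \in C then l i else 0).
  case: ifPn => [/Hl//|iC]; apply: (@cvg_near_eq _ _ _ _ _ (fun=> 0)); last exact: cvg_cst.
  by apply: nearW => z; rewrite V0// diff0.
have mixed i j : i != j -> far (fun z => enorm (row i z - row j z)) ->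
    (fun z => pair_diff g i j z (V z)) @ U --> (0 : R).
  move=> ij fij; rewrite -[X in _ --> X](subr0 0); apply: cvgB.
    apply: (small_diff_g fij _ (VKall i) (VKall j)).
    apply: filterS U_config => z [zO _].
    have := domain_edist_gt0 Omega_domain (zO i); have := domain_edist_gt0 Omega_domain (zO j).
    by rewrite /separation; elra.
  pose h z := 2 * `|K| * (rho z / enorm (row i z - row j z)).
  apply: (@cvg0_le _ _ _ _ _ h); last first.
    rewrite -(mulr0 (2 * `|K|)); apply: cvgM; first exact: cvg_cst.
    exact: far_cvg.
  apply: filterS2 (VKall i) (VKall j) => z h1 h2.
  apply: le_trans (ler_2pi_edot_div _ _) _; rewrite /h mulrA ler_wpM2r ?invr_ge0 ?enorm_ge0//.
  by apply: le_trans (ler_enormB _ _) _; elra.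
have cpair i j : i != j -> (fun z => pair_diff g i j z (V z)) @ U -->
     (if (i \in C) && (j \in C) then ll i j else 0).
  move=> ij; have [iC|iC] := boolP (i \in C); have [jC|jC] := boolP (j \in C) => /=.
  - exact: Hll.
  - by apply: mixed => //; exact: Vfar.
  - apply: mixed => // K'; apply: filterS (Vfar _ _ jC iC K') => z; by rewrite enormB.
  - apply: (@cvg_near_eq _ _ _ _ _ (fun=> 0)); last exact: cvg_cst.
    by apply: nearW => z; rewrite /pair_diff !V0// diff0 subrr edot0r mul0r mulr0 subrr.
have lim1 : (fun z => path_diff g Gamma z (V z)) @ U -->
    \sum_(i < N) Gamma 0 i ^+ 2 * (if i \in C then l i else 0) +
    \sum_(i < N) \sum_(j < N | i != j) Gamma 0 i * Gamma 0 j *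
       (if (i \in C) && (j \in C) then ll i j else 0).
  apply: cvgD.
    by apply: cvg_sum => i _; apply: cvgM; [exact: cvg_cst | exact: cself].
  apply: cvg_sum => i _; apply: cvg_sum => j ij.
  by apply: cvgM; [exact: cvg_cst | exact: cpair].
have lim2 : (fun z => path_diff g Gamma z (V z)) @ U --> (0 : R).
  pose h z := (N * 2)%:R * (`|K| * (rho z * `|path_grad g Gamma z|)).
  apply: (@cvg0_le _ _ _ _ _ h); last first.
    rewrite -(mulr0 (N * 2)%:R) -[X in _ * X](mulr0 `|K|).
    by do 2?[apply: cvgM; first exact: cvg_cst].
  have VKA : \forall z \near U, forall k, enorm (row k (V z)) <= `|K| * rho z.
    by apply: filter_forall => k; exact: VKall.
  near=> z; have cz : config z by near: z.
  apply: le_trans (ler_path_diff Omega_domain HG Gamma (V z) cz) _.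
  rewrite /h ler_wpM2l// mulrA ler_wpM2r//.
  have r0 : 0 < rho z by near: z; exact: near_rho_gt0.
  apply: mx_norm_le => [|i j]; first by rewrite mulr_ge0// ltW.
  have -> : V z i j = row i (V z) 0 j by rewrite mxE.
  apply: le_trans (mx_entry_le_norm _ _ _) _; apply: le_trans (norm_le_enorm _) _.
  by move: i; near: z.
rewrite -[RHS](cvg_uniq lim1 lim2); congr (_ + _).
  by rewrite big_mkcond; apply: eq_bigr => i _; case: ifP => // _; rewrite mulr0.
rewrite big_mkcond; apply: eq_bigr => i _; case: ifP => iC /=; last first.
  by rewrite big1// => j _; rewrite mulr0.
rewrite [LHS]big_mkcondl; apply: eq_bigr => j _; case: ifP => // _; by rewrite mulr0.
Unshelve. all: by end_near. Qed.

Definition cluster (i : 'I_N) : {set 'I_N} :=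
  [set k | `[< close (fun z => enorm (row i z - row k z)) >]].

Lemma closeD f h : close f -> close h -> close (fun z => f z + h z).
Proof.
move=> [K1 H1] [K2 H2]; exists (K1 + K2).
by apply: filterS2 H1 H2 => z h1 h2; rewrite mulrDl lerD.
Qed.

Lemma close_le f h : close h -> (\forall z \near U, f z <= h z) -> close f.
Proof. by move=> [K H] fh; exists K; apply: filterS2 H fh => z h1 h2; exact: le_trans h1. Qed.

Lemma clusterP i k : reflect (close (fun z => enorm (row i z - row k z))) (k \in cluster i).
Proof. by rewrite inE; exact: asboolP. Qed.

Lemma cluster_far i a b : a \in cluster i -> b \notin cluster i ->
  far (fun z => enorm (row a z - row b z)).
Proof.
move=> /clusterP ia ib; have [h|//] := close_or_far (fun z => enorm (row a z - row b z)).
case/clusterP: ib; apply: close_le (closeD ia h) _.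
by apply: nearW => z; exact: ler_enorm_dist.
Qed.

Lemma close_uniform (C : {set 'I_N}) (f : 'I_N -> 'M[R]_(N, 2) -> R) :
  (forall k, k \in C -> close (f k)) ->
  exists K, forall k, k \in C -> \forall z \near U, f k z <= K * rho z.
Proof.
move=> fc; have H k : exists K, k \in C -> \forall z \near U, f k z <= K * rho z.
  by have [/fc[K h]|h] := boolP (k \in C); [exists K | exists 0].
have [Kf HK] := choice H; exists (\sum_k `|Kf k|) => k kC.
apply: filterS2 near_rho_gt0 (HK k kC) => z r0 /le_trans; apply.
rewrite ler_pM2r//; apply: le_trans (ler_norm _) _.
by rewrite (bigD1 k)//= lerDl sumr_ge0.
Qed.

(** [V] is the dilation about point [i]: the logarithm of every distance inside the cluster grows at
    rate exactly 1, while the contribution of [g] vanishes in the limit because the boundary is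
    far. *)
Lemma no_interior_cluster (i j : 'I_N) : Delta_admissible Gamma ->
  (forall k, far (fun z => D (row k z))) -> i != j ->
  ~ close (fun z => enorm (row i z - row j z)).
Proof.
move=> adm Dfar ij cij; set C := cluster i.
have iC : i \in C.
  apply/clusterP; exists 1; apply: filterS near_rho_gt0 => z r0.
  by rewrite subrr enorm0 mul1r ltW.
have jC : j \in C by apply/clusterP.
have C2 : (2 <= #|C|)%N.
  have sub : [set i; j]%SET \subset C by apply/fintype.subsetP => k /finset.set2P[] ->.
  by rewrite (leq_trans _ (subset_leq_card sub))// cards2 ij.
have [K HK] := close_uniform (f := fun k z => enorm (row i z - row k z)) (fun k kC => elimT (clusterP i k) kC).
pose V (z : 'M[R]_(N, 2)) : 'M[R]_(N, 2) := \matrix_(k < N) (if k \in C then row k z - row i z else 0).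
have VE k z : row k (V z) = if k \in C then row k z - row i z else 0 by rewrite rowK.
have VK k : k \in C -> \forall z \near U, enorm (row k (V z)) <= K * rho z.
  by move=> kC; apply: filterS (HK k kC) => z; rewrite VE kC enormB.
have small a b : a \in C -> b \in C ->
    (fun z => 'd g (row a z, row b z) (row a (V z), row b (V z)) : R) @ U --> (0 : R).
  move=> aC bC; apply: (small_diff_g (Dfar a) _ (VK a aC) (VK b bC)).
  apply: filterS U_config => z [zO _]; rewrite /separation.
  by have := domain_edist_gt0 Omega_domain (zO b); have := enorm_ge0 (row a z - row b z); elra.
have pairs a b : a \in C -> b \in C -> a != b ->
    (fun z => pair_diff g a b z (V z)) @ U --> (- (2 * pi)^-1 : R).
  move=> aC bC ab; rewrite -[X in _ --> X]add0r; apply: cvgB; first exact: small.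
  apply: (cvg_near_eq (h := fun=> (2 * pi)^-1)); last exact: cvg_cst.
  apply: filterS U_config => z [_ zN]; rewrite !VE aC bC.
  have -> : row a z - row i z - (row b z - row i z) = row a z - row b z by rewrite opprB addrA subrK.
  by rewrite divff ?mulr1// edot_eq0 subr_eq0 zN.
have := test_field (K := K) (V := V)
  (l := fun=> 0) (ll := fun _ _ => - (2 * pi)^-1) VK _ (@cluster_far i) _ pairs.
rewrite big1 ?add0r => [H|k _]; last by rewrite mulr0.
have : \sum_(a in C) \sum_(b in C | a != b) Gamma 0 a * Gamma 0 b * (- (2 * pi)^-1) = 0.
  by apply: H => [k z kC|a aC]; [rewrite VE (negbTE kC) | exact: small].
under eq_bigr do rewrite -mulr_suml; rewrite -mulr_suml => /eqP.
by rewrite mulf_eq0 (negbTE (adm C C2)) oppr_eq0 /= gt_eqF//; have [] := @inv2pi R.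
Qed.

Lemma cvg_edot_quotient (r w : 'M[R]_(N, 2) -> plane) (r1 w1 : plane) :
  r @ U --> r1 -> w @ U --> w1 -> r1 != 0 ->
  (fun z => edot (r z) (w z) / edot (r z) (r z)) @ U --> edot r1 w1 / edot r1 r1.
Proof.
move=> rr ww r10; have FF : Filter U by exact: filter_filter.
have n0 : edot r1 r1 != 0 by rewrite edot_eq0.
exact: (@cvgM _ _ U FF _ _ _ _ (cvg_edot FF rr ww) (@cvgV _ _ U FF _ _ n0 (cvg_edot FF rr rr))).
Qed.

(** By this homogeneity of degree 0, rates can be computed after dividing by [rho]. *)
Lemma edot_quotient_scale (c : R) (r w : plane) : c != 0 ->
  edot (c *: r) (c *: w) / edot (c *: r) (c *: r) = edot r w / edot r r.
Proof.
move=> c0; rewrite !edotZl !edotZr.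
have [->|r0] := eqVneq r 0; first by rewrite !edot0l !mulr0 !mul0r.
by field; rewrite c0 edot_eq0 r0.
Qed.

Implicit Types (z : 'M[R]_(N, 2)) (i j k : 'I_N).

Lemma close_cvg0 f : (forall z, 0 <= f z) -> close f -> f @ U --> (0 : R).
Proof.
move=> f0 [K fK]; apply: (cvg0_le (h := fun z => K * rho z)).
  by apply: filterS fK => z; rewrite ger0_norm.
by rewrite -(mulr0 K); apply: cvgM => //; exact: cvg_cst.
Qed.

Lemma boundary_cluster_limit i : close (fun z => D (row i z)) ->
  exists2 a, boundary Omega a & forall k, k \in cluster i -> forall d : R, 0 < d ->
    \forall z \near U, enorm (row k z - a) < d.
Proof.
move=> Di; have [|a ca ra] := ultra_cvg (f := row i) (compact_closure_domain Omega_domain).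
  by apply: filterS U_config => z [zO _]; exact: subset_closure.
have nO := setC_domain_neq0 Omega_domain.
have D0 : (fun z => D (row i z)) @ U --> (0 : R).
  by apply: close_cvg0 => // z; exact: edist_ge0.
have D1 : (fun z => D (row i z)) @ U --> D a.
  exact: cvg_comp _ _ ra (@edist_setC_continuous _ Omega nO a).
have Da := cvg_uniq D1 D0.
exists a.
  by case: (closure_domain_cases ca) => // /(domain_edist_gt0 Omega_domain); rewrite Da ltxx.
have ea : (fun z => enorm (row i z - a)) @ U --> (0 : R).
  have FF : Filter U by exact: filter_filter.
  have := @cvgB _ _ _ U FF _ _ _ _ ra (@cvg_cst _ a _ U FF); rewrite subrr => h.
  by rewrite -(@enorm0 R); exact: cvg_comp _ _ h (@enorm_continuous R 0).
move=> k /clusterP /close_cvg0 h d d0.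
have {}h := h (fun z => enorm_ge0 _).
have hs : (fun z => enorm (row i z - row k z) + enorm (row i z - a)) @ U --> (0 : R).
  by rewrite -[X in _ --> X](addr0 0); exact: cvgD.
move/cvgrPdist_lt : hs => /(_ d d0); apply: filterS => z; rewrite sub0r normrN => hz.
apply: le_lt_trans (le_lt_trans (ler_norm _) hz).
by rewrite (enormB (row i z)); exact: ler_enorm_dist.
Qed.

Lemma cvg_enorm0 (f : 'M[R]_(N, 2) -> plane) :
  (fun z => enorm (f z)) @ U --> (0 : R) -> f @ U --> (0 : plane).
Proof.
move=> /cvgrPdist_lt f0; apply/cvgrPdist_lt => e /f0; apply: filterS => z.
rewrite !sub0r !normrN ger0_norm ?enorm_ge0//; apply: le_lt_trans; exact: norm_le_enorm.
Qed.

(* The limit rate of [2 pi g] caused by the reflected point: [A] is the sum of the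
   scaled distances of the two points to the boundary and [P] the scaled
   difference of their projections. *)
Definition image_quotient (A : R) (P : plane) := A ^+ 2 / (edot P P + A ^+ 2).

(** * The rescaled limit of a cluster at a boundary point *)

Section AtPoint.
Variables (C : {set 'I_N}) (K : R) (a n : plane).

Let adapted (eta : R) (x y : plane) :=
  [/\ D x < eps0, enorm ((x - p x) - D x *: n) <= eta * D x,
      `|edot (p x - p y) n| <= eta * enorm (p x - p y) &
      enorm (p x - p y) <= 2 * enorm (x - y)].

Hypotheses (Ba : boundary Omega a) (n1 : edot n n = 1)
  (geo : forall eta : R, 0 < eta -> exists2 d : R, 0 < d & forall x y, Omega x -> Omega y ->
    enorm (x - a) < d -> enorm (y - a) < d -> adapted eta x y)
  (Ca : forall k, k \in C -> forall d : R, 0 < d -> \forall z \near U, enorm (row k z - a) < d)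
  (CD : forall k, k \in C -> \forall z \near U, D (row k z) <= K * rho z)
  (CC : forall i j, i \in C -> j \in C -> \forall z \near U, enorm (row i z - row j z) <= K * rho z).

(** The test field: each point of the cluster moves along its normal, at a speed equal to its
    distance from the boundary. *)
Let V k z := row k z - p (row k z).

Lemma near_geo eta i j : 0 < eta -> i \in C -> j \in C ->
  \forall z \near U, adapted eta (row i z) (row j z).
Proof.
move=> eta0 iC jC; have [d d0 H] := geo eta0.
near=> z; have [zO _] : config z by near: z.
apply: H => //; near: z; exact: Ca.
Unshelve. all: by end_near. Qed.

Lemma near_collar i : i \in C -> \forall z \near U, D (row i z) < eps0.
Proof. by move=> iC; apply: filterS (near_geo ltr01 iC iC) => z []. Qed.

Lemma enorm_V i : i \in C -> \forall z \near U, enorm (V i z) = D (row i z).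
Proof.
move=> iC; apply: filterS2 U_config (near_collar iC) => z [zO _] Dz.
by have [_ <-] := projP Omega_domain p_proj (zO i) Dz; rewrite enormB.
Qed.

Lemma dist_ratio_cvg i : i \in C ->
  exists2 b : R, 1 <= b & (fun z => D (row i z) / rho z) @ U --> b.
Proof.
move=> iC; have r0 := near_rho_gt0.
have [b bl] : exists b : R, (fun z => D (row i z) / rho z) @ U --> b.
  have h : \forall z \near U, `|D (row i z) / rho z| <= K.
    near=> z; have rz : 0 < rho z by near: z.
    have Dz : D (row i z) <= K * rho z by near: z; exact: CD.
    rewrite ger0_norm ?ler_pdivrMr//.
    by rewrite divr_ge0 ?(ltW rz)// edist_ge0//; exact: setC_domain_neq0 Omega_domain.
  exact: ultra_real_cvg h.
exists b => //; apply: cvg_ge_lim bl; near=> z; have rz : 0 < rho z by near: z.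
by rewrite ler_pdivlMr// mul1r; exact: clearance_edist.
Unshelve. all: by end_near. Qed.

Lemma scaled_V_cvg i (b : R) : i \in C -> (fun z => D (row i z) / rho z) @ U --> b ->
  (fun z => (rho z)^-1 *: V i z) @ U --> b *: n.
Proof.
move=> iC bl; have FF : Filter U by exact: filter_filter.
have r0 := near_rho_gt0.
have h1 : (fun z => (D (row i z) / rho z) *: n) @ U --> b *: n.
  exact: (@cvgZ _ _ _ U FF _ _ _ _ bl (@cvg_cst _ n _ U FF)).
have h2 : (fun z => (rho z)^-1 *: V i z - (D (row i z) / rho z) *: n) @ U --> (0 : plane).
  apply: cvg_enorm0; apply/cvgrPdist_lt => e e0.
  have K1 : 0 < `|K| + 1 by rewrite ltr_pwDr.
  have eta0 : 0 < e / (`|K| + 1) / 2 by rewrite !divr_gt0.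
  near=> z; have rz : 0 < rho z by near: z.
  have [_ hV _ _] : adapted (e / (`|K| + 1) / 2) (row i z) (row i z).
    by near: z; exact: near_geo.
  have hD : D (row i z) <= K * rho z by near: z; exact: CD.
  rewrite sub0r normrN ger0_norm ?enorm_ge0// mulrC -scalerA -scalerBr enormZ gtr0_norm ?invr_gt0//.
  rewrite mulrC ltr_pdivrMr//; apply: le_lt_trans hV _.
  have hD' : D (row i z) <= (`|K| + 1) * rho z.
    by apply: le_trans hD _; rewrite ler_pM2r//; have := ler_norm K; lra.
  apply: (@le_lt_trans _ _ (e / (`|K| + 1) / 2 * ((`|K| + 1) * rho z))); first by rewrite ler_wpM2l// ltW.
  have -> : e / (`|K| + 1) / 2 * ((`|K| + 1) * rho z) = e * rho z / 2 by field; rewrite gt_eqF.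
  by rewrite ltr_pdivrMr// ltr_pMr ?mulr_gt0// ltr1n.
have := @cvgD _ _ _ U FF _ _ _ _ h2 h1; rewrite add0r => h3.
by apply: cvg_near_eq h3; apply: nearW => z; rewrite !fctE subrK.
Unshelve. all: by end_near. Qed.

Lemma scaled_P_cvg i j : i \in C -> j \in C -> exists2 P : plane, edot P n = 0 &
  (fun z => (rho z)^-1 *: (p (row i z) - p (row j z))) @ U --> P.
Proof.
move=> iC jC; have FF : Filter U by exact: filter_filter.
have r0 := near_rho_gt0.
have Pb : \forall z \near U, enorm ((rho z)^-1 *: (p (row i z) - p (row j z))) <= 2 * K.
  near=> z; have rz : 0 < rho z by near: z.
  have [_ _ _ hP] : adapted 1 (row i z) (row j z).
    by near: z; exact: near_geo.
  have hC : enorm (row i z - row j z) <= K * rho z by near: z; exact: CC.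
  rewrite enormZ gtr0_norm ?invr_gt0// mulrC ler_pdivrMr// -mulrA.
  by apply: le_trans hP _; rewrite ler_pM2l.
have [P Pl] := ultra_plane_cvg Pb; exists P => //.
have E1 := cvg_edot FF Pl (@cvg_cst _ n _ U FF).
suff E2 : (fun z => edot ((rho z)^-1 *: (p (row i z) - p (row j z))) n) @ U --> (0 : R).
  exact: cvg_uniq E1 E2.
apply/cvgrPdist_lt => e e0.
have K1 : 0 < `|2 * K| + 1 by rewrite ltr_pwDr.
have eta0 : 0 < e / (`|2 * K| + 1) / 2 by rewrite !divr_gt0.
near=> z; have rz : 0 < rho z by near: z.
have [_ _ hn _] : adapted (e / (`|2 * K| + 1) / 2) (row i z) (row j z).
  by near: z; exact: near_geo.
have hb : enorm ((rho z)^-1 *: (p (row i z) - p (row j z))) <= 2 * K by near: z.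
rewrite sub0r normrN edotZl normrM gtr0_norm ?invr_gt0//.
rewrite enormZ gtr0_norm ?invr_gt0// in hb.
have ri : 0 < (rho z)^-1 by rewrite invr_gt0.
apply: (@le_lt_trans _ _ (e / (`|2 * K| + 1) / 2 * (`|2 * K| + 1))); last first.
  by rewrite mulrAC divfK ?gt_eqF// ltr_pdivrMr// ltr_pMr// ltr1n.
apply: (@le_trans _ _ ((rho z)^-1 * (e / (`|2 * K| + 1) / 2 * enorm (p (row i z) - p (row j z))))).
  by rewrite ler_pM2l.
rewrite mulrCA ler_pM2l//; apply: le_trans hb _; apply: le_trans (ler_norm _) _.
by rewrite lerDl.
Unshelve. all: by end_near. Qed.

Lemma orthogonal_edot (P : plane) (A : R) : edot P n = 0 ->
  edot (P + A *: n) (P + A *: n) = edot P P + A ^+ 2 /\ edot (P + A *: n) (A *: n) = A ^+ 2.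
Proof.
by move=> Pn; rewrite !edotDl !edotDr !edotZl !edotZr n1 (edotC n P) Pn; split; ring.
Qed.

(** The change of [reflected_part] is O(rho). What remains is the rate of the logarithm of the
    vector from [row j z] to the reflection of [row i z]; rescaled, this vector tends to
    [P - (bi + bj) *: n] and moves with velocity [- (bi + bj) *: n]. *)
Lemma diff_g_cvg i j (bi bj : R) (P : plane) : i \in C -> j \in C -> 1 <= bi -> 1 <= bj ->
  edot P n = 0 ->
  (fun z => D (row i z) / rho z) @ U --> bi -> (fun z => D (row j z) / rho z) @ U --> bj ->
  (fun z => (rho z)^-1 *: (p (row i z) - p (row j z))) @ U --> P ->
  (fun z => 'd g (row i z, row j z) (V i z, V j z) : R) @ U -->
    ((2 * pi)^-1 * image_quotient (bi + bj) P : R).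
Proof.
move=> iC jC bi1 bj1 Pn li lj lP; have FF : Filter U by exact: filter_filter.
have r0 := near_rho_gt0.
have [C3 C30 Hpsi] := psi_bounds Omega_domain HG.
have Vi := scaled_V_cvg iC li; have Vj := scaled_V_cvg jC lj.
have VD := @cvgD _ _ _ U FF _ _ _ _ Vi Vj; rewrite -scalerDl in VD.
have rl := @cvgB _ _ _ U FF _ _ _ _ lP VD.
pose A := bi + bj; have A0 : 0 < A by rewrite /A; lra.
have [E1 E2] := orthogonal_edot (- A) Pn.
have Q1 : P - A *: n != 0.
  rewrite -edot_eq0 -scaleNr E1 gt_eqF// ltr_wpDl ?edot_ge0// sqrrN exprn_gt0//.
have ql := cvg_edot_quotient rl (@cvgN _ _ _ U FF _ _ VD) Q1.
have limE : edot (P - A *: n) (- (A *: n)) / edot (P - A *: n) (P - A *: n) = image_quotient A P.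
  by rewrite -scaleNr E1 E2 sqrrN.
rewrite limE in ql.
have ql2 := @cvgM _ _ U FF _ _ _ _ (@cvg_cst R (2 * pi)^-1 _ U FF) ql.
pose e z : R := 'd (reflected_part p g ^~ (row j z)) (row i z) (V i z) + 'd (reflected_part p g (row i z)) (row j z) (V j z).
have el : e @ U --> (0 : R).
  apply: (cvg0_le (h := fun z => 2 * C3 * K * rho z)); last first.
    by rewrite -(mulr0 (2 * C3 * K)); apply: cvgM => //; exact: cvg_cst.
  near=> z; have [zO _] : config z by near: z.
  have Di : D (row i z) < eps0 by near: z; exact: (near_collar iC).
  have Dj : D (row j z) < eps0 by near: z; exact: (near_collar jC).
  have [_ h1 h2] := Hpsi _ _ (zO i) (zO j) Di Dj.
  have ei : enorm (V i z) = D (row i z) by near: z; exact: (enorm_V iC).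
  have ej : enorm (V j z) = D (row j z) by near: z; exact: (enorm_V jC).
  have ki : D (row i z) <= K * rho z by near: z; exact: (CD iC).
  have kj : D (row j z) <= K * rho z by near: z; exact: (CD jC).
  apply: le_trans (ler_normD _ _) _.
  apply: le_trans (lerD (h1 (V i z)) (h2 (V j z))) _; rewrite ei ej -mulrDr.
  have -> : 2 * C3 * K * rho z = C3 * (K * rho z + K * rho z) by ring.
  by rewrite ler_pM2l// lerD.
have fl := @cvgD _ _ _ U FF _ _ _ _ el ql2; rewrite add0r in fl.
apply: cvg_near_eq fl; near=> z; have [zO _] : config z by near: z.
have rz : 0 < rho z by near: z.
have Di : D (row i z) < eps0 by near: z; exact: (near_collar iC).
have Dj : D (row j z) < eps0 by near: z; exact: (near_collar jC).
have eE : e z = _ := congr2 +%R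
  (diff_psi_l Omega_domain p_proj HG (V i z) (zO i) Di (zO j))
  (diff_psi_r Omega_domain p_proj HG (V j z) (zO i) Di (zO j)).
rewrite !fctE eE (diff_g_split g (V i z) (V j z) (zO i) (zO j)).
(* The projection does not move, so the velocity [2 *: 'd p x v - v] of the reflected point becomes
   [- v]. *)
rewrite (diff_proj_normal Omega_domain p_proj (zO i) Di) scaler0 sub0r.
have rE : reflection p (row i z) - row j z = p (row i z) - p (row j z) - (V i z + V j z).
  by rewrite /V /reflection; apply/rowP => k; rewrite !mxE; ring.
rewrite /=.
have -> : (rho z)^-1 *: (p (row i z) - p (row j z)) - ((rho z)^-1 *: V i z + (rho z)^-1 *: V j z) =
    (rho z)^-1 *: (reflection p (row i z) - row j z).
  by rewrite rE -scalerDr -scalerBr.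
have -> : - ((rho z)^-1 *: V i z + (rho z)^-1 *: V j z) = (rho z)^-1 *: (- (V i z + V j z)).
  by rewrite -scalerDr scalerN.
rewrite edot_quotient_scale ?invr_neq0 ?gt_eqF//.
move: (reflection p (row i z) - row j z) => r; rewrite !edotNr edotDr.
move: (edot r (V i z)) (edot r (V j z)) ((edot r r)^-1) => q1 q2 q.
move: ('d g (row i z, row j z) (V i z, 0)) ('d g (row i z, row j z) (0, V j z)) => d1 d2.
by ring.
Unshelve. all: by end_near. Qed.

(** The direct logarithm yields the same quotient with [bi - bj] in place of [bi + bj]. Its
    denominator stays positive because, measured in units of [rho], distinct points are at distance
    at least 1. *)
Lemma pair_diff_cvg i j (bi bj : R) (P : plane) (W : 'M[R]_(N, 2) -> 'M[R]_(N, 2)) :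
  (forall k z, k \in C -> row k (W z) = V k z) ->
  i \in C -> j \in C -> i != j -> 1 <= bi -> 1 <= bj -> edot P n = 0 ->
  (fun z => D (row i z) / rho z) @ U --> bi -> (fun z => D (row j z) / rho z) @ U --> bj ->
  (fun z => (rho z)^-1 *: (p (row i z) - p (row j z))) @ U --> P ->
  (fun z => pair_diff g i j z (W z)) @ U -->
    ((2 * pi)^-1 * (image_quotient (bi + bj) P - image_quotient (bi - bj) P) : R) /\
  0 < edot P P + (bi - bj) ^+ 2.
Proof.
move=> WV iC jC ij bi1 bj1 Pn li lj lP; have FF : Filter U by exact: filter_filter.
have r0 := near_rho_gt0.
have Vi := scaled_V_cvg iC li; have Vj := scaled_V_cvg jC lj.
have VB := @cvgB _ _ _ U FF _ _ _ _ Vi Vj; rewrite -scalerBl in VB.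
have xl := @cvgD _ _ _ U FF _ _ _ _ lP VB.
have [E1 E2] := orthogonal_edot (bi - bj) Pn.
have xE z : (rho z)^-1 *: (p (row i z) - p (row j z)) + ((rho z)^-1 *: V i z - (rho z)^-1 *: V j z) =
    (rho z)^-1 *: (row i z - row j z).
  by rewrite /V -scalerBr -scalerDr; congr (_ *: _); apply/rowP => k; rewrite !mxE; ring.
have pos : 1 <= edot P P + (bi - bj) ^+ 2.
  rewrite -E1; apply: (cvg_ge_lim _ (cvg_edot FF xl xl)); near=> z.
  have rz : 0 < rho z by near: z.
  rewrite !fctE /= xE -sqr_enorm enormZ gtr0_norm ?invr_gt0//.
  rewrite -[1](expr1n _ 2) ler_pXn2r ?nnegrE ?mulr_ge0 ?enorm_ge0 ?invr_ge0 ?(ltW rz)//.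
  by rewrite mulrC ler_pdivlMr// mul1r clearance_dist.
have X0 : P + (bi - bj) *: n != 0 by rewrite -edot_eq0 E1 gt_eqF// (lt_le_trans ltr01).
split; last exact: lt_le_trans pos.
have ql := cvg_edot_quotient xl VB X0; rewrite E1 E2 in ql.
have ql2 := @cvgM _ _ U FF _ _ _ _ (@cvg_cst R (2 * pi)^-1 _ U FF) ql.
rewrite mulrBr.
have fl := @cvgB _ _ _ U FF _ _ _ _ (diff_g_cvg iC jC bi1 bj1 Pn li lj lP) ql2.
apply: cvg_near_eq fl; near=> z.
have rz : 0 < rho z by near: z.
rewrite !fctE /= /pair_diff !WV// xE -scalerBr edot_quotient_scale//.
by rewrite invr_neq0// gt_eqF.
Unshelve. all: by end_near. Qed.

(** For fixed [c >= 0] the quotient [A / (c + A)] is nondecreasing in [A] and takes values in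
    [0, 1]. *)
Lemma image_quotient_bounds (x y : R) (P : plane) : 1 <= x -> 1 <= y -> 0 < edot P P + (x - y) ^+ 2 ->
  0 <= image_quotient (x + y) P - image_quotient (x - y) P <= 1.
Proof.
move=> x1 y1; rewrite /image_quotient; have := edot_ge0 P; move: (edot P P) => c c0 pos.
have B0 := sqr_ge0 (x - y).
have AB : (x - y) ^+ 2 <= (x + y) ^+ 2 by nra.
move: ((x - y) ^+ 2) ((x + y) ^+ 2) B0 AB pos => B A B0 AB pos.
have posA : 0 < c + A by lra.
apply/andP; split.
  rewrite subr_ge0 ler_pdivrMr// mulrAC ler_pdivlMr//; nra.
have h1 : A / (c + A) <= 1 by rewrite ler_pdivrMr// mul1r; lra.
have h2 : 0 <= B / (c + B) by rewrite divr_ge0// ltW.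
by lra.
Qed.

Lemma boundary_cluster_sum :
  (forall i j, i \in C -> j \notin C -> far (fun z => enorm (row i z - row j z))) ->
  exists2 c : 'I_N -> 'I_N -> R,
    forall i j, i \in C -> j \in C -> i != j -> 0 <= c i j <= 1 &
    \sum_(i in C) Gamma 0 i ^+ 2 +
      \sum_(i in C) \sum_(j in C | i != j) Gamma 0 i * Gamma 0 j * c i j = 0.
Proof.
move=> Cfar.
have Hb k : exists b : R, k \in C -> 1 <= b /\ (fun z => D (row k z) / rho z) @ U --> b.
  have [kC|_] := boolP (k \in C); last by exists 0.
  by have [b b1 bl] := dist_ratio_cvg kC; exists b.
have {Hb}[b Hb] := choice Hb.
have HP (ij : 'I_N * 'I_N) : exists P : plane, ij.1 \in C -> ij.2 \in C -> edot P n = 0 /\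
    (fun z => (rho z)^-1 *: (p (row ij.1 z) - p (row ij.2 z))) @ U --> P.
  have [iC|_] := boolP (ij.1 \in C); last by exists 0.
  have [jC|_] := boolP (ij.2 \in C); last by exists 0.
  by have [P P1 Pl] := scaled_P_cvg iC jC; exists P.
have {HP}[P HP] := choice HP.
pose W (z : 'M[R]_(N, 2)) : 'M[R]_(N, 2) := \matrix_(k < N) (if k \in C then V k z else 0).
have WV k z : k \in C -> row k (W z) = V k z by move=> kC; rewrite rowK kC.
pose c i j := image_quotient (b i + b j) (P (i, j)) - image_quotient (b i - b j) (P (i, j)).
have pc i j (iC : i \in C) (jC : j \in C) (ij : i != j) :
    (fun z => pair_diff g i j z (W z)) @ U --> ((2 * pi)^-1 * c i j : R) /\
    0 < edot (P (i, j)) (P (i, j)) + (b i - b j) ^+ 2.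
  have [bi1 li] := Hb i iC; have [bj1 lj] := Hb j jC; have [Pn lP] := HP (i, j) iC jC.
  exact: pair_diff_cvg.
(* For a point and its own reflection the two projections coincide, so [P] is 0 and the quotient is
   1. *)
have sc i (iC : i \in C) : (fun z => 'd g (row i z, row i z) (row i (W z), row i (W z)) : R) @ U -->
    ((2 * pi)^-1 : R).
  have [bi1 li] := Hb i iC; have FF : Filter U by exact: filter_filter.
  have l0 : (fun z => (rho z)^-1 *: (p (row i z) - p (row i z))) @ U --> (0 : plane).
    suff -> : (fun z => (rho z)^-1 *: (p (row i z) - p (row i z))) = (fun=> 0) by exact: cvg_cst.
    by apply/funext => z; rewrite subrr scaler0.
  have := diff_g_cvg iC iC bi1 bi1 (edot0l n) li li l0.
  rewrite /image_quotient edot0l add0r divff ?mulr1; last by rewrite expf_neq0// gt_eqF//; lra.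
  by apply: cvg_near_eq; apply: nearW => z; rewrite !WV.
exists c; first by move=> i j iC jC ij; apply: image_quotient_bounds; [exact: (Hb i iC).1|exact: (Hb j jC).1|exact: (pc i j iC jC ij).2].
have VK k : k \in C -> \forall z \near U, enorm (row k (W z)) <= K * rho z.
  by move=> kC; apply: filterS2 (enorm_V kC) (CD kC) => z e1 e2; rewrite WV// e1.
have := test_field (K := K) (V := W)
  (l := fun=> (2 * pi)^-1) (ll := fun i j => (2 * pi)^-1 * c i j) VK _ Cfar sc (fun i j iC jC ij => (pc i j iC jC ij).1).
have H0 k z : k \notin C -> row k (W z) = 0 by move=> kC; rewrite rowK (negbTE kC).
move=> /(_ H0).
have i2 : (2 * pi)^-1 != 0 :> R by rewrite gt_eqF//; have [] := @inv2pi R.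
rewrite -mulr_suml => E; apply: (mulIf i2); rewrite mul0r mulrDl -[RHS]E; congr (_ + _).
rewrite mulr_suml; apply: eq_bigr => i _; rewrite mulr_suml; apply: eq_bigr => j _; ring.
Qed.

End AtPoint.

Lemma no_boundary_cluster i : (forall k, Gamma 0 k != 0) ->
  (forall E : {set 'I_N}, (2 <= #|E|)%N ->
    \sum_(i in E) \sum_(j in E | Gamma 0 i * Gamma 0 j < 0) `|Gamma 0 i * Gamma 0 j|
      < \sum_(i in E) Gamma 0 i ^+ 2) ->
  ~ close (fun z => D (row i z)).
Proof.
move=> G0 adm Di; set C := cluster i.
have [a Ba Ca] := boundary_cluster_limit Di.
have [n n1 geo] := boundary_geometry Omega_domain eps0_gt0 Omega_C3 p_proj Ba.
have r0 := near_rho_gt0.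
have iC : i \in C.
  by apply/clusterP; exists 1; apply: filterS r0 => z rz; rewrite subrr enorm0 mul1r ltW.
have [K1 HK1] := close_uniform (f := fun k z => enorm (row i z - row k z))
  (fun k kC => elimT (clusterP i k) kC).
have [K2 HK2] : close (fun z => D (row i z)) by [].
have [k1 k10 K1k] : exists2 k1 : R, 0 <= k1 & K1 <= k1 by exists `|K1| => //; exact: ler_norm.
have [k2 k20 K2k] : exists2 k2 : R, 0 <= k2 & K2 <= k2 by exists `|K2| => //; exact: ler_norm.
(* Through point [i], distances to the complement are at most [(k2 + k1) * rho z] and mutual
   distances at most [2 * k1 * rho z]. *)
pose K := k2 + 2 * k1.
have KE z : K * rho z = k2 * rho z + 2 * (k1 * rho z) by rewrite /K; ring.
have CD k : k \in C -> \forall z \near U, D (row k z) <= K * rho z.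
  move=> kC; near=> z; have rz : 0 < rho z by near: z.
  have h1 : enorm (row i z - row k z) <= K1 * rho z by near: z; exact: HK1.
  have h2 : D (row i z) <= K2 * rho z by near: z.
  have := edist_lipschitz (row k z) (row i z) (setC_domain_neq0 Omega_domain).
  have h3 : K1 * rho z <= k1 * rho z by rewrite ler_pM2r.
  have h4 : 0 <= k1 * rho z by rewrite mulr_ge0// ltW.
  have h5 : K2 * rho z <= k2 * rho z by rewrite ler_pM2r.
  rewrite (enormB (row k z) (row i z)) KE.
  move: h1 h2 h3 h4 h5; move: (K1 * _) (k1 * _) (K2 * _) (k2 * _) => *; elra.
have CC x y : x \in C -> y \in C -> \forall z \near U, enorm (row x z - row y z) <= K * rho z.
  move=> xC yC; near=> z; have rz : 0 < rho z by near: z.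
  have h1 : enorm (row i z - row x z) <= K1 * rho z by near: z; exact: HK1.
  have h2 : enorm (row i z - row y z) <= K1 * rho z by near: z; exact: HK1.
  apply: le_trans (ler_enorm_dist (row x z) (row i z) (row y z)) _.
  have h3 : K1 * rho z <= k1 * rho z by rewrite ler_pM2r.
  have h4 : 0 <= k2 * rho z by rewrite mulr_ge0// ltW.
  rewrite (enormB (row x z) (row i z)) KE; apply: le_trans (lerD h1 h2) _.
  by move: h3 h4; move: (K1 * _) (k1 * _) (k2 * _) => q1 q2 q3; lra.
have [c c01] := boundary_cluster_sum n1 geo Ca CD CC (@cluster_far i).
apply/eqP; rewrite gt_eqF//.
have [C2|C1] := leqP 2 #|C|.
  (* As [c] lies in [0, 1], replacing it by 1 on the negative products and by 0 on the others can
     only lower the sum. *)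
  apply: (@lt_le_trans _ _ (\sum_(i in C) Gamma 0 i ^+ 2 -
      \sum_(i in C) \sum_(j in C | Gamma 0 i * Gamma 0 j < 0) `|Gamma 0 i * Gamma 0 j|)).
    by rewrite subr_gt0; exact: adm.
  rewrite lerD2l -sumrN; apply: ler_sum => k kC; rewrite -sumrN big_mkcondr [leRHS]big_mkcondr.
  apply: ler_sum => l lC /=; have [<-|kl] := eqVneq k l.
    by rewrite ltNge -expr2 sqr_ge0.
  have /andP[c0 c1] := c01 k l kC lC kl.
  case: ltP => h; last by rewrite mulr_ge0.
  by rewrite ltr0_norm// opprK -[leLHS]mulr1 ler_nM2l.
(* A cluster of one point leaves only [Gamma 0 i ^+ 2], positive by [G0]. *)
rewrite [X in _ + X]big1 ?addr0 => [|k kC]; last first.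
  rewrite big1// => l /andP[lC kl]; exfalso.
  have sub : [set k; l]%SET \subset C by apply/fintype.subsetP => x /finset.set2P[] ->.
  by have := leq_ltn_trans (subset_leq_card sub) C1; rewrite cards2 kl.
rewrite (bigD1 i)//= ltr_pwDl ?sumr_ge0// => [|k _]; last exact: sqr_ge0.
by rewrite lt_def sqr_ge0 expf_neq0.
Unshelve. all: by end_near. Qed.

End BlowUp.

(** * The lower bound on clearance times gradient *)

Section GradientBound.
Context {R : realType}.
Notation plane := 'rV[R]_2.

(** The coefficients in [boundary_cluster_sum] are nonnegative, so it is the pairs of opposite sign
    that the squares have to outweigh; either form of admissibility provides this. *)
Lemma weak_boundary_admissible (N : nat) (Omega : set plane) (Gamma : 'rV[R]_N) :
  boundary_admissible Omega Gamma ->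
  forall C : {set 'I_N}, (2 <= #|C|)%N ->
    \sum_(i in C) \sum_(j in C | Gamma 0 i * Gamma 0 j < 0) `|Gamma 0 i * Gamma 0 j|
      < \sum_(i in C) Gamma 0 i ^+ 2.
Proof.
move=> [h1 h2] C C2; have [/h1|/h2 H] := pselect (strictly_convex Omega); first exact.
apply: le_lt_trans (H C C2); apply: ler_sum => i iC; rewrite big_mkcondr [leRHS]big_mkcondr.
apply: ler_sum => j jC /=; have [<-|ij] := eqVneq i j; first by rewrite ltNge -expr2 sqr_ge0.
by case: ifP.
Qed.

Lemma L_admissible_neq0 (N : nat) (Gamma : 'rV[R]_N) : L_admissible Gamma ->
  forall k, Gamma 0 k != 0.
Proof.
move=> /L_admissibleP[s [t [t0 _ H]]] k; have := H ((s^-1)%g k) ((s^-1)%g k).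
rewrite permKV addnn -signr_odd odd_double expr0 mul1r => E; apply/eqP => Gk.
by move: E; rewrite Gk mul0r => /esym/eqP; rewrite mulf_eq0 orbb gt_eqF.
Qed.

Variables (Omega : set plane) (eps0 : R) (p : plane -> plane).
Hypotheses (Omega_domain : bounded_domain Omega) (eps0_gt0 : 0 < eps0)
  (Omega_C3 : Ck_boundary 3 Omega) (p_proj : boundary_projection Omega eps0 p).
Variables (G : plane -> plane -> R) (g : plane * plane -> R).
Hypothesis HG : hypothesis_G Omega eps0 p G g.
Notation D x := (edist x (~` Omega)).
Variables (N : nat) (Gamma : 'rV[R]_N).
Notation config := (config Omega : set 'M[R]_(N, 2)).
Notation rho := (@clearance R Omega N).
Hypotheses (Gamma_L : L_admissible Gamma) (Gamma_boundary : boundary_admissible Omega Gamma)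
  (Gamma_Delta : Delta_admissible Gamma).

(** Along [U] one fixed gap realizes the clearance. A distance to the complement equal to [rho]
    would produce a boundary cluster; once these are excluded, a distance between two points equal
    to [rho] produces an interior one. *)
Lemma clearance_not_cvg0 (U : set_system 'M[R]_(N, 2)) : UltraFilter U -> U config ->
  (fun z => rho z * `|path_grad g Gamma z|) @ U --> (0 : R) -> ~ rho @ U --> (0 : R).
Proof.
move=> UU U_config grad0 rho0.
have Uc1 : \forall z \near U, rho z < 1.
  move/cvgrPdist_lt : (rho0) => /(_ 1 ltr01); apply: filterS2 U_config => z cz.
  by rewrite sub0r normrN; apply: le_lt_trans; exact: ler_norm.
have [|[i j] Uij] := @ultra_exists _ U UU _ (fun ij => [set z | gap Omega ij z = rho z]).
  by apply: filterS Uc1 => z; exact: clearance_attained.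
have Dfar k : far Omega U (fun z => D (row k z)).
  have [h|//] := @close_or_far R Omega N U UU (fun z => D (row k z)); exfalso; move: h.
  exact: (no_boundary_cluster Omega_domain eps0_gt0 Omega_C3 p_proj HG U_config rho0 grad0
    (L_admissible_neq0 Gamma_L) (weak_boundary_admissible Gamma_boundary)).
have [ij|ij] := eqVneq i j.
  have h : U [set z | D (row i z) = rho z] by apply: filterS Uij => z; rewrite /gap /= ij eqxx.
  have h1 := Dfar i 1; have [z []] := filter_ex (filterI h h1).
  by rewrite /= mul1r => ->; rewrite ltxx.
apply: (no_interior_cluster Omega_domain eps0_gt0 Omega_C3 p_proj HG U_config rho0 grad0 Gamma_Delta Dfar ij).
by exists 1; apply: filterS Uij => z; rewrite /gap /= (negbTE ij) mul1r => ->.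
Qed.

(** Otherwise some ultrafilter contains all sets where [rho] times the gradient is below [d]. If
    [rho] does not tend to 0 along it, compactness of the configurations with clearance at least [e]
    gives a limit configuration where the gradient vanishes. *)
Lemma gradient_lower_bound : (forall z, config z -> path_grad g Gamma z != 0) ->
  exists2 d : R, 0 < d & forall z, config z -> d <= rho z * `|path_grad g Gamma z|.
Proof.
move=> nocrit; apply: contrapT => nd.
pose m z := rho z * `|path_grad g Gamma z|.
pose A (d : R) := [set z | config z /\ m z < d].
have FA : ProperFilter (filter_from [set d : R | 0 < d] A).
  apply: filter_from_proper.
    apply: filter_from_filter; first by exists 1 => /=.
    move=> a b /= a0 b0; exists (minr a b); first by rewrite /= lt_min a0.
    by move=> z [cz]; rewrite lt_min => /andP[].
  move=> d d0; apply: contrapT => ne; apply: nd; exists d => // z cz; rewrite leNgt; apply/negP => h.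
  by apply: ne; exists z.
have [U [UU FU]] := ultraFilterLemma FA.
have UA d : 0 < d -> U (A d) by move=> d0; apply: FU; exists d.
have Uc : U config by apply: filterS (UA 1 ltr01) => z [].
have m0 : m @ U --> (0 : R).
  apply/cvgrPdist_lt => e /UA; apply: filterS => z [cz mz].
  by rewrite sub0r normrN ger0_norm// mulr_ge0// ltW// clearance_gt0.
apply: (clearance_not_cvg0 UU Uc m0); apply/cvgrPdist_lt => e e0.
have [h|h] := in_ultra_setVsetC [set z | e <= rho z] UU; last first.
  apply: filterS2 Uc h => z cz /negP; rewrite -ltNge sub0r normrN ger0_norm//.
  by rewrite ltW// clearance_gt0.
exfalso; have [l el Ul] := ultra_cvg (f := id) (compact_clearance Omega_domain e0) h.
have cl : config l by apply: (clearance_config Omega_domain); exact: lt_le_trans el.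
have FF : Filter U by exact: filter_filter.
have r1 : rho @ U --> rho l by exact: cvg_comp _ _ Ul (@clearance_continuous _ _ Omega_domain N l).
have g1 : (fun z => `|path_grad g Gamma z|) @ U --> (`|path_grad g Gamma l| : R).
  have gc := path_grad_continuous HG (Gamma := Gamma) cl.
  have gU := cvg_comp _ _ Ul gc.
  exact: (@cvg_norm _ _ _ U FF _ _ gU).
have : rho l * `|path_grad g Gamma l| = 0 by exact: cvg_uniq (@cvgM _ _ U FF _ _ _ _ r1 g1) m0.
move/eqP; rewrite mulf_eq0 normr_eq0 (negbTE (nocrit l cl)) orbF gt_eqF//.
exact: clearance_gt0.
Qed.

End GradientBound.

(** * The ascending flow *)

Section Flow.
Context {R : realType}.
Notation plane := 'rV[R]_2.
Variables (Omega : set plane) (eps0 : R) (p : plane -> plane).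
Hypotheses (Omega_domain : bounded_domain Omega).
Variables (G : plane -> plane -> R) (g : plane * plane -> R).
Hypothesis HG : hypothesis_G Omega eps0 p G g.
Variables (N : nat) (Gamma : 'rV[R]_N).
Notation config := (config Omega : set 'M[R]_(N, 2)).
Notation rho := (@clearance R Omega N).
Notation H := (path_function Gamma G g).
Implicit Types (z v : 'M[R]_(N, 2)) (s t : R).

Lemma is_derive_path z v t : config (z + t *: v) ->
  is_derive t 1 (fun t => H (z + t *: v)) (path_diff g Gamma (z + t *: v) v).
Proof.
move=> c.
have h1 : is_diff t (fun t : R => z + t *: v) (fun u => u *: v).
  by apply: (is_diff_eq (is_diffD (is_diff_cst z t) (is_diff_scalel t v))); apply/funext => u; rewrite !fctE add0r.
have h2 := is_diff_comp h1 (is_diff_path Omega_domain HG Gamma c).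
have d2 : differentiable (H \o (fun t : R => z + t *: v)) t by case: h2.
apply: DeriveDef; first exact: diff_derivable.
by rewrite deriveE// (@diff_val _ _ _ _ _ _ _ h2) /= scale1r.
Qed.

(** The normalization serves two ends. By [2 * x <= 1 + x ^+ 2] the velocity never exceeds half the
    clearance, however large the gradient; and where [rho] times the gradient is at least [d], the
    rate of ascent is at least [d ^+ 2 / (1 + d ^+ 2)]. *)
Definition velocity z : 'M[R]_(N, 2) :=
  (rho z ^+ 2 / (1 + rho z ^+ 2 * \sum_i \sum_j path_grad g Gamma z i j ^+ 2)) *:
  path_grad g Gamma z.

Definition step s z := z + s *: velocity z.

Lemma sqr_mx_norm_le (m n : nat) (A : 'M[R]_(m, n)) : `|A| ^+ 2 <= \sum_i \sum_j A i j ^+ 2.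
Proof.
have S0 : 0 <= \sum_i \sum_j A i j ^+ 2.
  by apply: sumr_ge0 => i _; apply: sumr_ge0 => j _; exact: sqr_ge0.
rewrite -[leRHS]sqr_sqrtr// ler_pXn2r ?nnegrE ?sqrtr_ge0//.
apply: mx_norm_le => [|i j]; first exact: sqrtr_ge0.
rewrite -sqrtr_sqr ler_sqrt// (bigD1 i)//= (bigD1 j)//= -addrA lerDl addr_ge0//.
  by apply: sumr_ge0 => j' _; exact: sqr_ge0.
by apply: sumr_ge0 => i' _; apply: sumr_ge0 => j' _; exact: sqr_ge0.
Qed.

Lemma half_quotient_le (a b e : R) : 0 < a -> 0 <= b -> b ^+ 2 <= e ->
  a ^+ 2 / (1 + a ^+ 2 * e) * b <= a / 2.
Proof.
move=> a0 b0 be; have a2 : 0 < a ^+ 2 by rewrite exprn_gt0.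
have e0 : 0 <= e by apply: le_trans be; exact: sqr_ge0.
have q0 : 0 < 1 + a ^+ 2 * e by rewrite ltr_pwDl// mulr_ge0// ltW.
rewrite [leLHS]mulrAC ler_pdivrMr// [leRHS]mulrAC ler_pdivlMr//.
have h : a ^+ 2 * b ^+ 2 <= a ^+ 2 * e by rewrite ler_pM2l.
have -> : a ^+ 2 * b * 2 = a * (2 * (a * b)) by ring.
rewrite ler_pM2l//; have := sqr_ge0 (1 - a * b).
have -> : (1 - a * b) ^+ 2 = 1 - 2 * (a * b) + a ^+ 2 * b ^+ 2 by ring.
by move: h; move: (a ^+ 2 * e) (a * b) (a ^+ 2 * b ^+ 2) => *; lra.
Qed.

Lemma velocity_le z : config z -> `|velocity z| <= rho z / 2.
Proof.
move=> cz; have r0 := clearance_gt0 Omega_domain cz.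
have := sqr_mx_norm_le (path_grad g Gamma z); rewrite /velocity normrZ.
have := normr_ge0 (path_grad g Gamma z).
move: (`|path_grad g Gamma z|) (\sum_i _) => b e b0 be.
have e0 : 0 <= e by apply: le_trans be; exact: sqr_ge0.
rewrite ger0_norm; first exact: half_quotient_le.
by rewrite divr_ge0 ?sqr_ge0// addr_ge0// mulr_ge0// sqr_ge0.
Qed.

(** The Lipschitz constant 4 of the clearance times a displacement of at most [s * rho z / 2]. *)
Lemma clearance_step s z : config z -> 0 <= s -> (1 - 2 * s) * rho z <= rho (step s z).
Proof.
move=> cz s0; have := clearance_lipschitz Omega_domain (step s z) z.
rewrite /step addrAC subrr add0r normrZ ger0_norm//.
have h : s * `|velocity z| <= s * (rho z / 2) by rewrite ler_wpM2l// velocity_le.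
by move: h; move: (s * `|velocity z|) (rho (z + _)) => *; nra.
Qed.

Lemma config_step s z : config z -> 0 <= s <= 1 / 8 -> config (step s z).
Proof.
move=> cz /andP[s0 s1]; apply: (clearance_config Omega_domain).
apply: lt_le_trans (clearance_step cz s0); rewrite mulr_gt0 ?clearance_gt0//; lra.
Qed.

Lemma config_iter_step s n z : config z -> 0 <= s <= 1 / 8 -> config (iter n (step s) z).
Proof. by move=> cz s1; elim: n => //= n IH; exact: config_step. Qed.

Lemma clearance_iter_step s n z : config z -> 0 <= s <= 1 / 8 ->
  (1 - 2 * s) ^+ n * rho z <= rho (iter n (step s) z).
Proof.
move=> cz s1; elim: n => [|n IH]; first by rewrite expr0 mul1r.
have /andP[s0 s8] := s1; rewrite exprS -mulrA iterS.
apply: le_trans (clearance_step (config_iter_step n cz s1) s0).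
by rewrite ler_wpM2l//; lra.
Qed.

Lemma step_continuous s z : config z -> {for z, continuous (step s)}.
Proof.
move=> cz; have FF := nbhs_filter z.
have gc := path_grad_continuous HG (Gamma := Gamma) cz.
have rc : rho @ nbhs z --> rho z by exact: (@clearance_continuous _ _ Omega_domain N z).
have r2 : (fun z => rho z ^+ 2) @ nbhs z --> (rho z ^+ 2 : R).
  by rewrite expr2; under eq_fun do rewrite expr2; exact: (@cvgM _ _ (nbhs z) FF _ _ _ _ rc rc).
have ec (i : 'I_N) (j : 'I_2) : (fun z => path_grad g Gamma z i j ^+ 2) @ nbhs z --> (path_grad g Gamma z i j ^+ 2 : R).
  have c1 := cvg_comp _ _ gc (@coord_continuous R N 2 i j (path_grad g Gamma z)).
  by rewrite expr2; under eq_fun do rewrite expr2; exact: (@cvgM _ _ (nbhs z) FF _ _ _ _ c1 c1).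
have Ec : (fun z => \sum_i \sum_j path_grad g Gamma z i j ^+ 2) @ nbhs z -->
    (\sum_i \sum_j path_grad g Gamma z i j ^+ 2 : R).
  apply: (@cvg_sum R _ (nbhs z) FF _ xpredT (fun i z => \sum_j path_grad g Gamma z i j ^+ 2)) => i _.
  by apply: (@cvg_sum R _ (nbhs z) FF _ xpredT (fun j z => path_grad g Gamma z i j ^+ 2)) => j _; exact: ec.
have e0 : 0 <= \sum_i \sum_j path_grad g Gamma z i j ^+ 2.
  by apply: sumr_ge0 => i _; apply: sumr_ge0 => j _; exact: sqr_ge0.
have q0 : 1 + rho z ^+ 2 * (\sum_i \sum_j path_grad g Gamma z i j ^+ 2) != 0.
  by rewrite gt_eqF// ltr_pwDl// mulr_ge0// sqr_ge0.
have qc := @cvgM _ _ (nbhs z) FF _ _ _ _ r2 (@cvgV _ _ (nbhs z) FF _ _ q0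
  (@cvgD _ _ _ (nbhs z) FF _ _ _ _ (@cvg_cst R 1 _ (nbhs z) FF)
    (@cvgM _ _ (nbhs z) FF _ _ _ _ r2 Ec))).
have vc := @cvgZ _ _ _ (nbhs z) FF _ _ _ _ qc gc.
have ic : id @ nbhs z --> z by [].
exact: (@cvgD _ _ _ (nbhs z) FF _ _ _ _ ic
  (@cvgZ _ _ _ (nbhs z) FF _ _ _ _ (@cvg_cst R s _ (nbhs z) FF) vc)).
Qed.

Lemma path_grad_uniform (r eta : R) : 0 < r -> 0 < eta -> exists2 e : R, 0 < e &
  forall z z', r <= rho z -> `|z' - z| <= e ->
    config z' /\ `|path_grad g Gamma z' - path_grad g Gamma z| <= eta.
Proof.
move=> r0 eta0.
(* The radius [expR (- M)] is positive for every [M] and shrinks as [M] grows, as the monotonicity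
   in [compact_bound] demands. *)
pose P (M : R) z := forall z', `|z' - z| <= expR (- M) ->
  config z' /\ `|path_grad g Gamma z' - path_grad g Gamma z| <= eta.
have [||M HM] := @compact_bound _ _ [set z | r <= rho z] P (compact_clearance Omega_domain r0).
- by move=> M M' z MM' h z' zz'; apply: h; apply: le_trans zz' _; rewrite ler_expR lerN2.
- move=> z rz; have cz : config z by apply: (clearance_config Omega_domain); exact: lt_le_trans rz.
  have gc := path_grad_continuous HG (Gamma := Gamma) cz.
  have eta2 : 0 < eta / 2 by rewrite divr_gt0.
  have h1 : nbhs z [set z' | `|path_grad g Gamma z - path_grad g Gamma z'| < eta / 2].
    exact: (iffLR (@cvgrPdist_lt _ _ _ (nbhs z) _ _ _) gc).
  have h2 : nbhs z config by apply: open_nbhs_nbhs; split => //; exact: open_config.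
  have /nbhs_ballP[e /= e0] := @filterI _ (nbhs z) (nbhs_filter z) _ _ h2 h1.
  rewrite -ball_normE => He; exists (- ln (e / 2)).
  have e2 : 0 < e / 2 by rewrite divr_gt0.
  apply/nbhs_ballP; exists (e / 2) => //= z1; rewrite -ball_normE /= => zz1 z'.
  rewrite opprK lnK ?posrE// => z1z'.
  have zz' : `|z - z'| < e.
    have -> : z - z' = (z - z1) - (z' - z1) by rewrite opprB addrA subrK.
    apply: le_lt_trans (ler_normB _ _) _; move: zz1 z1z'.
    by move: (`|z - z1|) (`|z' - z1|) => *; lra.
  have zz1' : `|z - z1| < e by apply: lt_trans zz1 _; rewrite ltr_pdivrMr// ltr_pMr// ltr1n.
  have [cz' gz'] := He z' zz'; have [_ gz1] := He z1 zz1'; split => //.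
  have -> : path_grad g Gamma z' - path_grad g Gamma z1 =
      (path_grad g Gamma z - path_grad g Gamma z1) - (path_grad g Gamma z - path_grad g Gamma z').
    by rewrite opprB [RHS]addrC addrA subrK.
  apply: le_trans (ler_normB _ _) _; move: gz' gz1 => /=.
  by move: (`|_ - path_grad g Gamma z1|) (`|_ - path_grad g Gamma z'|) => *; lra.
by exists (expR (- M)); [exact: expR_gt0 | move=> z z' rz; exact: HM].
Qed.

Variable d : R.
Hypotheses (d0 : 0 < d)
  (grad_low : forall z, config z -> d <= rho z * `|path_grad g Gamma z|).
Let c := d ^+ 2 / (1 + d ^+ 2).

Lemma path_diff_velocity z : config z -> c <= path_diff g Gamma z (velocity z).
Proof.
move=> cz; rewrite (path_diff_grad Omega_domain HG Gamma _ cz).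
have r0 := clearance_gt0 Omega_domain cz.
have := sqr_mx_norm_le (path_grad g Gamma z); have := grad_low cz.
have -> : \sum_i \sum_j velocity z i j * path_grad g Gamma z i j =
    rho z ^+ 2 / (1 + rho z ^+ 2 * \sum_i \sum_j path_grad g Gamma z i j ^+ 2) *
    \sum_i \sum_j path_grad g Gamma z i j ^+ 2.
  rewrite mulr_sumr; apply: eq_bigr => i _; rewrite mulr_sumr; apply: eq_bigr => j _.
  by rewrite mxE expr2 mulrA.
move: (\sum_i _) => e dl be.
have dE : d ^+ 2 <= rho z ^+ 2 * e.
  apply: (@le_trans _ _ ((rho z * `|path_grad g Gamma z|) ^+ 2)).
    by rewrite ler_pXn2r ?nnegrE ?(ltW d0) ?mulr_ge0// ltW.
  by rewrite exprMn ler_pM2l ?exprn_gt0.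
rewrite mulrAC; move: dE; move: (rho z ^+ 2 * e) => x dx; rewrite /c.
have d2 : 0 < d ^+ 2 by rewrite exprn_gt0.
have x1 : 0 < 1 + x by lra.
have d1 : 0 < 1 + d ^+ 2 by lra.
by rewrite ler_pdivrMr// [leRHS]mulrAC ler_pdivlMr// !mulrDr !mulr1 mulrC lerD2r.
Qed.

Lemma step_ascent (r : R) : 0 < r -> exists2 s0 : R, 0 < s0 &
  forall s z, 0 < s <= s0 -> r <= rho z -> H z + s * (c / 2) <= H (step s z).
Proof.
move=> r0; have c0 : 0 < c by rewrite /c divr_gt0 ?exprn_gt0// ltr_pwDr// exprn_gt0.
have n0 : 0 < (N * 2)%:R + 1 :> R by rewrite ltr_pwDr.
(* Summed over the [N * 2] entries, an error of this size costs at most half of the rate [c]; the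
   [+ 1] keeps the divisor positive when [N] is 0. *)
have eta0 : 0 < c / 2 / ((N * 2)%:R + 1) by apply: divr_gt0 => //; exact: divr_gt0.
have [e e0 He] := path_grad_uniform r0 eta0.
exists e => // s z /andP[s0 se] rz.
have cz : config z by apply: (clearance_config Omega_domain); exact: lt_le_trans rz.
have v1 : `|velocity z| <= 1.
  by apply: le_trans (velocity_le cz) _; have := clearance_le1 Omega z; lra.
have near_z t : 0 <= t <= s -> config (z + t *: velocity z) /\
    `|path_grad g Gamma (z + t *: velocity z) - path_grad g Gamma z| <= c / 2 / ((N * 2)%:R + 1).
  move=> /andP[t0 ts]; apply: He => //; rewrite addrAC subrr add0r normrZ ger0_norm//.
  by apply: le_trans (le_trans ts se); rewrite -[leRHS]mulr1 ler_wpM2l.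
have dH t : t \in `]0, s[ -> is_derive t 1 (fun t => H (z + t *: velocity z))
    (path_diff g Gamma (z + t *: velocity z) (velocity z)).
  rewrite in_itv /= => /andP[t0 ts]; apply: is_derive_path.
  by apply: (near_z t _).1; rewrite !ltW.
have cH : {within `[0, s], continuous (fun t => H (z + t *: velocity z))}.
  apply: derivable_within_continuous => t; rewrite in_itv /= => ts.
  by have [] := is_derive_path (near_z t ts).1.
have [t] := MVT s0 dH cH.
rewrite in_itv /= => /andP[t0 ts]; rewrite scale0r addr0 subr0 => E.
rewrite /step -lerBrDl E mulrC ler_pM2r//.
have [ct gt] : _ /\ _ := near_z t (introT andP (conj (ltW t0) (ltW ts))).
apply: (@le_trans _ _ (path_diff g Gamma z (velocity z) - (N * 2)%:R * (c / 2 / ((N * 2)%:R + 1)))).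
  have h1 := path_diff_velocity cz.
  have h2 : (N * 2)%:R * (c / 2 / ((N * 2)%:R + 1)) <= c / 2.
    have c2 : 0 <= c / 2 by apply: divr_ge0 => //; exact: ltW.
    rewrite mulrA ler_pdivrMr// [leRHS]mulrDr mulr1 [leLHS]mulrC.
    by move: c2; move: (c / 2) => x *; rewrite lerDl.
  by move: h1 h2; move: (path_diff _ _ _ _) ((N * 2)%:R * _) => *; lra.
rewrite lerBlDr addrC -lerBlDr.
rewrite (path_diff_grad Omega_domain HG Gamma _ cz) (path_diff_grad Omega_domain HG Gamma _ ct) -sumrB.
have term i j : velocity z i j * path_grad g Gamma z i j -
    velocity z i j * path_grad g Gamma (z + t *: velocity z) i j <= c / 2 / ((N * 2)%:R + 1).
  rewrite -mulrBr; apply: le_trans (ler_norm _) _; rewrite normrM -[leRHS]mul1r.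
  apply: ler_pM => //; first exact: le_trans (mx_entry_le_norm _ _ _) v1.
  rewrite distrC; apply: le_trans gt.
  by have := mx_entry_le_norm (path_grad g Gamma (z + t *: velocity z) - path_grad g Gamma z) i j; rewrite !mxE.
apply: (@le_trans _ _ (\sum_(i < N) \sum_(j < 2) c / 2 / ((N * 2)%:R + 1))).
  by apply: ler_sum => i _; rewrite -sumrB; apply: ler_sum => j _; exact: term.
by rewrite !sumr_const !card_ord -mulrnA mulr_natl mulnC.
Qed.

(** The time [T] is chosen so that the gain [T * c / 2] is [|b - a| + 1]. The admissible step size
    depends only on the clearance guaranteed until the end, [r * expR (- (4 * T))], which is known
    before [n] is chosen; so [n] and [s] serve all [z] at once. *)
Lemma flow_exceeds (r a b : R) : 0 < r -> exists n s, 0 < s <= 1 / 8 /\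
  forall z, r <= rho z -> a <= H z -> b < H (iter n (step s) z).
Proof.
move=> r0; have c0 : 0 < c by rewrite /c divr_gt0 ?exprn_gt0// ltr_pwDr// exprn_gt0.
pose T := (`|b - a| + 1) * 2 / c.
have T0 : 0 < T by rewrite divr_gt0// mulr_gt0// ltr_pwDr.
have [s0 s00 Hs0] := step_ascent (mulr_gt0 r0 (expR_gt0 (- (4 * T)))).
pose m := minr s0 (1 / 8); have m0 : 0 < m by rewrite lt_min s00 divr_gt0.
pose n := (truncn (T / m)).+1; pose s := T / n%:R.
have n0 : 0 < n%:R :> R by rewrite ltr0n.
have sm : s <= m.
  rewrite ler_pdivrMr// mulrC -ler_pdivrMr//; apply: ltW.
  by have := truncnS_gt (T / m).
have s1 : 0 < s by rewrite divr_gt0.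
have s8 : 0 <= s <= 1 / 8 by rewrite (ltW s1) (le_trans sm)// ge_min lexx orbT.
have sn : s * n%:R = T by rewrite divfK// gt_eqF.
exists n, s; split; first by rewrite s1; case/andP: s8.
move=> z rz az; have cz : config z by apply: (clearance_config Omega_domain); exact: lt_le_trans rz.
have low k : (k <= n)%N -> r * expR (- (4 * T)) <= rho (iter k (step s) z).
  move=> kn; apply: le_trans (clearance_iter_step k cz s8).
  have q0 : 0 <= 1 - 2 * s by case/andP: s8 => *; lra.
  rewrite mulrC; apply: ler_pM rz; rewrite ?expR_ge0 ?(ltW r0)//.
  apply: (@le_trans _ _ ((1 - 2 * s) ^+ n)); last by rewrite ler_wiXn2l//; lra.
  have -> : expR (- (4 * T)) = expR (- (4 * s)) ^+ n by rewrite -expRM_natl -sn; congr expR; ring.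
  rewrite ler_pXn2r ?nnegrE ?expR_ge0// expRN -[leLHS]mul1r ler_pdivrMr ?expR_gt0//.
  (* The product is [1 + 2 * s - 8 * s ^+ 2], at least 1 for [0 <= s <= 1 / 4]. *)
  apply: (@le_trans _ _ ((1 - 2 * s) * (1 + 4 * s))); first by case/andP: s8 => *; nra.
  by rewrite ler_wpM2l// expR_ge1Dx.
have up k : (k <= n)%N -> H z + k%:R * (s * (c / 2)) <= H (iter k (step s) z).
  elim: k => [|k IH kn]; first by rewrite mul0r addr0.
  have kn' : (k <= n)%N by exact: ltnW.
  rewrite iterS; apply: le_trans (Hs0 s _ _ (low k kn')); last by rewrite s1 (le_trans sm)// ge_min lexx.
  by rewrite -natr1 mulrDl mul1r addrA lerD2r IH.
apply: lt_le_trans (up n (leqnn n)).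
have -> : n%:R * (s * (c / 2)) = T * c / 2 by rewrite -sn; field.
rewrite /T divfK ?gt_eqF// mulfK//.
by have := ler_norm (b - a); move: az; move: (H z) (`|b - a|) => *; lra.
Qed.

End Flow.

(** * Angles along the flow *)

Section Angles.
Context {R : realType}.
Notation plane := 'rV[R]_2.

Definition dir (a : R) : plane := \row_j (if j == 0 then cos a else sin a).

Definition cross (u v : plane) : R := u 0 0 * v 0 1 - u 0 1 * v 0 0.

(** The signed angle from [u] to [v] when they are less than a right angle apart; as long as
    [0 < edot u v] it depends continuously on both. *)
Definition turn (u v : plane) : R := atan (cross u v / edot u v).

Lemma edot_dir a : edot (dir a) (dir a) = 1.
Proof. by rewrite edotE !mxE /= -!expr2 cos2Dsin2. Qed.

Lemma enorm_dir a : enorm (dir a) = 1.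
Proof. exact: enorm_unit (edot_dir a). Qed.

Lemma sin_atan (x : R) : sin (atan x) = x / Num.sqrt (1 + x ^+ 2).
Proof.
have c0 : cos (atan x) != 0.
  by rewrite cos_atan invr_eq0 gt_eqF// sqrtr_gt0 ltr_pwDl// sqr_ge0.
have -> : x / Num.sqrt (1 + x ^+ 2) = tan (atan x) * cos (atan x) by rewrite atanK cos_atan.
by rewrite /tan divfK.
Qed.

Lemma ltr_turn u v : `|turn u v| < pi / 2.
Proof. by rewrite ltr_norml atan_gtNpi2 atan_ltpi2. Qed.

Lemma turn_dir (u v : plane) a : u = enorm u *: dir a -> 0 < edot u v ->
  v = enorm v *: dir (a + turn u v).
Proof.
move=> uE uv0; have u0 : 0 < enorm u.
  by rewrite enorm_gt0; apply: contraTneq uv0 => ->; rewrite edot0l ltxx.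
have v0 : 0 < enorm v.
  by rewrite enorm_gt0; apply: contraTneq uv0 => ->; rewrite edot0r ltxx.
have uE0 : u 0 0 = enorm u * cos a by rewrite {1}uE !mxE.
have uE1 : u 0 1 = enorm u * sin a by rewrite {1}uE !mxE.
have v2 : enorm v ^+ 2 = v 0 0 ^+ 2 + v 0 1 ^+ 2 by rewrite sqr_enorm edotE !expr2.
have cs := cos2Dsin2 a.
(* The coordinates of [v] in the frame formed by [dir a] and its rotation by a right angle. *)
pose q := v 0 0 * cos a + v 0 1 * sin a; pose q' := v 0 1 * cos a - v 0 0 * sin a.
have dE : edot u v = enorm u * q by rewrite edotE uE0 uE1 /q; ring.
have cE : cross u v = enorm u * q' by rewrite /cross uE0 uE1 /q'; ring.
have q0 : 0 < q by move: uv0; rewrite dE pmulr_rgt0.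
have tE : cross u v / edot u v = q' / q.
  by rewrite cE dE; field; rewrite !gt_eqF.
have qq : q ^+ 2 + q' ^+ 2 = enorm v ^+ 2.
  have -> : q ^+ 2 + q' ^+ 2 = (v 0 0 ^+ 2 + v 0 1 ^+ 2) * (cos a ^+ 2 + sin a ^+ 2) by rewrite /q /q'; ring.
  by rewrite cs mulr1 v2.
have sE : Num.sqrt (1 + (q' / q) ^+ 2) = enorm v / q.
  have -> : 1 + (q' / q) ^+ 2 = (enorm v / q) ^+ 2.
    by rewrite !expr_div_n -qq; field; rewrite gt_eqF.
  by rewrite sqrtr_sqr ger0_norm// divr_ge0// ltW.
have E1 : enorm v * cos (turn u v) = q.
  by rewrite /turn tE cos_atan sE invf_div mulrCA divff ?mulr1// gt_eqF.
have E2 : enorm v * sin (turn u v) = q'.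
  by rewrite /turn tE sin_atan sE; field; rewrite !gt_eqF.
apply: rV2P; rewrite !mxE /= ?cosD ?sinD.
  rewrite mulrBr mulrCA E1 [enorm v * _]mulrCA E2 /q /q' -[LHS]mulr1 -cs; ring.
rewrite mulrDr mulrCA E1 [enorm v * _]mulrCA E2 /q /q' -[LHS]mulr1 -cs; ring.
Qed.

Variables (x0 : plane) (e : R).

(* With ratio 3 each leg is longer than all the earlier ones together, which
   keeps the points apart whatever the directions. *)
Definition walk (a : nat -> R) (i : nat) : plane :=
  x0 + \sum_(l < i) (e * 3 ^+ l) *: dir (a l).

Lemma walkS a i : walk a i.+1 = walk a i + (e * 3 ^+ i) *: dir (a i).
Proof. by rewrite /walk big_ord_recr addrA. Qed.

Hypothesis e0 : 0 < e.

Let e3 i : 0 < e * 3 ^+ i. Proof. by rewrite mulr_gt0// exprn_gt0. Qed.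

Lemma walk_le a i j : (i <= j)%N ->
  enorm (walk a j - walk a i) <= (e * 3 ^+ j - e * 3 ^+ i) / 2.
Proof.
move=> ij; rewrite -(subnKC ij); elim: (j - i)%N => [|k IH].
  by rewrite addn0 !subrr enorm0 mul0r.
rewrite addnS walkS (addrAC (walk a (i + k)) _ (- walk a i)); apply: le_trans (ler_enormD _ _) _.
rewrite enormZ enorm_dir mulr1 ger0_norm; last exact: ltW.
have -> : e * 3 ^+ (i + k).+1 = 3 * (e * 3 ^+ (i + k)) by rewrite exprS mulrCA.
move: IH; move: (e * 3 ^+ (i + k)) (e * 3 ^+ i) (enorm _) => x y w; lra.
Qed.

(** The last leg is longer than the distance covered since step [i] by at least
    [(e * 3 ^+ j + e * 3 ^+ i) / 2], where [j] is the index of that leg. *)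
Lemma walk_ge a i j : (i < j)%N -> e <= enorm (walk a j - walk a i).
Proof.
case: j => // j; rewrite ltnS => ij; have := walk_le a ij; rewrite walkS.
rewrite (addrAC (walk a j) _ (- walk a i)).
have i1 : e <= e * 3 ^+ i by rewrite ler_pMr// exprn_ege1// ler1n.
have j1 : e <= e * 3 ^+ j by rewrite ler_pMr// exprn_ege1// ler1n.
have : enorm ((e * 3 ^+ j) *: dir (a j)) = e * 3 ^+ j.
  by rewrite enormZ enorm_dir mulr1 ger0_norm// ltW.
move: ((e * 3 ^+ j) *: dir (a j)) (walk a j - walk a i) i1 j1 => u w.
move: (e * 3 ^+ j) (e * 3 ^+ i) => J I i1 j1 uE h.
have := ler_enormD (w + u) (- w); rewrite addrAC subrr add0r enormN uE.
move: (enorm w) (enorm (w + u)) h => *; lra.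
Qed.

End Angles.

Lemma cvg_mx (R : realType) (T : Type) (F : set_system T) {FF : Filter F} m n
    (f : T -> 'M[R]_(m, n)) (l : 'M[R]_(m, n)) :
  (forall i j, (fun t => f t i j) @ F --> (l i j : R)) -> f @ F --> l.
Proof.
move=> fl; apply/cvgrPdist_lt => e e0.
have h : \forall t \near F, forall i j, `|l i j - f t i j| < e.
  apply: filter_forall => i; apply: filter_forall => j.
  by move/cvgrPdist_lt : (fl i j); exact.
by apply: filterS h => t h; apply: mx_norm_lt => // i j; rewrite !mxE.
Qed.

Lemma walk_room (R : realType) (e D0 Dl w a b : R) : 0 < e -> D0 <= Dl + w -> w <= (a - e) / 2 ->
  a <= b -> e <= b -> 2 * b <= D0 -> e <= Dl.
Proof. move=> h1 h2 h3 h4 h5 h6. lra. Qed.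

(** * Collinear configurations among the moved chains *)

Section Collinear.
Context {R : realType}.
Notation plane := 'rV[R]_2.
Variables (Omega : set plane) (eps0 : R) (p : plane -> plane).
Hypotheses (Omega_domain : bounded_domain Omega).
Variables (G : plane -> plane -> R) (g : plane * plane -> R).
Hypothesis HG : hypothesis_G Omega eps0 p G g.
Variables (m : nat) (Gamma : 'rV[R]_m.+1) (k : 'S_m.+1).
Notation config := (config Omega : set 'M[R]_(m.+1, 2)).
Notation rho := (@clearance R Omega m.+1).
Notation step := (step Omega g Gamma).
Implicit Types (z : 'M[R]_(m.+1, 2)) (j : 'I_m) (theta : 'rV[R]_m).

(** Each velocity is at most the clearance in [enorm], so two of them differ by at most twice the
    distance of their points; for [s <= 1 / 8] the difference of the points then turns by less than
    a right angle. *)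
Lemma edot_step s z (a b : 'I_m.+1) : config z -> 0 <= s <= 1 / 8 -> a != b ->
  0 < edot (row a z - row b z) (row a (step s z) - row b (step s z)).
Proof.
move=> cz /andP[s0 s1] ab; have r0 := clearance_gt0 Omega_domain cz.
pose v := velocity Omega g Gamma z.
have -> : row a (step s z) - row b (step s z) = (row a z - row b z) - s *: (row b v - row a v).
  by rewrite /step -/v; apply/rowP => c; rewrite !mxE; ring.
rewrite edotBr edotZr -sqr_enorm.
have h1 := clearance_dist Omega z ab; have h2 := velocity_le Omega_domain g Gamma cz.
have h3 i : enorm (row i v) <= rho z.
  apply: le_trans (enorm_le_norm _) _; have := row_norm i v.
  by rewrite -/v in h2; move: h2; move: (`|v|) (`|row i v|) => *; lra.
have h4 : enorm (row b v - row a v) <= 2 * enorm (row a z - row b z).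
  apply: le_trans (ler_enormB _ _) _; have := h3 a; have := h3 b; move: h1; elra.
have h5 := ler_edot (row a z - row b z) (row b v - row a v).
have h6 := lt_le_trans r0 h1.
move: h4 h5 h6; move: (enorm (row a z - _)) (enorm (row b v - _)) (edot _ _) => x y q h4 h5 h6.
have h7 : x * y <= x * (2 * x) by rewrite ler_pM2l.
have h8 : s * q <= s * (x * (2 * x)) by rewrite ler_wpM2l// (le_trans h5).
apply: lt_le_trans (lerB (lexx _) h8).
have -> : x ^+ 2 - s * (x * (2 * x)) = x ^+ 2 * (1 - 2 * s) by ring.
by rewrite mulr_gt0 ?exprn_gt0//; lra.
Qed.

Definition edge z j := row (k (inord j.+1)) z - row (k (inord j)) z.

Lemma inord_neq j : k (inord j.+1) != k (inord j).
Proof.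
rewrite (inj_eq perm_inj); apply/eqP => /(congr1 (@nat_of_ord _)).
by rewrite !inordK ?ltnS// 1?ltnW// => /eqP; rewrite eqn_leq ltnn.
Qed.

Lemma edge_step s z j : config z -> 0 <= s <= 1 / 8 -> 0 < edot (edge z j) (edge (step s z) j).
Proof. by move=> cz s1; apply: edot_step => //; exact: inord_neq. Qed.

(** The abscissae are partial sums of the edge lengths, which are positive because consecutive
    points differ. *)
Lemma collinear_rows z (u : plane) : config z ->
  (forall j, edge z j = enorm (edge z j) *: u) ->
  exists2 r : 'I_m.+1 -> R, (forall i j : 'I_m.+1, (i < j)%N -> r i < r j) &
    forall i, row (k i) z = row (k ord0) z + r i *: u.
Proof.
move=> [_ zN] zE.
pose q l := row (k (inord l)) z; pose len l := enorm (q l.+1 - q l).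
have qS l : (l < m)%N -> q l.+1 = q l + len l *: u.
  by move=> lm; have := zE (Ordinal lm); rewrite /edge /= /len /q => <-; rewrite addrC subrK.
have qi (i : 'I_m.+1) : q i = row (k i) z by rewrite /q inord_val.
have qlen l : (l < m)%N -> 0 < len l.
  by move=> lm; rewrite enorm_gt0 subr_eq0; apply: zN; exact: (inord_neq (Ordinal lm)).
clearbody len; clear zE zN.
have qE l : (l <= m)%N -> q l = q 0%N + (\sum_(0 <= l' < l) len l') *: u.
  elim: l => [|l IH lm]; first by rewrite big_nil scale0r addr0.
  by rewrite big_nat_recr//= scalerDl addrA -IH ?qS// ltnW.
exists (fun i : 'I_m.+1 => \sum_(0 <= l < i) len l).
  move=> i j ij; rewrite (@big_cat_nat _ _ _ i 0 j)// 1?ltnW//= ltrDl big_ltn//.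
  have jm : (j <= m)%N by rewrite -ltnS.
  rewrite ltr_pwDl ?qlen ?(leq_trans ij)// big_nat sumr_ge0// => l /andP[_ lj].
  by rewrite ltW// qlen// (leq_trans lj).
by move=> i; rewrite -!qi -qE// -ltnS.
Qed.

Variables (x0 : plane) (e : R).
(** With [eD] the walk, which strays from [x0] by less than [e * 3 ^+ m / 2], stays at distance at
    least [e] from the complement; [e1] matches the cap in [clearance]. *)
Hypotheses (Ox0 : Omega x0) (e0 : 0 < e) (e1 : e <= 1)
  (eD : 2 * (e * 3 ^+ m) <= edist x0 (~` Omega)).

Definition angles theta (l : nat) : R := if insub l is Some j then theta 0 j else 0.

Definition start theta : 'M[R]_(m.+1, 2) :=
  \matrix_(i < m.+1) walk x0 e (angles theta) ((k^-1)%g i).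

Lemma edge_start theta j : edge (start theta) j = (e * 3 ^+ j) *: dir (theta 0 j).
Proof.
rewrite /edge !rowK !permK !inordK ?ltnS// 1?ltnW// walkS addrAC subrr add0r.
by rewrite /angles valK.
Qed.

Lemma clearance_start theta : e <= rho (start theta).
Proof.
apply: le_bigmin => // -[i j] _; rewrite /gap /=; have [_|ij] := eqVneq i j.
  rewrite rowK; set l := (k^-1)%g i.
  have lm : (l <= m)%N by rewrite -ltnS.
  have := edist_lipschitz x0 (walk x0 e (angles theta) l) (setC_domain_neq0 Omega_domain).
  rewrite enormB => h1; have h2 := walk_le x0 e0 (angles theta) (leq0n l).
  rewrite expr0 mulr1 in h2; have h3 : e * 3 ^+ l <= e * 3 ^+ m by rewrite ler_pM2l// ler_weXn2l// ler1n.
  have h4 : e <= e * 3 ^+ m by rewrite ler_pMr// exprn_ege1// ler1n.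
  have walk0 : walk x0 e (angles theta) 0 = x0 by rewrite /walk big_ord0 addr0.
  rewrite walk0 in h2.
  exact: walk_room e0 h1 h2 h3 h4 eD.
rewrite !rowK.
have : ((k^-1)%g i != (k^-1)%g j :> nat) by rewrite (inj_eq val_inj) (inj_eq perm_inj).
by rewrite neq_ltn => /orP[] h; [rewrite enormB|]; exact: walk_ge.
Qed.

Lemma config_start theta : config (start theta).
Proof. by apply: (clearance_config Omega_domain); exact: lt_le_trans (clearance_start theta). Qed.

Lemma start_continuous : continuous start.
Proof.
move=> theta; have FF := nbhs_filter theta; apply: (@cvg_mx _ _ _ FF) => i c.
set l := nat_of_ord ((k^-1)%g i).
have ac n : (fun theta => angles theta n) @ nbhs theta --> (angles theta n : R).
  rewrite /angles; case: insub => [j|]; last exact: (@cvg_cst R 0 _ (nbhs theta) FF).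
  exact: (@coord_continuous R 1 m 0 j theta).
have dc n : (fun theta => dir (angles theta n) 0 c) @ nbhs theta --> (dir (angles theta n) 0 c : R).
  have -> : (fun theta => dir (angles theta n) 0 c) = (fun x => if c == 0 then cos x else sin x) \o (angles ^~ n).
    by apply/funext => th; rewrite mxE.
  rewrite mxE; apply: (cvg_comp _ _ (ac n)); case: (c == 0); [exact: continuous_cos | exact: continuous_sin].
have stE th : start th i c = x0 0 c + \sum_(n < l) (e * 3 ^+ n) * dir (angles th n) 0 c.
  by rewrite /start mxE /walk mxE summxE; congr (_ + _); apply: eq_bigr => n _; rewrite mxE.
rewrite stE; under eq_fun do rewrite stE.
apply: (@cvgD R R _ (nbhs theta) FF _ _ _ _ (@cvg_cst R _ _ (nbhs theta) FF)).
apply: (@cvg_sum R _ (nbhs theta) FF _ xpredT (fun (n : 'I_l) th => (e * 3 ^+ n) * dir (angles th n) 0 c)) => n _.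
exact: (@cvgM R _ (nbhs theta) FF _ _ _ _ (@cvg_cst R _ _ (nbhs theta) FF) (dc n)).
Qed.

Variable s : R.
Hypothesis s1 : 0 <= s <= 1 / 8.

Definition moved n theta := iter n (step s) (start theta).

Lemma config_moved n theta : config (moved n theta).
Proof. by apply: config_iter_step => //; exact: config_start. Qed.

Lemma moved_continuous n : continuous (moved n).
Proof.
move=> theta; elim: n => [|n IH]; first exact: start_continuous.
exact: cvg_comp _ _ IH (step_continuous Omega_domain HG (config_moved n theta)).
Qed.

(** A continuous real-valued lift of the direction of edge [j], accumulated from the turns of the
    single steps. *)
Fixpoint angle n j theta : R :=
  if n is n'.+1 then angle n' j theta + turn (edge (moved n' theta) j) (edge (moved n'.+1 theta) j)
  else theta 0 j.

Lemma edge_angle n j theta :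
  edge (moved n theta) j = enorm (edge (moved n theta) j) *: dir (angle n j theta).
Proof.
elim: n => [|n IH] /=.
  by rewrite edge_start enormZ enorm_dir mulr1 ger0_norm// ltW// mulr_gt0// exprn_gt0.
by apply: turn_dir => //; apply: edge_step => //; exact: config_moved.
Qed.

Lemma angle_bound n j theta : `|angle n j theta - theta 0 j| <= n%:R * (pi / 2).
Proof.
elim: n => [|n IH] /=; first by rewrite subrr normr0 mul0r.
rewrite addrAC; apply: le_trans (ler_normD _ _) _; rewrite -natr1 mulrDl mul1r lerD//.
exact: ltW (ltr_turn _ _).
Qed.

Lemma angle_continuous n j : continuous (angle n j).
Proof.
elim: n => [|n IH] theta /=; first exact: coord_continuous.
have FF := nbhs_filter theta.
have ec n' : (fun theta => edge (moved n' theta) j) @ nbhs theta --> edge (moved n' theta) j.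
  have rc i : (fun theta => row i (moved n' theta)) @ nbhs theta --> row i (moved n' theta).
    exact: cvg_comp _ _ (@moved_continuous n' theta) (@row_continuous R m.+1 2 i (moved n' theta)).
  exact: (@cvgB _ _ _ (nbhs theta) FF _ _ _ _ (rc _) (rc _)).
have dc n' (c : 'I_2) : (fun theta => edge (moved n' theta) j 0 c) @ nbhs theta --> (edge (moved n' theta) j 0 c : R).
  exact: cvg_comp _ _ (ec n') (@coord_continuous R 1 2 0 c (edge (moved n' theta) j)).
have d0 : edot (edge (moved n theta) j) (edge (moved n.+1 theta) j) != 0.
  by rewrite gt_eqF//; apply: edge_step => //; exact: config_moved.
have M := @cvgM R _ (nbhs theta) FF.
have cc := @cvgB R R _ (nbhs theta) FF _ _ _ _ (M _ _ _ _ (dc n 0) (dc n.+1 1)) (M _ _ _ _ (dc n 1) (dc n.+1 0)).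
have qc := M _ _ _ _ cc (@cvgV _ _ (nbhs theta) FF _ _ d0 (cvg_edot FF (ec n) (ec n.+1))).
have tc := cvg_comp _ _ qc (@continuous_atan R _).
exact: (@cvgD R R _ (nbhs theta) FF _ _ _ _ (@IH theta) tc).
Qed.

Lemma exists_collinear n : exists theta, exists2 r : 'I_m.+1 -> R,
  (forall i j : 'I_m.+1, (i < j)%N -> r i < r j) &
  forall i, row (k i) (moved n theta) = row (k ord0) (moved n theta) + r i *: dir 0.
Proof.
(* The total drift is at most [n%:R * (pi / 2)]; one unit more ensures that for [theta 0 j] equal to
   the bound or its opposite the angle has the sign of [theta 0 j]. *)
have pi0 := @pi_ge0 R; have B0 : 0 < n%:R * (pi / 2) + 1 :> R.
  by rewrite ltr_wpDl// mulr_ge0// divr_ge0.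
have [||theta th0] := poincare_miranda (F := angle n) B0 (fun j => @angle_continuous n j).
- move=> j x _ xj; have := angle_bound n j x; rewrite xj ler_norml => /andP[_].
  by move: (angle _ _ _) (n%:R * _) => *; lra.
- move=> j x _ xj; have := angle_bound n j x; rewrite xj ler_norml => /andP[+ _].
  by move: (angle _ _ _) (n%:R * _) => *; lra.
exists theta; apply: collinear_rows; first exact: config_moved.
by move=> j; rewrite -(th0 j); exact: edge_angle.
Qed.

End Collinear.

(** This gives all starting chains a common lower bound, whatever their angles: their clearance is
    at least [e]. *)
Lemma path_lower_bound (R : realType) (Omega : set 'rV[R]_2) (eps0 : R) (p : 'rV[R]_2 -> 'rV[R]_2)
    (G : 'rV[R]_2 -> 'rV[R]_2 -> R) (g : 'rV[R]_2 * 'rV[R]_2 -> R) (N : nat) (Gamma : 'rV[R]_N) (r : R) :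
  bounded_domain Omega -> hypothesis_G Omega eps0 p G g -> 0 < r ->
  exists a : R, forall z : 'M[R]_(N, 2), r <= clearance Omega z -> a <= path_function Gamma G g z.
Proof.
move=> Omega_domain HG r0; set H := path_function Gamma G g.
have [||M HM] := @compact_bound R _ [set z : 'M[R]_(N, 2) | r <= clearance Omega z]
  (fun M z => - M <= H z) (compact_clearance Omega_domain r0); last by exists (- M).
  by move=> M M' z MM'; apply: le_trans; rewrite lerN2.
move=> z rz; have cz : config Omega z by apply: (clearance_config Omega_domain); exact: lt_le_trans rz.
have Hc : H @ nbhs z --> H z.
  by case: (is_diff_path Omega_domain HG Gamma cz) => dH _; exact: differentiable_continuous dH.
exists (1 - H z).
have h : nbhs z [set z' | `|H z - H z'| < 1] by exact: (iffLR (@cvgrPdist_lt _ _ _ (nbhs z) _ _ _) Hc).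
apply: (@filterS _ (nbhs z) (nbhs_filter z) _ _ _ h) => z' /=.
by rewrite ltr_norml => /andP[_]; move: (H z) (H z') => *; lra.
Qed.

Theorem theorem2p12 (R : realType) (Omega : set 'rV[R]_2)
  (Omega_domain : bounded_domain Omega) (Omega_C3 : Ck_boundary 3 Omega)
  (eps0 : R) (eps0_gt0 : 0 < eps0) (p : 'rV[R]_2 -> 'rV[R]_2)
  (p_proj : boundary_projection Omega eps0 p)
  (G : 'rV[R]_2 -> 'rV[R]_2 -> R) (g : 'rV[R]_2 * 'rV[R]_2 -> R)
  (HG : hypothesis_G Omega eps0 p G g)
  (N : nat) (Gamma : 'rV[R]_N)
  (Gamma_L : L_admissible Gamma)
  (Gamma_boundary : boundary_admissible Omega Gamma)
  (Gamma_Delta : Delta_admissible Gamma) :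
  exists z : 'M[R]_(N, 2),
    config Omega z /\ critical_point (path_function Gamma G g) z.
Proof.
apply: contrapT => nocrit.
have grad0 z : config Omega z -> path_grad g Gamma z != 0.
  move=> cz; apply/eqP => g0; apply: nocrit; exists z; split => //.
  by have := critical_path Omega_domain HG cz g0.
have [d d0 grad_low] := gradient_lower_bound Omega_domain eps0_gt0 Omega_C3 p_proj HG
  Gamma_L Gamma_boundary Gamma_Delta grad0.
case: N Gamma Gamma_L {Gamma_boundary Gamma_Delta nocrit} grad0 grad_low => [|m] Gamma Gamma_L grad0 grad_low.
  (* Without points, the empty configuration is admissible and its gradient is an empty matrix,
     hence zero. *)
  have c0 : config Omega (0 : 'M[R]_(0, 2)) by split => -[].
  by have := grad0 0 c0; rewrite (flatmx0 (path_grad _ _ _)) eqxx.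
have [k [t [t0 tmono Gt]]] := L_admissibleP Gamma_L.
have [x0 Ox0] : Omega !=set0 by case: Omega_domain.
have Dx0 := domain_edist_gt0 Omega_domain Ox0.
have m0 : 0 < 2 * 3 ^+ m :> R by rewrite mulr_gt0// exprn_gt0.
pose e := minr 1 (edist x0 (~` Omega) / (2 * 3 ^+ m)).
have e0 : 0 < e by rewrite lt_min ltr01 divr_gt0.
have e1 : e <= 1 by rewrite ge_min lexx.
have eD : 2 * (e * 3 ^+ m) <= edist x0 (~` Omega).
  by rewrite mulrCA -ler_pdivlMr// ge_min lexx orbT.
have [a Ha] := path_lower_bound Gamma Omega_domain HG e0.
have [b Hb] := path_upper_bound Omega_domain eps0_gt0 Omega_C3 p_proj HG t0 tmono Gt.
(* [n] and [s] are fixed before [theta]: the bounds [a] and [b] hold for all starting chains and for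
   all collinear configurations, respectively. *)
have [n [s [/andP[s0 s1] Hn]]] := flow_exceeds Omega_domain HG d0 grad_low a b e0.
have s01 : 0 <= s <= 1 / 8 by rewrite ltW.
have [theta [r rmono rE]] := exists_collinear Omega_domain HG Gamma k e0 e1 eD s01 n.
have es := clearance_start Omega_domain k e0 e1 eD theta.
have := Hn _ es (Ha _ es); rewrite ltNge => /negP; apply.
exact: Hb (config_moved Omega_domain _ _ _ e0 e1 eD s01 n theta) (enorm_dir 0) rmono rE.
Qed.
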